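(* Let \(G\) be a finite simple connected graph with maximum degree \(\Delta(G)\leq 4\) that is not isomorphic to the octahedral graph \(O_{3}\). Then: (1) \(\mathrm{Cl}(G)\) is homotopy equivalent to a wedge of circumferences (circles); (2) \(G\) is homotopy \(K\)-permanent, i.e. \(\mathrm{Cl}(K^{n}(G))\simeq \mathrm{Cl}(G)\) for all \(n\geq 1\).
   Context: All graphs are finite and simple. A clique of a graph is a maximal complete subgraph. The clique graph \(K(G)\) is the intersection graph of the cliques of \(G\); iterated clique graphs are \(K^{0}(G)=G\), \(K^{n}(G)=K(K^{n-1}(G))\). \(\mathrm{Cl}(G)\) is the simplicial complex whose simplices are the (vertex sets of) complete subgraphs of \(G\); graphs \(G_1,G_2\) are called homotopic (\(G_1\simeq G_2\)) when \(\mathrm{Cl}(G_1)\) and \(\mathrm{Cl}(G_2)\) are homotopy equivalent. The octahedral graph \(O_{3}\) is the complement of the disjoint union of three edges. A wedge of circumferences may be empty (i.e. a point). *)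

(* Defs.v *)
From HB Require Import structures.
From mathcomp Require Import all_boot all_order all_algebra.
From mathcomp Require Import all_classical all_reals all_analysis homotopy.

Set Implicit Arguments.
Unset Strict Implicit.
Unset Printing Implicit Defensive.

Import Order.TTheory GRing.Theory Num.Theory.
Import numFieldNormedType.Exports.

Local Open Scope classical_set_scope.
Local Open Scope ring_scope.

Record sgraph := SGraph {
  vertex :> finType;
  adj : rel vertex;
  adj_sym : symmetric adj;
  adj_irrefl : irreflexive adj }.

Definition graph_iso (G H : sgraph) : Prop :=
  exists2 f : G -> H, bijective f & forall x y, adj (f x) (f y) = adj x y.

(* The graph without vertices is not connected. *)
Definition graph_connected (G : sgraph) : Prop :=
  (0 < #|G|)%N /\ forall x y : G, connect (@adj G) x y.

Definition degree (G : sgraph) (x : G) : nat := #|[pred y | adj x y]|.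

Definition max_degree (G : sgraph) : nat := (\max_(x : G) degree x)%N.

Section complement.
Variable G : sgraph.

Definition compl_adj : rel G := [rel x y | (x != y) && ~~ adj x y].

Lemma compl_adj_sym : symmetric compl_adj.
Proof. by move=> x y; rewrite /compl_adj /= eq_sym adj_sym. Qed.

Lemma compl_adj_irrefl : irreflexive compl_adj.
Proof. by move=> x; rewrite /compl_adj /= eqxx. Qed.

Definition compl_graph : sgraph := SGraph compl_adj_sym compl_adj_irrefl.

End complement.

(* Vertices (i, b) : 'I_n * bool; the i-th edge joins (i, false) to (i, true). *)
Section disjoint_edges.
Variable n : nat.

Definition edges_adj : rel ('I_n * bool) :=
  [rel x y | (x.1 == y.1) && (x.2 != y.2)].

Lemma edges_adj_sym : symmetric edges_adj.
Proof. by move=> x y; rewrite /edges_adj /= eq_sym [x.2 == _]eq_sym. Qed.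

Lemma edges_adj_irrefl : irreflexive edges_adj.
Proof. by move=> x; rewrite /edges_adj /= !eqxx. Qed.

Definition disjoint_edges : sgraph := SGraph edges_adj_sym edges_adj_irrefl.

End disjoint_edges.

Definition octahedral_graph (n : nat) : sgraph := compl_graph (disjoint_edges n).

(* Vertex sets of the (nonempty) complete subgraphs. *)
Definition complete_sub (G : sgraph) : pred {set G} :=
  [pred A : {set G} |
    (A != finset.set0) && [forall x in A, forall y in A, (x != y) ==> adj x y]].

Section clique_graph.
Variable G : sgraph.

Definition clique : pred {set G} := [pred A | maxset (@complete_sub G) A].

Definition clique_adj : rel {A : {set G} | clique A} :=
  [rel A B | (A != B) && (val A :&: val B != finset.set0)%SET].

Lemma clique_adj_sym : symmetric clique_adj.
Proof. by move=> A B; rewrite /clique_adj /= eq_sym finset.setIC. Qed.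

Lemma clique_adj_irrefl : irreflexive clique_adj.
Proof. by move=> A; rewrite /clique_adj /= eqxx. Qed.

Definition clique_graph : sgraph := SGraph clique_adj_sym clique_adj_irrefl.

End clique_graph.

Definition iter_clique_graph (n : nat) (G : sgraph) : sgraph :=
  iter n clique_graph G.

Definition Cl (G : sgraph) : {set {set G}} := [set A | complete_sub A]%SET.

(* Geometric realization, in barycentric coordinates, of the simplicial complex
   on the vertex set V whose set of nonempty simplices is S. *)
Definition realization (R : realType) (V : finType) (S : {set {set V}}) :
    set {ptws V -> R} :=
  [set x | [/\ forall v, 0 <= x v, \sum_v x v = 1 &
               [set v | x v != 0]%SET \in S]].
Arguments realization R {V} S.

Definition Cl_space (R : realType) (G : sgraph) : topologicalType :=
  set_type (realization R (Cl G)).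

Definition homotopic_maps (R : realType) (X Y : topologicalType)
    (f g : X -> Y) : Prop :=
  exists H : X * R -> Y,
    [/\ {within [set: X] `*` `[0, 1], continuous H},
        forall x, H (x, 0) = f x & forall x, H (x, 1) = g x].

Definition homotopy_equivalent (R : realType) (X Y : topologicalType) : Prop :=
  exists (f : X -> Y) (g : Y -> X),
    [/\ continuous f, continuous g,
        homotopic_maps R (g \o f) idfun & homotopic_maps R (f \o g) idfun].

Definition homotopic_graphs (R : realType) (G1 G2 : sgraph) : Prop :=
  homotopy_equivalent R (Cl_space R G1) (Cl_space R G2).

Definition homotopy_K_permanent (R : realType) (G : sgraph) : Prop :=
  forall n : nat, (1 <= n)%N -> homotopic_graphs R (iter_clique_graph n G) G.

Section circle.
Variable R : realType.

Definition circle : set (R * R) := [set p | p.1 ^+ 2 + p.2 ^+ 2 = 1].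

Lemma circle_base_subproof : ((1, 0) : R * R) \in circle.
Proof. by apply/mem_set; rewrite /circle /= expr1n expr0n addr0. Qed.

Definition circle_base : circle := exist _ (1, 0) circle_base_subproof.

End circle.

(* The library's wedge of an empty family is the empty space, whence the
   separate case; the wedge of no circles is a point. *)
Definition wedge_of_circles (R : realType) (n : nat) : topologicalType :=
  if n is m.+1 then
    wedge (X := fun _ : 'I_m.+1 => set_type (@circle R)) (fun=> circle_base R)
  else set_type [set (0 : R)].

(* Main.v *)
(** Explicit formulas give three homotopy equivalences between realizations:
    straight-line homotopies; Dowker duality, from the map sending [x] to the
    weights [max x - max_(v not related to k) x v]; and the deletion of the star
    of a simplex [tau] whose link is a cone.

    Part (1). If no edge of a triangle is dominated (its ends having a common
    neighbour adjacent to all the others), then maximum degree four forces an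
    octahedron. Deleting dominated edges thus leads to a triangle-free graph,
    that is, to a one-dimensional complex, whose non-tree edges are slid along a
    spanning tree to its root until only loops at the root remain.

    Part (2). Call [H] sun-local if every family of pairwise intersecting cliques
    without a common vertex consists of the three outer triangles, and possibly
    the central one, of a sun whose central vertices have degree four. Low degree
    graphs are sun-local. For a sun-local graph, [Cl (K H)] is the nerve of the cliques (equivalent to [Cl H]
    by duality) plus, for each sun, the simplex on its outer triangles, for which
    the central triangle is a cone point; hence [K H] and [H] are homotopic.
    Moreover a minimal set [M] of cliques dominating all cliques is again
    sun-local, and domination is preserved by [K], so that
    [K^(n+1) H ~ K^n M ~ M ~ K H ~ H] by induction on [n]. *)

Require Import Defs.
From HB Require Import structures.
From mathcomp Require Import all_boot all_order all_algebra.
From mathcomp Require Import all_classical all_reals all_analysis homotopy.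
From mathcomp Require Import lra.

Set Implicit Arguments.
Unset Strict Implicit.
Unset Printing Implicit Defensive.

Import Order.TTheory GRing.Theory Num.Theory.
Import numFieldNormedType.Exports.

Local Open Scope classical_set_scope.
Local Open Scope ring_scope.

(** * Homotopies *)

(** Degree bounds do not pass to [clique_graph], so part (2) needs a class of graphs that is stable
    under K up to domination. Sun-locality restricts only the clique families without a common
    vertex, which are exactly what separates Cl (K H) from the nerve. In part (2) the exclusion of
    octahedra says that some two outer vertices of a sun are nonadjacent; an outer triangle then
    meets every clique that meets the central one, so a minimal dominating set containing the three
    outer triangles omits the centre. The degree bounds that [good_sun] puts on adjacent outer
    vertices are there because a sun one level up is centred at cliques through such vertices.
    Homotopies are never glued along subcomplexes: each equivalence is a pair of maps whose round
    trips either equal the identity or share a simplex with it. In part (1) the spanning tree is not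
    contracted, because a loop at one vertex is not simplicial; each remaining edge becomes a
    three-edge ear, whose inner vertices are reserved in advance so that the vertex type never
    changes. *)

Lemma continuous_to_set_type (X Y : topologicalType) (A : set Y)
    (f : X -> set_type A) :
  continuous (set_val \o f) -> continuous f.
Proof.
move=> cf; apply/continuousP => _ [B oB <-].
by rewrite -comp_preimage; move/continuousP: cf => /(_ B oB).
Qed.

Lemma continuous_to_ptws (X Y : topologicalType) (I : eqType)
    (f : X -> {ptws I -> Y}) :
  (forall i, continuous (fun x => f x i)) -> continuous f.
Proof.
move=> cf x; apply/cvg_sup => i U /= [_ [[B oB <-]] Bfx sBU].
have /(cf i x) : nbhs (f x i) B by apply: open_nbhs_nbhs.
move=> fB; apply: (@filterS _ _ _ ((fun y => f y i) @^-1` B)) fB.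
by move=> y; exact: sBU.
Qed.

Lemma set_val_continuous (X : topologicalType) (A : set X) :
  continuous (@set_val X A : set_type A -> X).
Proof. exact: initial_continuous. Qed.

Lemma continuous_pair (X Y Z : topologicalType) (f : X -> Y) (g : X -> Z) :
  continuous f -> continuous g -> continuous (fun x => (f x, g x)).
Proof. by move=> cf cg x; apply: cvg_pair; [exact: cf|exact: cg]. Qed.

Lemma continuous_fst (X Y : topologicalType) : continuous (@fst X Y).
Proof. by move=> x; exact: cvg_fst. Qed.

Lemma continuous_snd (X Y : topologicalType) : continuous (@snd X Y).
Proof. by move=> x; exact: cvg_snd. Qed.

Lemma continuous_compT (X Y Z : topologicalType) (f : X -> Y) (g : Y -> Z) :
  continuous f -> continuous g -> continuous (g \o f).
Proof. by move=> cf cg x; apply: continuous_comp; [exact: cf|exact: cg]. Qed.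

Section continuous_real.
Variables (R : realType) (X : topologicalType).
Implicit Types f g : X -> R.

Lemma continuousDT f g :
  continuous f -> continuous g -> continuous (fun x => f x + g x).
Proof. by move=> cf cg x; apply: (@cvgD _ R^o); [exact: cf|exact: cg]. Qed.

Lemma continuousNT f : continuous f -> continuous (fun x => - f x).
Proof. by move=> cf x; apply: (@cvgN _ R^o); exact: cf. Qed.

Lemma continuousBT f g :
  continuous f -> continuous g -> continuous (fun x => f x - g x).
Proof. by move=> cf cg; apply: continuousDT => //; exact: continuousNT. Qed.

Lemma continuousMT f g :
  continuous f -> continuous g -> continuous (fun x => f x * g x).
Proof. by move=> cf cg x; apply: cvgM; [exact: cf|exact: cg]. Qed.

Lemma continuousVT f :
  (forall x, f x != 0) -> continuous f -> continuous (fun x => (f x)^-1).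
Proof. by move=> f0 cf x; apply: cvgV; [exact: f0|exact: cf]. Qed.

Lemma continuous_cstT (c : R) : continuous (fun _ : X => c).
Proof. by move=> x; exact: cvg_cst. Qed.

Lemma continuous_minT f g :
  continuous f -> continuous g -> continuous (fun x => Num.min (f x) (g x)).
Proof.
by move=> cf cg x; apply: (@continuous_min _ _ f g); [exact: cf|exact: cg].
Qed.

Lemma continuous_maxT f g :
  continuous f -> continuous g -> continuous (fun x => Num.max (f x) (g x)).
Proof.
by move=> cf cg x; apply: (@continuous_max _ _ f g); [exact: cf|exact: cg].
Qed.

Lemma continuous_bigT (I : Type) (op : R -> R -> R) (x0 : R) (r : seq I)
    (P : pred I) (F : I -> X -> R) :
  (forall f g, continuous f -> continuous g ->
     continuous (fun x => op (f x) (g x))) ->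
  (forall i, continuous (F i)) ->
  continuous (fun x => \big[op/x0]_(i <- r | P i) F i x).
Proof.
move=> cop cF; elim: r => [|i r IH].
  by under eq_fun do rewrite big_nil; exact: continuous_cstT.
under eq_fun do rewrite big_cons.
by case: (P i) => //; exact: cop.
Qed.

End continuous_real.

Section homotopy.
Variable R : realType.
Implicit Types X Y Z W : topologicalType.

Definition clamp01 (t : R) : R := Num.max 0 (Num.min 1 t).

Lemma clamp01_ge0 t : 0 <= clamp01 t.
Proof. by rewrite le_max lexx. Qed.

Lemma clamp01_le1 t : clamp01 t <= 1.
Proof. by rewrite ge_max ler01 ge_min lexx. Qed.

Lemma clamp010 : clamp01 0 = 0.
Proof. by rewrite /clamp01 min_r ?ler01 // maxxx. Qed.

Lemma clamp011 : clamp01 1 = 1.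
Proof. by rewrite /clamp01 minxx max_r ?ler01. Qed.

Lemma continuous_clamp01 X (f : X -> R) :
  continuous f -> continuous (fun x => clamp01 (f x)).
Proof.
move=> cf; apply: continuous_maxT; first exact: continuous_cstT.
by apply: continuous_minT => //; exact: continuous_cstT.
Qed.

(** Precomposition with the retraction [clamp01] of the line onto the unit interval trades
    continuity on the strip for plain continuity, so that homotopies compose without subspace
    topologies. *)
Lemma homotopic_mapsP X Y (f g : X -> Y) :
  homotopic_maps R f g <->
  exists H : X * R -> Y,
    [/\ continuous H, forall x, H (x, 0) = f x & forall x, H (x, 1) = g x].
Proof.
split=> [[H [cH H0 H1]]|[H [cH H0 H1]]]; last first.
  by exists H; split => //; exact: continuous_subspaceT.
have clampP (p : X * R) : (p.1, clamp01 p.2) \in [set: X] `*` `[0, 1].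
  apply/mem_set; split => //=; rewrite in_itv /=.
  by rewrite clamp01_ge0 clamp01_le1.
pose c (p : X * R) : set_type ([set: X] `*` `[0, 1]) := SigSub (clampP p).
exists (fun p => H (p.1, clamp01 p.2)); split.
- have -> : (fun p => H (p.1, clamp01 p.2)) =
      sigL ([set: X] `*` `[0, 1]) H \o c by apply/funext.
  apply: continuous_compT; last exact/subspace_sigL_continuousP.
  apply: continuous_to_set_type; apply: continuous_pair.
    exact: continuous_fst.
  apply: continuous_clamp01; exact: continuous_snd.
- by move=> x; rewrite /= clamp010 H0.
- by move=> x; rewrite /= clamp011 H1.
Qed.

Lemma homotopic_maps_refl X Y (f : X -> Y) :
  continuous f -> homotopic_maps R f f.
Proof.
move=> cf; apply/homotopic_mapsP; exists (f \o fst); split => //.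
by apply: continuous_compT => //; exact: continuous_fst.
Qed.

Lemma homotopic_maps_trans X Y (f g h : X -> Y) :
  homotopic_maps R f g -> homotopic_maps R g h -> homotopic_maps R f h.
Proof.
move=> /homotopic_mapsP[H [cH H0 H1]] /homotopic_mapsP[K [cK K0 K1]].
apply/homotopic_mapsP.
pose L (p : X * R) :=
  if p.2 <= 2^-1 then H (p.1, 2 * p.2) else K (p.1, 2 * p.2 - 1).
have half : (2^-1 : R) + 2^-1 = 1 by lra.
exists L; split; last 2 first.
- by move=> x; rewrite /L /= invr_ge0 ler0n mulr0.
- move=> x; rewrite /L /= ifF; last by apply/negbTE; rewrite -ltNge; lra.
  by rewrite -K1; congr (K (_, _)); lra.
(* The two closed half-strips cover the product, and both formulas give [g] on their common
   boundary. *)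
pose A := [set p : X * R | p.2 <= 2^-1].
pose B := [set p : X * R | 2^-1 <= p.2].
have cA : closed A.
  rewrite (_ : A = snd @^-1` [set t | t <= 2^-1]) //.
  apply: closed_comp; last exact: closed_le.
  by move=> p _; exact: continuous_snd.
have cB : closed B.
  rewrite (_ : B = snd @^-1` [set t | t >= 2^-1]) //.
  apply: closed_comp; last exact: closed_ge.
  by move=> p _; exact: continuous_snd.
have AB : A `|` B = setT.
  by rewrite -subTset => p _; have [] := leP p.2 2^-1; [left|move/ltW; right].
have c2 : continuous (fun p : X * R => 2 * p.2).
  by apply: continuousMT; [exact: continuous_cstT|exact: continuous_snd].
have cHA : continuous (fun p : X * R => H (p.1, 2 * p.2)).
  apply: (@continuous_compT _ _ _ (fun p : X * R => (p.1, 2 * p.2))) => //.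
  by apply: continuous_pair => //; exact: continuous_fst.
have cKB : continuous (fun p : X * R => K (p.1, 2 * p.2 - 1)).
  apply: (@continuous_compT _ _ _ (fun p : X * R => (p.1, 2 * p.2 - 1))) => //.
  apply: continuous_pair; first exact: continuous_fst.
  by apply: continuousBT => //; exact: continuous_cstT.
have : {within A `|` B, continuous L}.
  apply: withinU_continuous => //.
    apply: (@subspace_eq_continuous _ _ _ (fun p : X * R => H (p.1, 2 * p.2))).
      by move=> p /set_mem pA; rewrite /from_subspace /L; case: ifPn => // /negP[]; exact: pA.
    exact: continuous_subspaceT.
  apply: (@subspace_eq_continuous _ _ _ (fun p : X * R => K (p.1, 2 * p.2 - 1))).
    move=> p /set_mem; rewrite /B /= => pB; rewrite /from_subspace /L; case: ifP => // pA.
    have -> : p.2 = 2^-1 by apply/eqP; rewrite eq_le pA pB.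
    rewrite mulfV ?pnatr_eq0 // subrr.
    by rewrite -[1]/(1%:R) H1 K0.
  exact: continuous_subspaceT.
rewrite AB => cL; exact/continuous_subspace_setT.
Qed.

Lemma homotopic_maps_comp X Y Z W (f g : X -> Y) (h : Y -> Z) (k : W -> X) :
  continuous h -> continuous k -> homotopic_maps R f g ->
  homotopic_maps R (h \o f \o k) (h \o g \o k).
Proof.
move=> ch ck /homotopic_mapsP[H [cH H0 H1]]; apply/homotopic_mapsP.
exists (fun p => h (H (k p.1, p.2))); split => [|x|x] /=; rewrite ?H0 ?H1 //.
apply: (@continuous_compT _ _ _ (fun p : W * R => H (k p.1, p.2))) => //.
apply: (@continuous_compT _ _ _ (fun p : W * R => (k p.1, p.2))) => //.
apply: continuous_pair; last exact: continuous_snd.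
by apply: (@continuous_compT _ _ _ fst) => //; exact: continuous_fst.
Qed.

Lemma homotopy_equivalent_refl X : homotopy_equivalent R X X.
Proof.
have cid : continuous (@idfun X) by move=> x; exact: cvg_id.
by exists idfun, idfun; split => //; exact: homotopic_maps_refl.
Qed.

Lemma homotopy_equivalent_sym X Y :
  homotopy_equivalent R X Y -> homotopy_equivalent R Y X.
Proof. by move=> [f [g [cf cg gf fg]]]; exists g, f. Qed.

Lemma homotopy_equivalent_trans Y X Z :
  homotopy_equivalent R X Y -> homotopy_equivalent R Y Z ->
  homotopy_equivalent R X Z.
Proof.
move=> [f [g [cf cg gf fg]]] [h [k [ch ck kh hk]]].
exists (h \o f), (g \o k); split; try exact: continuous_compT.
  apply: homotopic_maps_trans gf.
  exact: (homotopic_maps_comp cg cf kh).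
apply: homotopic_maps_trans hk.
exact: (homotopic_maps_comp ch ck fg).
Qed.

End homotopy.

(** * Realizations and Dowker duality *)

Definition simplicial (V : finType) (S : {set {set V}}) : Prop :=
  forall s t : {set V}, s \in S -> t \subset s -> t != finset.set0 -> t \in S.

Definition supp (R : realType) (V : finType) (x : V -> R) : {set V} :=
  [set v | x v != 0]%SET.

Section realization.
Variable R : realType.

Local Notation geom S := (set_type (realization R S)).

Section one_complex.
Variables (V : finType) (S : {set {set V}}).

Lemma realization_ge0 (x : geom S) v : 0 <= set_val x v.
Proof. by have [+ _ _] := set_valP x; exact. Qed.

Lemma realization_sum (x : geom S) : \sum_v set_val x v = 1.
Proof. by have [] := set_valP x. Qed.

Lemma realization_supp (x : geom S) : supp (set_val x) \in S.
Proof. by have [] := set_valP x. Qed.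

Lemma realization_gt0 (x : geom S) v : (v \in supp (set_val x)) = (0 < set_val x v).
Proof. by rewrite inE lt0r realization_ge0 andbT. Qed.

Lemma realization_supp_neq0 (x : geom S) : supp (set_val x) != finset.set0.
Proof.
apply/negP => /eqP s0; have := realization_sum x.
rewrite big1 => [/eqP|v _]; first by rewrite eq_sym oner_eq0.
by apply/eqP; have := finset.in_set0 v; rewrite -s0 inE => /negbFE.
Qed.

Lemma realization_notin (x : geom S) v : v \notin supp (set_val x) -> set_val x v = 0.
Proof. by rewrite inE negbK => /eqP. Qed.

Lemma continuous_coord v : continuous (fun x : geom S => set_val x v).
Proof.
have cv : continuous (fun h : {ptws V -> R} => h v).
  exact: (@proj_continuous V (fun=> R) v).
move=> x; apply: (@continuous_comp _ {ptws V -> R} _ (@set_val _ _) _ x _ (cv _)).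
exact: set_val_continuous.
Qed.

Lemma continuous_to_realization (X : topologicalType) (f : X -> geom S) :
  (forall v, continuous (fun x => set_val (f x) v)) -> continuous f.
Proof.
by move=> cf; apply: continuous_to_set_type; exact: continuous_to_ptws.
Qed.

Lemma realization_eq (x x' : geom S) : set_val x =1 set_val x' -> x = x'.
Proof. by move=> xx'; apply/val_inj/funext. Qed.

Lemma exists_realization_map (X : topologicalType) (F : X -> V -> R) :
  (forall x v, 0 <= F x v) -> (forall x, \sum_v F x v = 1) ->
  (forall x, supp (F x) \in S) -> (forall v, continuous (F^~ v)) ->
  exists2 f : X -> geom S, continuous f & forall x v, set_val (f x) v = F x v.
Proof.
move=> F0 F1 FS cF.
have FP x : (F x : {ptws V -> R}) \in realization R S by apply/mem_set; split; [exact: F0|exact: F1|exact: FS].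
exists (fun x => SigSub (FP x)) => //.
exact: continuous_to_realization.
Qed.

Lemma exists_normalized_map (X : topologicalType) (F : X -> V -> R) :
  (forall x v, 0 <= F x v) -> (forall x, exists v, 0 < F x v) ->
  (forall x, supp (F x) \in S) -> (forall v, continuous (F^~ v)) ->
  exists2 f : X -> geom S, continuous f &
    forall x v, set_val (f x) v = F x v / \sum_w F x w.
Proof.
move=> F0 F1 FS cF.
have sum_gt0 x : 0 < \sum_w F x w.
  have [v v0] := F1 x; rewrite (bigD1 v) //=.
  by rewrite ltr_pwDl // sumr_ge0.
apply: (@exists_realization_map _ (fun x v => F x v / \sum_w F x w)).
- by move=> x v; rewrite divr_ge0 // ltW.
- by move=> x; rewrite -mulr_suml divff // gt_eqF.
- move=> x; rewrite (_ : supp _ = supp (F x)) //.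
  apply/setP => v; rewrite !inE mulf_eq0 negb_or invr_eq0.
  by rewrite (gt_eqF (sum_gt0 x)) andbT.
- move=> v; apply: continuousMT => //; apply: continuousVT.
    by move=> x; rewrite gt_eqF.
  by apply: continuous_bigT => // f g; exact: continuousDT.
Qed.

(** The supports of [f x] and [g x] lie in one simplex, so the segment joining the two points stays
    in the realization. *)
Lemma contiguous_homotopic (X : topologicalType) (f g : X -> geom S) :
  simplicial S -> continuous f -> continuous g ->
  (forall x, (supp (set_val (f x)) :|: supp (set_val (g x)))%SET \in S) ->
  homotopic_maps R f g.
Proof.
move=> complS cf cg fgS; apply/homotopic_mapsP.
pose F (p : X * R) v : R :=
  (1 - clamp01 p.2) * set_val (f p.1) v + clamp01 p.2 * set_val (g p.1) v.
have F0 p v : 0 <= F p v.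
  apply: addr_ge0; apply: mulr_ge0; rewrite ?realization_ge0 ?clamp01_ge0 //.
  by rewrite subr_ge0 clamp01_le1.
have F1 p : \sum_v F p v = 1.
  by rewrite big_split /= -!mulr_sumr !realization_sum !mulr1 subrK.
have FS p : supp (F p) \in S.
  apply: complS (fgS p.1) _ _.
    apply/fintype.subsetP => v; rewrite !inE -negb_and; apply: contra.
    by rewrite /F => /andP[/eqP -> /eqP ->]; rewrite !mulr0 addr0.
  apply/negP => /eqP s0; have := F1 p.
  rewrite big1 => [/eqP|v _]; first by rewrite eq_sym oner_eq0.
  by apply/eqP; have := finset.in_set0 v; rewrite -s0 inE => /negbFE.
have cF v : continuous (F^~ v).
  have cc : continuous (fun p : X * R => clamp01 p.2).
    by apply: continuous_clamp01; exact: continuous_snd.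
  have cfst (h : X -> geom S) :
      continuous h -> continuous (fun p : X * R => set_val (h p.1) v).
    move=> ch; apply: (@continuous_compT _ _ _ fst (fun x => set_val (h x) v)).
      exact: continuous_fst.
    by apply: (@continuous_compT _ _ _ h (fun x => set_val x v)) => //;
      exact: continuous_coord.
  apply: continuousDT; apply: continuousMT => //; try exact: cfst.
  by apply: continuousBT => //; exact: continuous_cstT.
have [H cH HE] := exists_realization_map F0 F1 FS cF.
exists H; split => // x; apply: realization_eq => v; rewrite HE /F /=.
  by rewrite clamp010 subr0 mul1r mul0r addr0.
by rewrite clamp011 subrr mul0r mul1r add0r.
Qed.

End one_complex.

Lemma contiguous_equivalent (V W : finType) (S : {set {set V}})
    (T : {set {set W}}) (f : geom S -> geom T) (g : geom T -> geom S) :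
  simplicial S -> simplicial T -> continuous f -> continuous g ->
  (forall x, (supp (set_val (g (f x))) :|: supp (set_val x))%SET \in S) ->
  (forall y, (supp (set_val (f (g y))) :|: supp (set_val y))%SET \in T) ->
  homotopy_equivalent R (geom S) (geom T).
Proof.
move=> cS cT cf cg gf fg; exists f, g; split => //.
- by apply: contiguous_homotopic => //; [exact: continuous_compT|move=> x; exact: cvg_id].
- by apply: contiguous_homotopic => //; [exact: continuous_compT|move=> x; exact: cvg_id].
Qed.

Definition dowker_complex (V K : finType) (I : V -> K -> bool) : {set {set V}} :=
  [set s | (s != finset.set0) && [exists k, [forall v in s, I v k]]]%SET.

Lemma simplicial_dowker (V' K' : finType) (J : V' -> K' -> bool) :
  simplicial (dowker_complex J).
Proof.
move=> s t; rewrite !inE => /andP[_ /existsP[k /forall_inP sk]] ts ->.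
by apply/existsP; exists k; apply/forall_inP => v /(fintype.subsetP ts)/sk.
Qed.

(* [dowker_weight I x k] is positive exactly when [k] is related to every vertex
   at which [x] is maximal; it is largest when [k] is related to all of the
   support of [x], so that the support of [x] is contained in that of the
   round trip. *)
Definition dowker_weight (V K : finType) (I : V -> K -> bool) (x : V -> R)
    (k : K) : R :=
  \big[Num.max/0]_v x v - \big[Num.max/0]_(v | ~~ I v k) x v.

Section dowker_weight.
Variables (V K : finType) (I : V -> K -> bool).
Local Notation S := (dowker_complex I).
Local Notation I' := (fun k v => I v k).
Implicit Types x : geom S.

Lemma dowker_weight_ge0 x k : 0 <= dowker_weight I (set_val x) k.
Proof.
rewrite subr_ge0; apply/bigmax_leP; split => [|v _].
  by apply: bigmax_ge_id.
exact: le_bigmax.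
Qed.

Lemma bigmax_attained x : exists2 v, v \in supp (set_val x) &
  set_val x v = \big[Num.max/0]_v set_val x v.
Proof.
have /set0Pn[v0 v0x] := realization_supp_neq0 x.
have [v _ vmax] := arg_maxP (set_val x) (erefl (predT v0)).
have vE : set_val x v = \big[Num.max/0]_v set_val x v.
  apply/eqP; rewrite eq_le le_bigmax /=; apply/bigmax_leP.
  by split=> [|w _]; [exact: realization_ge0|exact: vmax].
exists v => //; rewrite realization_gt0 vE.
apply: lt_le_trans (le_bigmax _ _ v0); by rewrite -realization_gt0.
Qed.

Lemma dowker_weight_gt0 x k : 0 < dowker_weight I (set_val x) k ->
  forall v, set_val x v = \big[Num.max/0]_v set_val x v -> I v k.
Proof.
rewrite subr_gt0 => lt_k v vE; apply: contraLR lt_k => nIvk.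
by rewrite -leNgt -vE; apply: le_bigmax_cond.
Qed.

Lemma dowker_weight_full x k : (forall v, v \in supp (set_val x) -> I v k) ->
  dowker_weight I (set_val x) k = \big[Num.max/0]_v set_val x v.
Proof.
move=> xk; rewrite /dowker_weight [X in _ - X](_ : _ = 0) ?subr0 //.
apply/eqP; rewrite eq_le bigmax_ge_id andbT; apply/bigmax_leP; split => // v.
by apply: contraR; rewrite -ltNge -realization_gt0; exact: xk.
Qed.

(** Some [k0] is related to the whole support and has weight [max x], the largest possible value. A
    [k] of maximal weight must reach it, so that nothing is subtracted in its weight. *)
Lemma dowker_weight_argmax x k :
  (forall k', dowker_weight I (set_val x) k' <= dowker_weight I (set_val x) k) ->
  forall v, v \in supp (set_val x) -> I v k.
Proof.
move=> kmax v vx; have := realization_supp x.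
rewrite inE => /andP[_ /existsP[k0 /forall_inP xk0]].
have := kmax k0; rewrite dowker_weight_full // lerBrDr gerDl.
move=> le0; apply: contraLR vx => nIvk; rewrite realization_gt0 -leNgt.
by apply: le_trans le0; apply: le_bigmax_cond.
Qed.

Lemma dowker_weight_pos x : exists k, 0 < dowker_weight I (set_val x) k.
Proof.
have := realization_supp x.
rewrite inE => /andP[_ /existsP[k0 /forall_inP xk0]]; exists k0.
rewrite dowker_weight_full //; have [v vx <-] := bigmax_attained x.
by rewrite -realization_gt0.
Qed.

Lemma dowker_weight_supp x :
  supp (dowker_weight I (set_val x)) \in dowker_complex I'.
Proof.
rewrite inE; apply/andP; split.
  have [k k0] := dowker_weight_pos x; apply/set0Pn; exists k.
  by rewrite inE gt_eqF.
have [v vx vE] := bigmax_attained x; apply/existsP; exists v.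
apply/forall_inP => k; rewrite inE => k0; apply: dowker_weight_gt0 vE.
by rewrite lt0r k0 dowker_weight_ge0.
Qed.

Lemma continuous_dowker_weight k :
  continuous (fun x => dowker_weight I (set_val x) k).
Proof.
apply: continuousBT; apply: continuous_bigT; try exact: continuous_coord;
  by move=> f g; exact: continuous_maxT.
Qed.

Lemma exists_dowker_map :
  exists2 f : geom S -> (geom (dowker_complex I')), continuous f &
    forall x k, set_val (f x) k =
      dowker_weight I (set_val x) k / \sum_l dowker_weight I (set_val x) l.
Proof.
apply: exists_normalized_map.
- exact: dowker_weight_ge0.
- exact: dowker_weight_pos.
- exact: dowker_weight_supp.
- exact: continuous_dowker_weight.
Qed.

End dowker_weight.

Lemma dowker_round_trip (V K : finType) (I : V -> K -> bool)
    (I' := fun k v => I v k)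
    (f : geom (dowker_complex I) -> (geom (dowker_complex I')))
    (g : geom (dowker_complex I') -> (geom (dowker_complex I))) :
  (forall x k, set_val (f x) k =
      dowker_weight I (set_val x) k / \sum_l dowker_weight I (set_val x) l) ->
  (forall y v, set_val (g y) v =
      dowker_weight I' (set_val y) v / \sum_w dowker_weight I' (set_val y) w) ->
  forall x, supp (set_val x) \subset supp (set_val (g (f x))).
Proof.
move=> fE gE x; apply/fintype.subsetP => v vx; rewrite inE gE.
have sum_gt0 : 0 < \sum_w dowker_weight I' (set_val (f x)) w.
  have [w w0] := dowker_weight_pos (f x); rewrite (bigD1 w) //=.
  by rewrite ltr_pwDl // sumr_ge0 // => *; exact: dowker_weight_ge0.
rewrite mulf_neq0 ?invr_eq0 ?gt_eqF // subr_gt0.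
have [k k0 kE] := bigmax_attained (f x); rewrite -kE.
have kmax k' : set_val (f x) k' <= set_val (f x) k by rewrite kE le_bigmax.
(* A [k'] unrelated to [v] cannot attain the maximum of [f x]: it would have the largest weight and
   hence be related to the whole support of [x], including [v]. *)
rewrite bigmax_lt -?realization_gt0 // => k' nIvk'.
rewrite lt_neqAle kmax andbT; apply: contra nIvk' => /eqP k'k.
suff : forall v, v \in supp (set_val x) -> I v k' by apply.
apply: dowker_weight_argmax => k''; have := kmax k''; rewrite -k'k !fE.
rewrite ler_pM2r // invr_gt0; have [w w0] := dowker_weight_pos x.
rewrite (bigD1 w) //=.
by rewrite ltr_pwDl // sumr_ge0 // => *; exact: dowker_weight_ge0.
Qed.

Theorem dowker_duality (V K : finType) (I : V -> K -> bool) :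
  homotopy_equivalent R (geom (dowker_complex I)) (geom (dowker_complex (fun k v => I v k))).
Proof.
have [f cf fE] := exists_dowker_map I.
have [g cg gE] := exists_dowker_map (fun k v => I v k).
apply: (@contiguous_equivalent _ _ _ _ f g) => //; try exact: simplicial_dowker.
- move=> x; rewrite (finset.setUidPl _) ?realization_supp //.
  exact: (dowker_round_trip fE gE).
- move=> y; rewrite (finset.setUidPl _) ?realization_supp //.
  exact: (dowker_round_trip gE fE).
Qed.
End realization.

(** * Deleting stars and simplicial maps *)

Section moves.
Variable R : realType.
Local Notation geom S := (set_type (realization R S)).

Section star_removal.
Variables (V : finType) (S : {set {set V}}) (tau : {set V}) (c : V).
Hypotheses (simS : simplicial S) (tau0 : tau != finset.set0).
Hypotheses (ctau : c \notin tau).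
Hypothesis coneS : forall s, s \in S -> tau \subset s -> (c |: s)%SET \in S.

Definition star_deletion (V : finType) (S : {set {set V}}) (tau : {set V}) :
  {set {set V}} := [set s in S | ~~ (tau \subset s)]%SET.

Local Notation S' := (star_deletion S tau).

Lemma simplicial_star_deletion (W : finType) (T : {set {set W}}) t :
  simplicial T -> simplicial (star_deletion T t).
Proof.
move=> simT s u; rewrite !inE => /andP[sT tNs] us u0.
rewrite (simT _ _ sT us u0) /=; apply: contra tNs => tu.
exact: fintype.subset_trans tu us.
Qed.

(** The initial value 1 does not disturb the minimum, since [tau] is nonempty and barycentric
    coordinates are at most 1. *)
Let m (x : V -> R) : R := \big[Num.min/1]_(v in tau) x v.

(* Moves the barycentric weight from [tau] to the cone point [c] until [tau]
   leaves the support. *)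
Let push (x : V -> R) (v : V) : R :=
  x v - m x *+ (v \in tau) + m x *+ (#|tau| * (v == c)).

Let m_ge0 (x : geom S) : 0 <= m (set_val x).
Proof.
by apply/bigmin_geP; split => // v _; exact: realization_ge0.
Qed.

Let m_le x v : v \in tau -> m x <= x v.
Proof. by move=> vt; apply: bigmin_le_cond. Qed.

Let m_attained (x : geom S) : exists2 v, v \in tau & set_val x v = m (set_val x).
Proof.
have /set0Pn[v0 v0t] := tau0.
have [v vt vmin] := arg_minP (set_val x) v0t.
exists v => //; apply/eqP; rewrite eq_le m_le // andbT.
apply/bigmin_geP; split => [|w wt]; last exact: vmin.
rewrite -(realization_sum x) (bigD1 v) //= lerDl sumr_ge0 // => w _.
exact: realization_ge0.
Qed.

Let m_eq0 (x : geom S) : ~~ (tau \subset supp (set_val x)) -> m (set_val x) = 0.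
Proof.
case/fintype.subsetPn => v vt /realization_notin v0.
by apply/eqP; rewrite eq_le m_ge0 andbT -v0 m_le.
Qed.

Let push_id x : m x = 0 -> push x =1 x.
Proof. by move=> m0 v; rewrite /push m0 !mul0rn subr0 addr0. Qed.

Let push_ge0 (x : geom S) v : 0 <= push (set_val x) v.
Proof.
rewrite /push addr_ge0 ?mulrn_wge0 ?m_ge0 // subr_ge0.
by case: (boolP (v \in tau)) => [/m_le|_]; rewrite ?mulr1n ?realization_ge0.
Qed.

Let push_sum (x : geom S) : \sum_v push (set_val x) v = 1.
Proof.
rewrite /push big_split sumrB /= realization_sum.
have -> : \sum_v m (set_val x) *+ (v \in tau) = m (set_val x) *+ #|tau|.
  rewrite -sumr_const [RHS]big_mkcond /=; apply: eq_bigr => v _.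
  by case: (v \in tau).
rewrite (bigD1 c) //= eqxx muln1 big1 ?addr0 ?subrK // => v /negbTE ->.
by rewrite muln0.
Qed.

Let push_supp (x : geom S) : tau \subset supp (set_val x) ->
  supp (push (set_val x)) \subset (c |: supp (set_val x))%SET.
Proof.
move=> tx; apply/fintype.subsetP => v; rewrite finset.in_setU1.
apply: contraTT; rewrite negb_or => /andP[/negbTE vc vx].
have vt : v \notin tau by apply: contra vx; exact: (fintype.subsetP tx).
rewrite inE negbK /push vc (negbTE vt) muln0 subr0 addr0.
by rewrite realization_notin.
Qed.

Let push_neq0 (x : geom S) : supp (push (set_val x)) != finset.set0.
Proof.
apply/negP => /eqP s0; have := push_sum x.
rewrite big1 => [/eqP|v _]; first by rewrite eq_sym oner_eq0.
by apply/eqP; have := finset.in_set0 v; rewrite -s0 inE => /negbFE.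
Qed.

Let push_S (x : geom S) : supp (push (set_val x)) \in S'.
Proof.
rewrite inE; case: (boolP (tau \subset supp (set_val x))) => tx.
  rewrite (simS (coneS (realization_supp x) tx)) ?push_supp //=.
  (* A vertex of [tau] at which the minimum is attained loses all its weight, and it receives none
     because [c] is outside [tau]. *)
  apply/fintype.subsetPn; have [v vt vE] := m_attained x; exists v => //.
  have vc : v == c = false by apply/negbTE; apply: contraNneq ctau => <-.
  by rewrite inE negbK /push vt vc vE muln0 mulr1n subrr addr0.
have -> : supp (push (set_val x)) = supp (set_val x).
  by apply/setP => v; rewrite !inE push_id // m_eq0.
by rewrite realization_supp.
Qed.

(** [push] fixes the points whose support does not contain [tau] and moves every other point inside
    the simplex [c |: supp x]; hence it is contiguous to the identity in both directions. *)
Lemma star_removal : homotopy_equivalent R (geom S) (geom S').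
Proof.
have [f cf fE] : exists2 f : geom S -> geom S', continuous f &
    forall x v, set_val (f x) v = push (set_val x) v.
  apply: exists_realization_map => //.
  move=> v; have cm : continuous (fun x : geom S => m (set_val x)).
    apply: continuous_bigT => [f g|w]; first exact: continuous_minT.
    exact: continuous_coord.
  have cmn n : continuous (fun x : geom S => m (set_val x) *+ n).
    elim: n => [|n IH]; first exact: continuous_cstT.
    have -> : (fun x : geom S => m (set_val x) *+ n.+1) =
      (fun x => m (set_val x) + m (set_val x) *+ n).
      by apply/funext => x; rewrite mulrS.
    exact: continuousDT.
  apply: continuousDT => //; apply: continuousBT => //.
  exact: continuous_coord.
have [g cg gE] : exists2 g : geom S' -> geom S, continuous g &
    forall x v, set_val (g x) v = set_val x v.
  apply: exists_realization_map.
  - by move=> x v; exact: realization_ge0.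
  - by move=> x; exact: realization_sum.
  - by move=> x; have := realization_supp x; rewrite inE => /andP[].
  - exact: continuous_coord.
apply: (@contiguous_equivalent _ _ _ _ _ f g) => //.
- exact: simplicial_star_deletion.
- move=> x; have -> : supp (set_val (g (f x))) = supp (push (set_val x)).
    by apply/setP => v; rewrite !inE gE fE.
  case: (boolP (tau \subset supp (set_val x))) => tx.
    apply: simS (coneS (realization_supp x) tx) _ _.
      by rewrite finset.subUset push_supp //= finset.subsetUr.
    have /set0Pn[v vx] := push_neq0 x.
    by apply/set0Pn; exists v; rewrite finset.in_setU vx.
  have -> : supp (push (set_val x)) = supp (set_val x).
    by apply/setP => v; rewrite !inE push_id // m_eq0.
  by rewrite finset.setUid realization_supp.
- move=> y; have -> : supp (set_val (f (g y))) = supp (set_val y).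
    have gy : set_val (g y) =1 set_val y by move=> v; rewrite gE.
    have sgy : supp (set_val (g y)) = supp (set_val y).
      by apply/setP => v; rewrite !inE gy.
    apply/setP => v; rewrite inE fE push_id ?gy ?inE // m_eq0 // sgy.
    by have := realization_supp y; rewrite inE => /andP[].
  by rewrite finset.setUid realization_supp.
Qed.

End star_removal.

(** The stars are deleted one at a time. Adding an apex must not complete another listed simplex:
    this keeps each cone inside the complex that the earlier deletions leave. *)
Lemma star_removal_seq (V : finType) (S : {set {set V}})
    (L : seq ({set V} * V)) :
  simplicial S ->
  (forall p, p \in L -> [/\ p.1 != finset.set0, p.2 \notin p.1 &
     forall s, s \in S -> p.1 \subset s -> (p.2 |: s)%SET \in S /\
       forall q, q \in L -> q.1 \subset (p.2 |: s)%SET -> q.1 \subset s]) ->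
  homotopy_equivalent R (geom S)
    (geom [set s in S | all (fun p : {set V} * V => ~~ (p.1 \subset s)) L]%SET).
Proof.
elim: L S => [|p L IH] S simS Lprop.
  rewrite (_ : [set s in S | _]%SET = S); first exact: homotopy_equivalent_refl.
  by apply/setP => s; rewrite inE andbT.
have [p0 pp pcone] := Lprop p (mem_head _ _).
apply: (@homotopy_equivalent_trans _ (geom (star_deletion S p.1))).
  by apply: star_removal p0 pp _ => // s sS ps; have [] := pcone s sS ps.
have -> : [set s in S | all (fun q : {set V} * V => ~~ (q.1 \subset s)) (p :: L)]%SET =
    [set s in star_deletion S p.1 | all (fun q : {set V} * V => ~~ (q.1 \subset s)) L]%SET.
  by apply/setP => s; rewrite !inE /= andbA.
apply: IH; first exact: simplicial_star_deletion.
move=> q qL; have qpL : q \in p :: L by rewrite inE qL orbT.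
have [q0 qq qcone] := Lprop q qpL.
split => // s; rewrite inE => /andP[sS nps] qs; have [qsS qsub] := qcone s sS qs.
split; last by move=> u uL; apply: qsub; rewrite inE uL orbT.
by rewrite inE qsS /=; apply: contra nps; apply: qsub; exact: mem_head.
Qed.

Section simplicial_map.
Variables (V W : finType) (phi : V -> W).

Definition push_forward (x : V -> R) (w : W) : R := \sum_(v | phi v == w) x v.

Lemma supp_push_forward (S : {set {set V}}) (x : geom S) :
  supp (push_forward (set_val x)) = (phi @: supp (set_val x))%SET.
Proof.
apply/setP => w; rewrite inE psumr_neq0 => [|v _]; last exact: realization_ge0.
apply/hasP/imsetP => [[v _ /andP[/eqP <- v0]]|[v vx ->]].
  by exists v => //; rewrite realization_gt0.
by exists v; rewrite ?mem_index_enum // eqxx -realization_gt0.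
Qed.

Lemma exists_simplicial_map (S : {set {set V}}) (T : {set {set W}}) :
  (forall s, s \in S -> (phi @: s)%SET \in T) ->
  exists2 f : geom S -> geom T, continuous f &
    forall x, supp (set_val (f x)) = (phi @: supp (set_val x))%SET.
Proof.
move=> phiST.
have [f cf fE] : exists2 f : geom S -> geom T, continuous f &
    forall x w, set_val (f x) w = push_forward (set_val x) w.
  apply: exists_realization_map.
  - by move=> x w; apply: sumr_ge0 => v _; exact: realization_ge0.
  - move=> x; rewrite /push_forward -(realization_sum x).
    by rewrite [RHS](partition_big phi predT).
  - by move=> x; rewrite supp_push_forward phiST // realization_supp.
  - move=> w; apply: continuous_bigT => [g h|v]; first exact: continuousDT.
    exact: continuous_coord.
exists f => // x; rewrite -supp_push_forward.
by apply/setP => w; rewrite !inE fE.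
Qed.

End simplicial_map.

Lemma simplicial_equivalent (V W : finType) (S : {set {set V}})
    (T : {set {set W}}) (r : V -> W) (i : W -> V) :
  simplicial S -> simplicial T ->
  (forall s, s \in S -> (r @: s)%SET \in T) ->
  (forall t, t \in T -> (i @: t)%SET \in S) ->
  (forall s, s \in S -> (i @: (r @: s) :|: s)%SET \in S) ->
  (forall t, t \in T -> (r @: (i @: t) :|: t)%SET \in T) ->
  homotopy_equivalent R (geom S) (geom T).
Proof.
move=> simS simT rST iTS irS riT.
have [f cf fE] := exists_simplicial_map rST.
have [g cg gE] := exists_simplicial_map iTS.
apply: (@contiguous_equivalent _ _ _ _ _ f g) => // x.
- by rewrite gE fE irS // realization_supp.
- by rewrite fE gE riT // realization_supp.
Qed.

End moves.

(** * Cliques and domination *)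

Section closed_adjacency.
Variable G : sgraph.
Implicit Types (u v : G) (A Q : {set G}).

(** With the reflexive closure, coinciding vertices need no separate treatment, and in a clique
    graph the relation just says that two cliques meet. *)
Definition cadj : rel G := [rel u v | (u == v) || adj u v].

Lemma cadjxx u : cadj u u.
Proof. by rewrite /cadj /= eqxx. Qed.

Lemma cadj_sym : symmetric cadj.
Proof. by move=> u v; rewrite /cadj /= eq_sym adj_sym. Qed.

Lemma adj_cadj u v : adj u v = (u != v) && cadj u v.
Proof. by rewrite /cadj /=; case: eqP => [->|] //=; rewrite adj_irrefl. Qed.

Lemma complete_subP A :
  reflect (A != finset.set0 /\ {in A &, forall u v, cadj u v}) (complete_sub A).
Proof.
apply: (iffP andP) => -[A0 cA]; split => //.
  move=> u v uA vA; have := forall_inP (forall_inP cA u uA) v vA.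
  by rewrite /cadj /=; case: eqP.
apply/forall_inP => u uA; apply/forall_inP => v vA; apply/implyP => uv.
by rewrite adj_cadj uv cA.
Qed.

Lemma simplicial_Cl : simplicial (Cl G).
Proof.
move=> s t; rewrite !inE => /complete_subP[_ cs] /fintype.subsetP ts t0.
by apply/complete_subP; split => // u v /ts us /ts vs; exact: cs.
Qed.

Lemma cliqueP Q : reflect
  [/\ Q != finset.set0, {in Q &, forall u v, cadj u v} &
      forall u, {in Q, forall v, cadj u v} -> u \in Q]
  (clique Q).
Proof.
apply: (iffP maxsetP) => [[/complete_subP[Q0 cQ] maxQ]|[Q0 cQ maxQ]].
  split => // u uQ; rewrite -(maxQ (u |: Q)%SET) ?finset.setU11 //.
    apply/complete_subP; split.
      by apply/set0Pn; exists u; rewrite finset.setU11.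
    move=> v w; rewrite !finset.in_setU1.
    move=> /predU1P[->|vQ] /predU1P[->|wQ]; [exact: cadjxx|exact: uQ| |exact: cQ].
    by rewrite cadj_sym uQ.
  exact: finset.subsetUr.
split=> [|A /complete_subP[_ cA] QA]; first exact/complete_subP.
apply/eqP; rewrite finset.eqEsubset QA andbT; apply/fintype.subsetP => u uA.
by apply: maxQ => v /(fintype.subsetP QA) vA; exact: cA.
Qed.

Lemma clique_max Q A : clique Q -> Q \subset A -> complete_sub A -> Q = A.
Proof. by move=> /maxsetP[_ maxQ] QA cA; rewrite (maxQ A). Qed.

End closed_adjacency.
Arguments cadj {G}.

Section clique_graphs.
Variable G : sgraph.

Definition cset (Q : clique_graph G) : {set G} := sval Q.

Lemma csetP Q : clique (cset Q).
Proof. exact: (svalP Q). Qed.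

Lemma cset_inj : injective cset.
Proof. exact: val_inj. Qed.

Lemma exists_cset (Q : {set G}) : clique Q -> exists P, cset P = Q.
Proof. by move=> cQ; exists (exist _ Q cQ). Qed.

Lemma cset_neq0 Q : cset Q != finset.set0.
Proof. by have /cliqueP[] := csetP Q. Qed.

Lemma exists_clique_graph (A : {set G}) :
  complete_sub A -> exists Q, A \subset cset Q.
Proof.
by move=> /maxset_exists[Q cQ AQ]; have [P PQ] := exists_cset cQ;
  exists P; rewrite PQ.
Qed.

Lemma cadj_clique_graph (Q P : clique_graph G) :
  cadj Q P = (cset Q :&: cset P != finset.set0)%SET.
Proof.
rewrite /cadj /=; case: (eqVneq Q P) => [->|QP] /=.
  by rewrite finset.setIid cset_neq0.
by rewrite /clique_adj /= QP.
Qed.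

Lemma cadj_clique_graphP (Q P : clique_graph G) :
  reflect (exists2 v, v \in cset Q & v \in cset P) (cadj Q P).
Proof.
rewrite cadj_clique_graph; apply: (iffP (set0Pn _)) => -[v].
  by rewrite finset.in_setI => /andP[]; exists v.
by exists v; rewrite finset.in_setI; apply/andP.
Qed.

Lemma mem_cset Q u : (forall v, v \in cset Q -> cadj u v) -> u \in cset Q.
Proof. by have /cliqueP[_ _] := csetP Q; apply. Qed.

Lemma cset_cadj Q u v : u \in cset Q -> v \in cset Q -> cadj u v.
Proof. by have /cliqueP[_ cQ _] := csetP Q; exact: cQ. Qed.

End clique_graphs.

(* [G] retracts onto a copy of [H] in such a way that [i (r g)] dominates [g]. *)
Definition dominated_retract (G H : sgraph) : Prop :=
  exists (i : H -> G) (r : G -> H),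
    (forall h h', cadj (i h) (i h') = cadj h h') /\
    (forall g g', cadj g g' -> cadj (i (r g)) g').

(** The new maps extend the images of cliques under [i] and [r] to arbitrarily chosen cliques.
    Domination makes up for the choice, because it determines enough of each extension. *)
Lemma dominated_retract_clique_graph (G H : sgraph) :
  dominated_retract G H -> dominated_retract (clique_graph G) (clique_graph H).
Proof.
move=> [i [r [iE rdom]]].
have ir2 g g' : cadj g g' -> cadj (i (r g)) (i (r g')).
  by move=> gg'; rewrite cadj_sym; apply: (rdom); rewrite cadj_sym; exact: rdom.
have /choice[I IP] (P : clique_graph H) :
    exists Q : clique_graph G, (i @: cset P)%SET \subset cset Q.
  apply: exists_clique_graph; apply/complete_subP; split.
    have /set0Pn[h hP] := cset_neq0 P; apply/set0Pn; exists (i h).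
    exact: imset_f.
  move=> _ _ /imsetP[h hP ->] /imsetP[h' h'P ->]; rewrite iE.
  exact: cset_cadj hP h'P.
have /choice[R RP] (Q : clique_graph G) :
    exists P : clique_graph H, (r @: cset Q)%SET \subset cset P.
  apply: exists_clique_graph; apply/complete_subP; split.
    have /set0Pn[h hP] := cset_neq0 Q; apply/set0Pn; exists (r h).
    exact: imset_f.
  move=> _ _ /imsetP[h hP ->] /imsetP[h' h'P ->]; rewrite -iE.
  apply: ir2; exact: cset_cadj hP h'P.
exists I, R; split => [P P'|Q Q'].
  apply/cadj_clique_graphP/cadj_clique_graphP => -[v vP vP'].
    (* A vertex [v] of the extension is adjacent to all of [i @: cset P0]; so is [i (r v)] by
       domination, and maximality of [P0] gives [r v \in cset P0]. *)
    have rv (P0 : clique_graph H) : v \in cset (I P0) -> r v \in cset P0.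
      move=> vP0; apply: mem_cset => h hP0; rewrite -iE; apply: rdom.
      apply: cset_cadj vP0 _; apply: (fintype.subsetP (IP P0)); exact: imset_f.
    by exists (r v); apply: rv.
  by exists (i v); [apply: (fintype.subsetP (IP P))|
    apply: (fintype.subsetP (IP P'))]; exact: imset_f.
move=> /cadj_clique_graphP[g gQ gQ']; apply/cadj_clique_graphP.
(* Domination puts [i (r g)] into every clique through [g], in particular into [Q']. *)
exists (i (r g)).
  apply: (fintype.subsetP (IP _)); apply: imset_f.
  by apply: (fintype.subsetP (RP _)); exact: imset_f.
by apply: mem_cset => g' g'Q'; apply: rdom; exact: cset_cadj gQ' g'Q'.
Qed.

Lemma dominated_retract_iter (n : nat) (G H : sgraph) :
  dominated_retract G H ->
  dominated_retract (iter_clique_graph n G) (iter_clique_graph n H).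
Proof.
by elim: n => // n IH GH; apply: dominated_retract_clique_graph; exact: IH.
Qed.

(** Since [i (r g)] is adjacent to all that [g] is adjacent to, adding the round trip of a complete
    set to it leaves it complete. The same holds in [H] because [i] reflects adjacency. *)
Lemma dominated_retract_homotopic (R : realType) (G H : sgraph) :
  dominated_retract G H -> homotopic_graphs R G H.
Proof.
move=> [i [r [iE rdom]]].
have ir2 g g' : cadj g g' -> cadj (i (r g)) (i (r g')).
  by move=> gg'; rewrite cadj_sym; apply: (rdom); rewrite cadj_sym; exact: rdom.
have im0 (V W : finType) (f : V -> W) (s : {set V}) :
    s != finset.set0 -> (f @: s)%SET != finset.set0.
  by move=> /set0Pn[v vs]; apply/set0Pn; exists (f v); exact: imset_f.
apply: (@simplicial_equivalent _ _ _ _ _ r i); try exact: simplicial_Cl.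
- move=> s; rewrite !inE => /complete_subP[s0 cs]; apply/complete_subP.
  split=> [|_ _ /imsetP[h hP ->] /imsetP[h' h'P ->]]; first exact: im0.
  by rewrite -iE; apply/ir2/cs.
- move=> t; rewrite !inE => /complete_subP[t0 ct]; apply/complete_subP.
  split=> [|_ _ /imsetP[h hP ->] /imsetP[h' h'P ->]]; first exact: im0.
  by rewrite iE; exact: ct.
- move=> s; rewrite !inE => /complete_subP[s0 cs]; apply/complete_subP.
  split=> [|u v]; first by rewrite finset.setU_eq0 negb_and s0 orbT.
  rewrite !finset.in_setU.
  move=> /orP[/imsetP[_ /imsetP[g gs ->] ->]|us];
  move=> /orP[/imsetP[_ /imsetP[g' gs' ->] ->]|vs].
  + by apply/ir2/cs.
  + by apply/rdom/cs.
  + by rewrite cadj_sym; apply/rdom/cs.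
  + exact: cs.
- move=> s; rewrite !inE => /complete_subP[s0 cs]; apply/complete_subP.
  split=> [|u v]; first by rewrite finset.setU_eq0 negb_and s0 orbT.
  rewrite !finset.in_setU.
  move=> /orP[/imsetP[_ /imsetP[g gs ->] ->]|us];
  move=> /orP[/imsetP[_ /imsetP[g' gs' ->] ->]|vs].
  + by rewrite -iE; apply: ir2; rewrite iE; exact: cs.
  + by rewrite -iE; apply: rdom; rewrite iE; exact: cs.
  + by rewrite -iE cadj_sym; apply: rdom; rewrite iE; exact: cs.
  + exact: cs.
Qed.

(** * Suns *)

Section suns.
Variable H : sgraph.
Implicit Types (a b c x y z u v w : H) (Q : {set H}) (F : {set {set H}}).

(* The outer vertices [x], [y], [z] form triangles with [bc], [ac], [ab]. *)
Record good_sun a b c x y z : Prop := GoodSun {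
  sun_ab : cadj a b; sun_bc : cadj b c; sun_ac : cadj a c;
  sun_xb : cadj x b; sun_xc : cadj x c; sun_xa : ~~ cadj x a;
  sun_ya : cadj y a; sun_yc : cadj y c; sun_yb : ~~ cadj y b;
  sun_za : cadj z a; sun_zb : cadj z b; sun_zc : ~~ cadj z c;
  sun_Na : forall u, cadj a u -> u \in [:: a; b; c; y; z];
  sun_Nb : forall u, cadj b u -> u \in [:: a; b; c; x; z];
  sun_Nc : forall u, cadj c u -> u \in [:: a; b; c; x; y];
  sun_xyz : ~ [/\ cadj x y, cadj y z & cadj x z];
  sun_deg_xy : cadj x y -> (degree x <= 4)%N /\ (degree y <= 4)%N;
  sun_deg_yz : cadj y z -> (degree y <= 4)%N /\ (degree z <= 4)%N;
  sun_deg_xz : cadj x z -> (degree x <= 4)%N /\ (degree z <= 4)%N }.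

Lemma good_sun_swap12 a b c x y z :
  good_sun a b c x y z -> good_sun b a c y x z.
Proof.
case=> ab bc ac xb xc xa ya yc yb za zb zc Na Nb Nc xyz dxy dyz dxz.
split => //; try by rewrite cadj_sym.
- by move=> u /Nb; rewrite !inE; do 5?case: (u == _).
- by move=> u /Na; rewrite !inE; do 5?case: (u == _).
- by move=> u /Nc; rewrite !inE; do 5?case: (u == _).
- by move=> [yx xz yz]; apply: xyz; split => //; rewrite cadj_sym.
- by rewrite cadj_sym => /dxy[].
Qed.

Lemma good_sun_swap23 a b c x y z :
  good_sun a b c x y z -> good_sun a c b x z y.
Proof.
case=> ab bc ac xb xc xa ya yc yb za zb zc Na Nb Nc xyz dxy dyz dxz.
split => //; try by rewrite cadj_sym.
- by move=> u /Na; rewrite !inE; do 5?case: (u == _).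
- by move=> u /Nc; rewrite !inE; do 5?case: (u == _).
- by move=> u /Nb; rewrite !inE; do 5?case: (u == _).
- by move=> [xz zy xy]; apply: xyz; split => //; rewrite cadj_sym.
- by rewrite cadj_sym => /dyz[].
Qed.

Lemma good_sun_rot a b c x y z : good_sun a b c x y z -> good_sun b c a y z x.
Proof. by move=> /good_sun_swap12/good_sun_swap23. Qed.

Lemma complete3 a b c : cadj a b -> cadj b c -> cadj a c ->
  complete_sub [set a; b; c]%SET.
Proof.
move=> ab bc ac; apply/complete_subP; split.
  by apply/set0Pn; exists a; rewrite !inE eqxx.
move=> u v; rewrite !inE => /orP[/orP[]|]/eqP-> /orP[/orP[]|]/eqP->;
  by rewrite ?cadjxx // cadj_sym.
Qed.

Lemma clique_cadj Q u v : clique Q -> u \in Q -> v \in Q -> cadj u v.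
Proof. by move=> /cliqueP[_ + _]; exact. Qed.

Lemma clique_mem Q u : clique Q -> (forall v, v \in Q -> cadj u v) -> u \in Q.
Proof. by move=> /cliqueP[_ _ +]; exact. Qed.

Lemma sun_clique_abc a b c x y z :
  good_sun a b c x y z -> clique [set a; b; c]%SET.
Proof.
move=> S; apply/cliqueP.
have /complete_subP[T0 cT] := complete3 (sun_ab S) (sun_bc S) (sun_ac S).
split => // u uT.
have [ua ub uc] : [/\ cadj u a, cadj u b & cadj u c].
  by split; apply: uT; rewrite !inE eqxx ?orbT.
have := sun_Na S; rewrite cadj_sym in ua; move=> /(_ u ua).
rewrite !inE -!orbA => /or4P[->|->|->|/orP[]/eqP uE]; rewrite ?orbT //.
  by have := sun_yb S; rewrite -uE ub.
by have := sun_zc S; rewrite -uE uc.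
Qed.

Lemma sun_clique_abz a b c x y z :
  good_sun a b c x y z -> clique [set a; b; z]%SET.
Proof.
move=> S; apply/cliqueP.
have bz : cadj b z by rewrite cadj_sym (sun_zb S).
have az : cadj a z by rewrite cadj_sym (sun_za S).
have /complete_subP[T0 cT] := complete3 (sun_ab S) bz az.
split => // u uT.
have [ua ub uz] : [/\ cadj u a, cadj u b & cadj u z].
  by split; apply: uT; rewrite !inE eqxx ?orbT.
have := sun_Na S; rewrite cadj_sym in ua; move=> /(_ u ua).
rewrite !inE -!orbA => /or4P[->|->|/eqP uE|/orP[/eqP uE|->]]; rewrite ?orbT //.
  by have := sun_zc S; rewrite -uE cadj_sym uz.
by have := sun_yb S; rewrite -uE ub.
Qed.

(** The other neighbours of [a] are [b], [c], [y], [z], with [y] not adjacent to [b] and [z] not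
    adjacent to [c]. A clique through [a] is therefore found by asking which of [b] and [c] it
    contains. *)
Lemma sun_cliques_through a b c x y z Q :
  good_sun a b c x y z -> clique Q -> a \in Q ->
  [\/ Q = [set a; b; c]%SET, Q = [set a; b; z]%SET, Q = [set a; c; y]%SET |
      cadj y z /\ Q = [set a; y; z]%SET].
Proof.
move=> S cQ aQ.
have az : cadj a z by rewrite cadj_sym (sun_za S).
have ay : cadj a y by rewrite cadj_sym (sun_ya S).
have bz : cadj b z by rewrite cadj_sym (sun_zb S).
have cy : cadj c y by rewrite cadj_sym (sun_yc S).
have NQ u : u \in Q -> u \in [:: a; b; c; y; z].
  by move=> uQ; apply: (sun_Na S); exact: clique_cadj cQ aQ uQ.
have byQ : b \in Q -> y \notin Q.
  move=> bQ; apply/negP => yQ; have := sun_yb S.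
  by rewrite (clique_cadj cQ yQ bQ).
have czQ : c \in Q -> z \notin Q.
  move=> bQ; apply/negP => yQ; have := sun_zc S.
  by rewrite (clique_cadj cQ yQ bQ).
have sub (A : {set H}) : complete_sub A ->
    (forall u, u \in Q -> u \in [:: a; b; c; y; z] -> u \in A) -> Q = A.
  move=> cA QA; apply: clique_max cA => //; apply/fintype.subsetP => u uQ.
  by apply: QA => //; exact: NQ.
case: (boolP (b \in Q)) => bQ; case: (boolP (c \in Q)) => cinQ.
- apply: Or41; apply: sub; first exact: complete3 (sun_ab S) (sun_bc S) (sun_ac S).
  move=> u uQ; rewrite !inE -!orbA => /or4P[->|->|->|/orP[]/eqP uE]; rewrite ?orbT //.
    by have := byQ bQ; rewrite -uE uQ.
  by have := czQ cinQ; rewrite -uE uQ.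
- apply: Or42; apply: sub; first exact: complete3 (sun_ab S) bz az.
  move=> u uQ; rewrite !inE -!orbA => /or4P[->|->|/eqP uE|/orP[/eqP uE|->]]; rewrite ?orbT //.
    by rewrite -uE uQ in cinQ.
  by have := byQ bQ; rewrite -uE uQ.
- apply: Or43; apply: sub; first exact: complete3 (sun_ac S) cy ay.
  move=> u uQ; rewrite !inE -!orbA => /or4P[->|/eqP uE|->|/orP[->|/eqP uE]]; rewrite ?orbT //.
    by rewrite -uE uQ in bQ.
  by have := czQ cinQ; rewrite -uE uQ.
- have aQE u : u \in Q -> [|| u == a, u == y | u == z].
    move=> uQ; have := NQ u uQ; rewrite !inE => /or4P[->|/eqP uE|/eqP uE|/orP[]->]; rewrite ?orbT //.
      by rewrite -uE uQ in bQ.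
    by rewrite -uE uQ in cinQ.
  case: (boolP (cadj y z)) => yz.
    apply: Or44; split => //; apply: sub; first exact: complete3 ay yz az.
    by move=> u uQ _; rewrite !inE -orbA aQE.
  case: (boolP (y \in Q)) => yQ.
    apply: Or43; apply: sub; first exact: complete3 (sun_ac S) cy ay.
    move=> u uQ _; rewrite !inE; case/or3P: (aQE u uQ) => [->|->|/eqP uE]; rewrite ?orbT //.
    by rewrite (clique_cadj cQ yQ) // -uE in yz.
  apply: Or42; apply: sub; first exact: complete3 (sun_ab S) bz az.
  move=> u uQ _; rewrite !inE; case/or3P: (aQE u uQ) => [->|/eqP uE|->]; rewrite ?orbT //.
  by rewrite -uE uQ in yQ.
Qed.

Definition sun_local : Prop := forall F, F != finset.set0 ->
  (forall Q, Q \in F -> clique Q) ->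
  {in F &, forall Q P, (Q :&: P != finset.set0)%SET} ->
  (forall v, exists2 Q, Q \in F & v \notin Q) ->
  exists a b c x y z, [/\ good_sun a b c x y z,
    [/\ [set b; c; x]%SET \in F, [set a; c; y]%SET \in F &
        [set a; b; z]%SET \in F] &
    forall Q, Q \in F -> [\/ Q = [set a; b; c]%SET, Q = [set b; c; x]%SET,
        Q = [set a; c; y]%SET | Q = [set a; b; z]%SET]].

(** Identifying any two of the six vertices contradicts one of the three nonadjacencies. The tuple
    of equations serves as a single rewrite rule. *)
Lemma presun_neqE a b c x y z :
  cadj a b -> cadj b c -> cadj a c -> cadj x b -> cadj x c -> ~~ cadj x a ->
  cadj y a -> cadj y c -> ~~ cadj y b -> cadj z a -> cadj z b -> ~~ cadj z c ->
  (((a == b) = false) * ((a == c) = false) * ((a == x) = false) * ((a == y) = false) *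
  ((a == z) = false) * ((b == a) = false) * ((b == c) = false) * ((b == x) = false) *
  ((b == y) = false) * ((b == z) = false) * ((c == a) = false) * ((c == b) = false) *
  ((c == x) = false) * ((c == y) = false) * ((c == z) = false) * ((x == a) = false) *
  ((x == b) = false) * ((x == c) = false) * ((x == y) = false) * ((x == z) = false) *
  ((y == a) = false) * ((y == b) = false) * ((y == c) = false) * ((y == x) = false) *
  ((y == z) = false) * ((z == a) = false) * ((z == b) = false) * ((z == c) = false) *
  ((z == x) = false) * ((z == y) = false))%type.
Proof.
move=> ab bc ac xb xc /negP xa ya yc /negP yb za zb /negP zc.
have [ba cb ca] : [/\ cadj b a, cadj c b & cadj c a].
  by rewrite !(cadj_sym _ a) (cadj_sym c).
have [aa bb cc] := And3 (cadjxx a) (cadjxx b) (cadjxx c).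
by do ! split; apply/negbTE/eqP => E; subst; contradiction.
Qed.

Definition sun_neqE a b c x y z (S : good_sun a b c x y z) :=
  presun_neqE (sun_ab S) (sun_bc S) (sun_ac S) (sun_xb S) (sun_xc S) (sun_xa S)
    (sun_ya S) (sun_yc S) (sun_yb S) (sun_za S) (sun_zb S) (sun_zc S).

End suns.

Section sun_families.
Variable H : sgraph.
Variables a b c x y z : H.
Hypothesis S : good_sun a b c x y z.

Definition sun_set (Q : {set H}) : Prop :=
  [\/ Q = [set a; b; c]%SET, Q = [set b; c; x]%SET,
      Q = [set a; c; y]%SET | Q = [set a; b; z]%SET].

Lemma sun_no_common v : v \in [set b; c; x]%SET -> v \in [set a; c; y]%SET ->
  v \notin [set a; b; z]%SET.
Proof.
have N := sun_neqE S; rewrite !inE.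
have [->|va] := eqVneq v a; first by rewrite !N.
have [->|vb] := eqVneq v b; first by rewrite !N.
have [->|vc] := eqVneq v c; first by rewrite !N.
by move=> /= /eqP ->; rewrite N.
Qed.

(** The centre consists of the vertices that lie in two of the outer triangles. This description is
    symmetric, so the outer triangles determine the centre however the sun is labelled. *)
Lemma sun_majority : ([set b; c; x] :&: [set a; c; y] :|:
    ([set a; c; y] :&: [set a; b; z]) :|: ([set b; c; x] :&: [set a; b; z]) =
  [set a; b; c])%SET.
Proof.
have N := sun_neqE S; apply/setP => v; rewrite !inE.
case: (v == a); case: (v == b); case: (v == c); rewrite ?orbT ?andbT //=.
have [->|_] := eqVneq v x; first by rewrite !N.
by have [->|_] := eqVneq v y; rewrite ?N.
Qed.

(** Any two of the four triangles meet, and the centre has a vertex in common with any two outer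
    ones. Three of them without a common vertex can thus only be the three outer ones, in some
    order. *)
Lemma sun_three (X Y Z : {set H}) : sun_set X -> sun_set Y -> sun_set Z ->
  (forall v, v \in X -> v \in Y -> v \notin Z) ->
  [/\ [/\ X != [set a; b; c]%SET, Y != [set a; b; c]%SET &
          Z != [set a; b; c]%SET],
      [/\ [set b; c; x]%SET \in [:: X; Y; Z], [set a; c; y]%SET \in [:: X; Y; Z] &
          [set a; b; z]%SET \in [:: X; Y; Z]] &
      (X :&: Y :|: (Y :&: Z) :|: (X :&: Z) = [set a; b; c])%SET].
Proof.
have N := sun_neqE S.
have neq u : u \notin [set a; b; c]%SET -> forall A : {set H}, u \in A ->
    A != [set a; b; c]%SET.
  by move=> uN A uA; apply: contraNneq uN => <-.
have NA : [set b; c; x]%SET != [set a; b; c]%SET.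
  by apply: (neq x); rewrite !inE ?eqxx ?orbT ?N.
have NB : [set a; c; y]%SET != [set a; b; c]%SET.
  by apply: (neq y); rewrite !inE ?eqxx ?orbT ?N.
have NC : [set a; b; z]%SET != [set a; b; c]%SET.
  by apply: (neq z); rewrite !inE ?eqxx ?orbT ?N.
have maj := sun_majority.
move=> sX sY sZ nc; move: nc.
case: sX => ->; case: sY => ->; case: sZ => -> nc;
  try (by have := nc a; rewrite !inE ?eqxx ?orbT => /(_ isT isT));
  try (by have := nc b; rewrite !inE ?eqxx ?orbT => /(_ isT isT));
  try (by have := nc c; rewrite !inE ?eqxx ?orbT => /(_ isT isT)).
all: split; [by split|by rewrite !inE !eqxx !orbT|rewrite -maj].
all: by apply/setP => v; rewrite !finset.in_setU !finset.in_setI;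
  case: (v \in [set b; c; x]%SET); case: (v \in [set a; c; y]%SET);
  case: (v \in [set a; b; z]%SET).
Qed.

End sun_families.

(** Sun-locality yields some sun, a priori a different one. The given outer triangles have no common
    vertex, so they are also the outer triangles of that sun, and by majority the two centres
    agree. *)
Lemma sun_local_family (H : sgraph) (a b c x y z : H) (F : {set {set H}}) :
  sun_local H -> good_sun a b c x y z -> (forall Q, Q \in F -> clique Q) ->
  {in F &, forall Q P, (Q :&: P != finset.set0)%SET} ->
  [set b; c; x]%SET \in F -> [set a; c; y]%SET \in F ->
  [set a; b; z]%SET \in F ->
  forall Q, Q \in F -> sun_set a b c x y z Q.
Proof.
move=> locH S cF F2 AF BF CF.
have F0 : F != finset.set0 by apply/set0Pn; eexists; exact: AF.
have Fnc v : exists2 Q, Q \in F & v \notin Q.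
  case: (boolP (v \in [set b; c; x]%SET)) => vA; last by eexists; first exact: AF.
  case: (boolP (v \in [set a; c; y]%SET)) => vB; last by eexists; first exact: BF.
  by eexists; [exact: CF|exact: sun_no_common S _ vA vB].
have [a' [b' [c' [x' [y' [z' [S' _ F4]]]]]]] := locH F F0 cF F2 Fnc.
have [_ [A' B' C'] maj] := sun_three S' (F4 _ AF) (F4 _ BF) (F4 _ CF)
  (@sun_no_common _ _ _ _ _ _ _ S).
have perm Q : Q \in [:: [set b; c; x]%SET; [set a; c; y]%SET; [set a; b; z]%SET] ->
    sun_set a b c x y z Q.
  by rewrite !inE => /or3P[]/eqP ->; [exact: Or42|exact: Or43|exact: Or44].
move=> Q /F4[]->; try exact: perm.
by apply: Or41; rewrite -maj sun_majority.
Qed.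

Lemma Cl_dowker (H : sgraph) :
  Cl H = dowker_complex (fun v (Q : clique_graph H) => v \in cset Q).
Proof.
apply/setP => s; rewrite !inE; apply/idP/idP => [cs|/andP[s0 /existsP[Q /forall_inP sQ]]].
  have [Q sQ] := exists_clique_graph cs.
  have /complete_subP[-> _] := cs; apply/existsP; exists Q.
  by apply/forall_inP => v /(fintype.subsetP sQ).
by apply/complete_subP; split => // u v /sQ uQ /sQ vQ; exact: cset_cadj uQ vQ.
Qed.

(* Among the families of pairwise intersecting cliques, those with a common vertex
   form the nerve of the cover by cliques; the other ones contain the three outer
   triangles of a sun, and the central triangle is a cone point for them. *)
Theorem sun_local_clique_graph (R : realType) (H : sgraph) :
  sun_local H -> homotopic_graphs R (clique_graph H) H.
Proof.
move=> locH; pose K := clique_graph H.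
(* A simplex of three outer triangles to be deleted, paired with the central triangle as its
   apex. *)
pose P (p : {set K} * K) : Prop := exists a b c x y z, exists A B C : K,
  [/\ good_sun a b c x y z, p.1 = [set A; B; C]%SET,
      [/\ cset A = [set b; c; x]%SET, cset B = [set a; c; y]%SET &
          cset C = [set a; b; z]%SET] & cset p.2 = [set a; b; c]%SET].
pose L := [seq p <- enum {: {set K} * K} | `[< P p >]].
have LP p : reflect (P p) (p \in L).
  by rewrite mem_filter mem_enum andbT; exact: asboolP.
have famP (s : {set K}) : s \in Cl K -> let F := (@cset H @: s)%SET in
    [/\ F != finset.set0, (forall Q, Q \in F -> clique Q) &
       {in F &, forall Q P, (Q :&: P != finset.set0)%SET}].
  rewrite inE => /complete_subP[/set0Pn[Q0 Q0s] cs]; split.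
  - by apply/set0Pn; exists (cset Q0); exact: imset_f.
  - by move=> _ /imsetP[Q _ ->]; exact: csetP.
  - move=> _ _ /imsetP[Q Qs ->] /imsetP[Q' Qs' ->].
    by rewrite -cadj_clique_graph; exact: cs.
have starP s p : s \in Cl K -> P p -> p.1 \subset s ->
    exists a b c x y z, [/\ good_sun a b c x y z, cset p.2 = [set a; b; c]%SET &
      forall Q, Q \in (p.2 |: s)%SET -> sun_set a b c x y z (cset Q)].
  move=> sK [a [b [c [x [y [z [A [B [C [S -> [EA EB EC] Et]]]]]]]]]] ps.
  have [F0 cF F2] := famP s sK.
  have AF : [set b; c; x]%SET \in (@cset H @: s)%SET.
    by rewrite -EA; apply/imset_f/(fintype.subsetP ps); rewrite !inE eqxx.
  have BF : [set a; c; y]%SET \in (@cset H @: s)%SET.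
    by rewrite -EB; apply/imset_f/(fintype.subsetP ps); rewrite !inE eqxx orbT.
  have CF : [set a; b; z]%SET \in (@cset H @: s)%SET.
    by rewrite -EC; apply/imset_f/(fintype.subsetP ps); rewrite !inE eqxx orbT.
  exists a, b, c, x, y, z; split => // Q; rewrite finset.in_setU1.
  move=> /predU1P[->|Qs]; first exact: Or41.
  by apply: (sun_local_family locH S cF F2 AF BF CF); exact: imset_f.
have apexP p : P p -> [/\ p.1 != finset.set0, p.2 \notin p.1 &
    forall v, exists2 Q, Q \in p.1 & v \notin cset Q].
  move=> [a [b [c [x [y [z [A [B [C [S -> [EA EB EC] Et]]]]]]]]]].
  have [] := sun_three S (Or42 _ _ _ erefl) (Or43 _ _ _ erefl) (Or44 _ _ _ erefl)
    (@sun_no_common _ _ _ _ _ _ _ S).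
  move=> [nA nB nC] _ _; split.
  - by apply/set0Pn; exists A; rewrite !inE eqxx.
  - rewrite !inE -orbA; apply/negP => /or3P[]/eqP E; move: Et; rewrite E.
    + by rewrite EA => /eqP; rewrite (negbTE nA).
    + by rewrite EB => /eqP; rewrite (negbTE nB).
    + by rewrite EC => /eqP; rewrite (negbTE nC).
  - move=> v; case: (boolP (v \in cset A)) => vA.
      case: (boolP (v \in cset B)) => vB.
        exists C; first by rewrite !inE eqxx orbT.
        by rewrite EC; apply: (sun_no_common S); rewrite -?EA -?EB.
      by exists B; rewrite // !inE eqxx orbT.
    by exists A; rewrite // !inE eqxx.
pose D : {set {set K}} :=
  [set s in Cl K | all (fun p : {set K} * K => ~~ (p.1 \subset s)) L]%SET.
rewrite /homotopic_graphs /Cl_space.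
apply: (@homotopy_equivalent_trans _ (set_type (realization R D))).
  apply: star_removal_seq; first exact: simplicial_Cl.
  move=> p /LP Pp; have [p0 pp _] := apexP p Pp; split => // s sK ps.
  have [a [b [c [x [y [z [S Et Qsun]]]]]]] := starP s p sK Pp ps.
  have tcadj Q : Q \in s -> cadj p.2 Q.
    move=> Qs; rewrite cadj_clique_graph Et; have := Qsun Q.
    rewrite finset.in_setU1 Qs orbT => /(_ isT)[]->; apply/set0Pn;
      try (by exists a; rewrite !inE eqxx ?orbT);
      by exists b; rewrite !inE eqxx ?orbT.
  split.
    move: sK; rewrite !inE => /complete_subP[_ cs]; apply/complete_subP; split.
      by apply/set0Pn; exists p.2; rewrite finset.setU11.
    move=> Q Q'; rewrite !finset.in_setU1.
    move=> /predU1P[->|Qs] /predU1P[->|Qs'];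
      [exact: cadjxx|exact: tcadj|by rewrite cadj_sym; exact: tcadj|exact: cs].
  (* Adding the centre [p.2] completes no other listed simplex: all members of [p.2 |: s] belong to
     one sun, and three of them without a common vertex are its outer triangles, none of which is
     [p.2]. *)
  move=> q /LP Pq qs; have [_ _ qnc] := apexP q Pq.
  have := Pq; move=> [_ [_ [_ [_ [_ [_ [A [B [C [_ qE _ _]]]]]]]]]].
  have /Qsun sA : A \in (p.2 |: s)%SET.
    by apply: (fintype.subsetP qs); rewrite qE !inE eqxx.
  have /Qsun sB : B \in (p.2 |: s)%SET.
    by apply: (fintype.subsetP qs); rewrite qE !inE eqxx orbT.
  have /Qsun sC : C \in (p.2 |: s)%SET.
    by apply: (fintype.subsetP qs); rewrite qE !inE eqxx orbT.
  have [|[nA nB nC] _ _] := sun_three S sA sB sC.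
    move=> v vA vB; have [Q] := qnc v; rewrite qE !inE -orbA.
    by move=> /or3P[]/eqP-> //; rewrite ?vA ?vB.
  have ptq : p.2 \notin q.1.
    rewrite qE !inE -orbA; apply/negP => /or3P[]/eqP E; move: Et; rewrite E => /eqP.
    + by rewrite (negbTE nA).
    + by rewrite (negbTE nB).
    + by rewrite (negbTE nC).
  apply/fintype.subsetP => Q Qq; have := fintype.subsetP qs Q Qq.
  by rewrite finset.in_setU1 => /predU1P[QE|//]; rewrite -QE Qq in ptq.
rewrite Cl_dowker; apply: homotopy_equivalent_sym.
(* What remains are the cliques with a common vertex: without one, sun-locality would find three
   outer triangles in [s]. *)
rewrite (_ : D = dowker_complex (fun (Q : K) v => v \in cset Q)).
  exact: dowker_duality.
apply/setP => s; rewrite inE [RHS]inE.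
apply/andP/andP => [[sK /allP sL]|[s0 /existsP[v /forall_inP sv]]].
  have [F0 cF F2] := famP s sK.
  move: (sK); rewrite inE => /complete_subP[-> _]; split => //.
  apply/existsP; apply: contrapT => nc.
  have Fnc v : exists2 Q, Q \in (@cset H @: s)%SET & v \notin Q.
    apply: contrapT => ncv; apply: nc; exists v; apply/forall_inP => Q Qs.
    apply/negPn/negP => vQ; apply: ncv; exists (cset Q) => //.
    exact: imset_f.
  have [a [b [c [x [y [z [S [AF BF CF] F4]]]]]]] := locH _ F0 cF F2 Fnc.
  have [A As EA] := imsetP AF; have [B Bs EB] := imsetP BF.
  have [C Cs EC] := imsetP CF; have [t Et] := exists_cset (sun_clique_abc S).
  have /sL : ([set A; B; C]%SET, t) \in L.
    by apply/LP; exists a, b, c, x, y, z, A, B, C.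
  move=> /negP[]; apply/fintype.subsetP => Q /=.
  by rewrite !inE -orbA => /or3P[]/eqP->.
have sK : s \in Cl K.
  rewrite inE; apply/complete_subP; split => // Q Q' Qs Qs'.
  by apply/cadj_clique_graphP; exists v; apply: sv.
split => //; apply/allP => p /LP Pp; apply/negP => ps.
have [_ _ /(_ v)[Q Qp]] := apexP p Pp.
by rewrite sv //; exact: (fintype.subsetP ps).
Qed.

(** * Domination cores of clique graphs *)

Lemma set3C (T : finType) (a b c : T) : [set a; b; c]%SET = [set b; a; c]%SET.
Proof. by rewrite [(_ :|: [set b])%SET]finset.setUC. Qed.

Lemma set3CA (T : finType) (a b c : T) : [set a; b; c]%SET = [set a; c; b]%SET.
Proof. by rewrite finset.setUAC. Qed.

Lemma degree_le4_nbr (H : sgraph) (x b c y : H) :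
  (degree x <= 4)%N -> adj x b -> adj x c -> adj x y -> uniq [:: b; c; y] ->
  exists w, forall u, cadj x u -> u \in [:: x; b; c; y; w].
Proof.
move=> dx xb xc xy U.
have : (#|[set u | adj x u] :\: [set:: [:: b; c; y]]|%SET <= 1)%N.
  have := finset.cardsID [set:: [:: b; c; y]]%SET [set u | adj x u]%SET.
  have -> : ([set u | adj x u] :&: [set:: [:: b; c; y]] = [set:: [:: b; c; y]])%SET.
    apply/finset.setIidPr/fintype.subsetP => u; rewrite !inE.
    by move=> /or3P[]/eqP->.
  rewrite cardsE (card_uniqP U) /=.
  have -> : #|[set u | adj x u]%SET| = degree x by rewrite cardsE.
  by move=> E; move: dx; rewrite -E -[4%N]/(3 + 1)%N leq_add2l.
set D := (_ :\: _)%SET => D1.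
have [D0|[w wD]] := finset.set_0Vmem D.
  (* Without a fourth neighbour, [x] itself fills the last slot. *)
  exists x => u; rewrite /cadj /= => /predU1P[->|xu]; first by rewrite !inE eqxx.
  have : u \notin D by rewrite D0 inE.
  rewrite !inE xu andbT negbK => /or3P[]->; by rewrite ?orbT.
exists w => u; rewrite /cadj /= => /predU1P[->|xu]; first by rewrite !inE eqxx.
case: (boolP (u \in D)) => uD.
  by rewrite (fintype.card_le1_eqP D1 _ _ uD wD) !inE eqxx !orbT.
move: uD; rewrite !inE xu andbT negbK => /or3P[]->; by rewrite ?orbT.
Qed.

(** [E] describes a possible fourth neighbour, which need not exist but is unique. *)
Lemma degree_le4 (H : sgraph) (v p q r : H) (E : H -> Prop) :
  (forall u, adj v u -> u \in [:: p; q; r] \/ E u) ->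
  (forall u u', E u -> E u' -> u = u') -> (degree v <= 4)%N.
Proof.
move=> vE E1.
have [w wP] : exists w, forall u, adj v u -> u \in [:: p; q; r; w].
  have [[w Ew]|nE] := pselect (exists w, E w).
    exists w => u /vE[|Eu]; first by rewrite !inE => /or3P[]->; rewrite ?orbT.
    by rewrite (E1 _ _ Eu Ew) !inE eqxx !orbT.
  exists p => u /vE[|Eu]; first by rewrite !inE => /or3P[]->; rewrite ?orbT.
  by case: nE; exists u.
apply: leq_trans (card_size [:: p; q; r; w]).
by apply: subset_leq_card; apply/fintype.subsetP => u; exact: wP.
Qed.

(** * Cliques of a domination core [M], whose vertices stand for cliques [s Q] of [H] *)

Section sun_clique_graph.
Variables (H M : sgraph) (s : M -> {set H}).
Hypothesis locH : sun_local H.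
Hypothesis s_inj : injective s.
Hypothesis s_clique : forall Q, clique (s Q).
Hypothesis s_cadj : forall Q P, cadj Q P = (s Q :&: s P != finset.set0)%SET.
Hypothesis s_dom : forall P, clique P -> exists Q, forall P', clique P' ->
  (P :&: P' != finset.set0)%SET -> (s Q :&: P' != finset.set0)%SET.
Hypothesis s_min : forall Q Q', (forall P, clique P ->
  (s Q :&: P != finset.set0)%SET -> (s Q' :&: P != finset.set0)%SET) -> Q = Q'.

Implicit Types (a b c x y z u v w : H) (Q P : M) (T : {set M}).

Lemma s_cadjP Q P : reflect (exists2 v, v \in s Q & v \in s P) (cadj Q P).
Proof.
rewrite s_cadj; apply: (iffP (set0Pn _)) => -[v].
  by rewrite finset.in_setI => /andP[]; exists v.
by exists v; rewrite finset.in_setI; apply/andP.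
Qed.

Lemma s_mem_cadj v Q P : v \in s Q -> v \in s P -> cadj Q P.
Proof. by move=> vQ vP; apply/s_cadjP; exists v. Qed.

Lemma s_cadj_mem Q u v : u \in s Q -> v \in s Q -> cadj u v.
Proof. exact: clique_cadj. Qed.

(** A clique that meets the centre but not the outer triangle [bcx] must be [ayz]. If [y] and [z]
    are not adjacent, the centre is dominated by [QA], and minimality would identify the two. *)
Lemma sun_not_center_yz a b c x y z Q QA : good_sun a b c x y z ->
  ~~ cadj y z -> s QA = [set b; c; x]%SET -> s Q <> [set a; b; c]%SET.
Proof.
move=> S yz EA EQ; have N := sun_neqE S.
suff : Q = QA.
  by move=> QQA; move: EQ; rewrite QQA EA => /setP/(_ a); rewrite !inE !N eqxx.
apply: s_min => P cP /set0Pn[v]; rewrite EQ EA !inE => /andP[vt vP].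
apply/set0Pn; case/orP: vt => [/orP[]|] /eqP vE; subst v.
- have [] := sun_cliques_through S cP vP => [->|->|->|[yz' _]].
  + by exists b; rewrite !inE !eqxx !orbT.
  + by exists b; rewrite !inE !eqxx !orbT.
  + by exists c; rewrite !inE !eqxx !orbT.
  + by rewrite yz' in yz.
- by exists b; rewrite !inE vP eqxx.
- by exists c; rewrite !inE vP eqxx orbT.
Qed.

(** The cliques of [M] that are not stars: the outer triangles of a sun meet pairwise, but not in
    one vertex. *)
Record tie T a b c x y z QA QB QC : Prop := Tie {
  tie_sun : good_sun a b c x y z;
  tie_A : s QA = [set b; c; x]%SET;
  tie_B : s QB = [set a; c; y]%SET;
  tie_C : s QC = [set a; b; z]%SET;
  tie_E : T = [set QA; QB; QC]%SET }.

Lemma tie_swap12 T a b c x y z QA QB QC :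
  tie T a b c x y z QA QB QC -> tie T b a c y x z QB QA QC.
Proof.
case=> S EA EB EC TE; split; first exact: good_sun_swap12.
- by rewrite EB.
- by rewrite EA.
- by rewrite EC set3C.
- by rewrite TE set3C.
Qed.

Lemma tie_swap23 T a b c x y z QA QB QC :
  tie T a b c x y z QA QB QC -> tie T a c b x z y QA QC QB.
Proof.
case=> S EA EB EC TE; split; first exact: good_sun_swap23.
- by rewrite EA set3C.
- by rewrite EC.
- by rewrite EB.
- by rewrite TE set3CA.
Qed.

Lemma tie_rot T a b c x y z QA QB QC :
  tie T a b c x y z QA QB QC -> tie T b c a y z x QB QC QA.
Proof. by move=> /tie_swap12/tie_swap23. Qed.

(** By [sun_xyz] some two outer vertices are nonadjacent, and [sun_not_center_yz] applies after
    relabelling. *)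
Lemma sun_not_center a b c x y z QA QB QC Q : good_sun a b c x y z ->
  s QA = [set b; c; x]%SET -> s QB = [set a; c; y]%SET ->
  s QC = [set a; b; z]%SET -> s Q <> [set a; b; c]%SET.
Proof.
move=> S EA EB EC.
case: (boolP (cadj y z)) => yz; last exact: sun_not_center_yz S yz EA.
case: (boolP (cadj x z)) => xz; last first.
  rewrite set3C; exact: sun_not_center_yz (good_sun_swap12 S) xz EB.
case: (boolP (cadj x y)) => xy; first by case: (sun_xyz S).
rewrite set3CA set3C; move/good_sun_rot/good_sun_rot: S => S.
exact: sun_not_center_yz S xy EC.
Qed.

Lemma tie_not_center T a b c x y z QA QB QC Q :
  tie T a b c x y z QA QB QC -> s Q <> [set a; b; c]%SET.
Proof. by case=> S EA EB EC _; exact: sun_not_center S EA EB EC. Qed.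

(** Sun-locality of [H] leaves the central triangle as the only possible fourth member, and the
    centre is not in the core. *)
Lemma tie_exists T : clique T -> (forall v, exists2 Q, Q \in T & v \notin s Q) ->
  exists a b c x y z QA QB QC, tie T a b c x y z QA QB QC.
Proof.
move=> cT nc; have /cliqueP[/set0Pn[Q0 Q0T] cT2 _] := cT.
have [||||a [b [c [x [y [z [S [AF BF CF] F4]]]]]]] := locH (F := (s @: T)%SET).
- by apply/set0Pn; exists (s Q0); exact: imset_f.
- by move=> _ /imsetP[Q _ ->].
- by move=> _ _ /imsetP[Q QT ->] /imsetP[P PT ->]; rewrite -s_cadj cT2.
- by move=> v; have [Q QT vQ] := nc v; exists (s Q) => //; exact: imset_f.
have [QA QAT /esym EA] := imsetP AF; have [QB QBT /esym EB] := imsetP BF.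
have [QC QCT /esym EC] := imsetP CF.
exists a, b, c, x, y, z, QA, QB, QC; split => //.
apply/setP => Q; rewrite !inE -orbA; apply/idP/or3P => [QT|[]/eqP-> //].
have /F4[] : s Q \in (s @: T)%SET by exact: imset_f.
- by move=> /(sun_not_center S EA EB EC).
- by rewrite -EA => /s_inj ->; apply: Or31.
- by rewrite -EB => /s_inj ->; apply: Or32.
- by rewrite -EC => /s_inj ->; apply: Or33.
Qed.

Lemma tie_through_a T a b c x y z QA QB QC Q :
  tie T a b c x y z QA QB QC -> a \in s Q ->
  [\/ Q = QB, Q = QC | cadj y z /\ s Q = [set a; y; z]%SET].
Proof.
move=> t aQ; case: (t) => S EA EB EC _.
have [] := sun_cliques_through S (s_clique Q) aQ => [E|E|E|E]; last exact: Or33.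
- by case: (tie_not_center t E).
- by apply: Or32; apply: s_inj; rewrite E EC.
- by apply: Or31; apply: s_inj; rewrite E EB.
Qed.

Lemma tie_through_b T a b c x y z QA QB QC Q :
  tie T a b c x y z QA QB QC -> b \in s Q ->
  [\/ Q = QA, Q = QC | cadj x z /\ s Q = [set b; x; z]%SET].
Proof. by move=> /tie_swap12 t /(tie_through_a t). Qed.

Lemma tie_through_c T a b c x y z QA QB QC Q :
  tie T a b c x y z QA QB QC -> c \in s Q ->
  [\/ Q = QA, Q = QB | cadj x y /\ s Q = [set c; x; y]%SET].
Proof. by move=> /tie_swap23/tie_swap12 t /(tie_through_a t). Qed.

Definition star v T : Prop := forall Q, Q \in T = (v \in s Q).

(** If the members share a vertex [v], then every [Q] through [v] meets all of them and belongs to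
    [T] by maximality. *)
Lemma star_or_tie T : clique T ->
  (exists v, star v T) \/
  exists a b c x y z QA QB QC, tie T a b c x y z QA QB QC.
Proof.
move=> cT; have [[v vT]|nc] := pselect (exists v, forall Q, Q \in T -> v \in s Q).
  left; exists v => Q; apply/idP/idP => [|vQ]; first exact: vT.
  by apply: clique_mem cT _ => P /vT vP; exact: s_mem_cadj vQ vP.
right; apply: tie_exists => // v; apply: contrapT => ncv; apply: nc; exists v.
move=> Q QT; apply/negPn/negP => vQ; apply: ncv; by exists Q.
Qed.

(* The tie [T'] has its central triangle opposite to that of [T] in the wheel
   centred at [b]. *)
Definition opposite_b T' a b c x y z QA QC : Prop :=
  exists w Q', [/\ good_sun z b x c w a, s Q' = [set z; x; w]%SET &
                   T' = [set QA; QC; Q']%SET].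

(** Everything is forced by the degree of [b]: [z] is the only neighbour of [b] not adjacent to [c],
    hence equal to [a'], and [a] is then the neighbour of [b] left for [z']. *)
Lemma tie_share_opposite T T' a b c x y z QA QB QC a' y' z' QB' QC' :
  tie T a b c x y z QA QB QC -> tie T' a' b x c y' z' QA QB' QC' ->
  opposite_b T' a b c x y z QA QC.
Proof.
move=> t t'; case: (t) => S EA EB EC TE; case: (t') => S' EA' EB' EC' TE'.
have N := sun_neqE S; have N' := sun_neqE S'.
have a'z : a' = z.
  have ba' : cadj b a' by rewrite cadj_sym (sun_ab S').
  have := sun_xa S'; have := sun_Nb S ba'.
  rewrite !inE => /orP[/eqP->|/or4P[]/eqP-> //].
  + by rewrite cadj_sym (sun_ac S).
  + by rewrite cadj_sym (sun_bc S).
  + by rewrite cadjxx.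
  + by rewrite cadj_sym (sun_xc S).
subst a'.
have z'a : z' = a.
  have ba : cadj b a by rewrite cadj_sym (sun_ab S).
  have := sun_Nb S' ba; rewrite !inE !N /=; by move/eqP.
subst z'; exists y', QB'; split => //.
have QCC : QC' = QC.
  by apply: s_inj; rewrite EC' EC; apply/setP => v; rewrite !inE; do 3!case: (v == _).
by rewrite TE' QCC set3CA.
Qed.

(** The centre vertex opposite to [x] is the only common neighbour of [b] and [c] besides [x], so
    [a'] is [a]; the core has just one member through [a] and [c], and one through [a] and [b]. *)
Lemma tie_share_same T T' a b c x y z QA QB QC a' y' z' QB' QC' :
  tie T a b c x y z QA QB QC -> tie T' a' b c x y' z' QA QB' QC' -> T = T'.
Proof.
move=> t t'; case: (t) => S EA EB EC TE; case: (t') => S' EA' EB' EC' TE'.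
have N := sun_neqE S; have N' := sun_neqE S'.
have a'a : a' = a.
  have ba' : cadj b a' by rewrite cadj_sym (sun_ab S').
  have := sun_Nb S ba'; rewrite !inE !N' => /orP[/eqP//|/= /eqP a'z].
  by have := sun_zc S; rewrite -a'z (sun_ac S').
subst a'; rewrite TE TE'.
have -> : QB' = QB.
  have aQ : a \in s QB' by rewrite EB' !inE eqxx.
  have cQ : c \in s QB' by rewrite EB' !inE eqxx orbT.
  have [//|E|[_ E]] := tie_through_a t aQ; move: cQ.
    by rewrite E EC !inE !N.
  by rewrite E !inE !N.
have -> : QC' = QC.
  have aQ : a \in s QC' by rewrite EC' !inE eqxx.
  have cQ : b \in s QC' by rewrite EC' !inE eqxx orbT.
  have [E|//|[_ E]] := tie_through_a t aQ; move: cQ.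
    by rewrite E EB !inE !N.
  by rewrite E !inE !N.
by [].
Qed.

(** The case distinction is on which vertex of the shared triangle is the outer one in the second
    sun: [x] gives the same tie, while [c] and [b] give opposite ties in the wheels centred at [b]
    and at [c]. *)
Lemma tie_share_A T T' a b c x y z QA QB QC a' b' c' x' y' z' QB' QC' :
  T <> T' ->
  tie T a b c x y z QA QB QC -> tie T' a' b' c' x' y' z' QA QB' QC' ->
  opposite_b T' a b c x y z QA QC \/ opposite_b T' a c b x z y QA QB.
Proof.
move=> TT' t t'; have N' := sun_neqE (tie_sun t').
have b'c' : (b' == c') = false by rewrite N'.
have AA' : [set b; c; x]%SET = [set b'; c'; x']%SET.
  by rewrite -(tie_A t) -(tie_A t').
have mem u : u \in [set b'; c'; x']%SET -> [|| u == b, u == c | u == x].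
  by rewrite -AA' !inE -orbA.
have [b'E c'E x'E] : [/\ [|| b' == b, b' == c | b' == x],
    [|| c' == b, c' == c | c' == x] & [|| x' == b, x' == c | x' == x]].
  by split; apply: mem; rewrite !inE eqxx ?orbT.
case/or3P: x'E => /eqP x'E; subst x'.
- right; move: b'E c'E; rewrite !N' /= => /orP[]/eqP b'E /orP[]/eqP c'E; subst b' c'.
  + by rewrite eqxx in b'c'.
  + exact: tie_share_opposite (tie_swap23 t) t'.
  + exact: tie_share_opposite (tie_swap23 t) (tie_swap23 t').
  + by rewrite eqxx in b'c'.
- left; move: b'E c'E; rewrite !N' /= => /orP[]/eqP b'E /orP[]/eqP c'E; subst b' c'.
  + by rewrite eqxx in b'c'.
  + exact: tie_share_opposite t t'.
  + exact: tie_share_opposite t (tie_swap23 t').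
  + by rewrite eqxx in b'c'.
- case: TT'; move: b'E c'E; rewrite !N' /= !orbF => /orP[]/eqP b'E /orP[]/eqP c'E; subst b' c'.
  + by rewrite eqxx in b'c'.
  + exact: tie_share_same t t'.
  + exact: tie_share_same t (tie_swap23 t').
  + by rewrite eqxx in b'c'.
Qed.

Lemma opposite_sym T' a b c x y z QA QC :
  opposite_b T' a b c x y z QA QC -> opposite_b T' c b a z y x QC QA.
Proof.
case=> w [Q' [S E TE]]; exists w, Q'; split.
- exact: good_sun_swap12 (good_sun_swap23 (good_sun_swap12 S)).
- by rewrite E set3C.
- by rewrite TE set3C.
Qed.

Lemma tie_share T T' a b c x y z QA QB QC a' b' c' x' y' z' QA' QB' QC' Q :
  T <> T' -> Q \in T -> Q \in T' ->
  tie T a b c x y z QA QB QC -> tie T' a' b' c' x' y' z' QA' QB' QC' ->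
  [\/ opposite_b T' b a c y x z QB QC, opposite_b T' a b c x y z QA QC |
      opposite_b T' a c b x z y QA QB].
Proof.
move=> TT' QT QT' t t'.
have {t' QT'} [a1 [b1 [c1 [x1 [y1 [z1 [QB1 [QC1 t1]]]]]]]] : exists a1 b1 c1 x1 y1 z1 QB1 QC1,
    tie T' a1 b1 c1 x1 y1 z1 Q QB1 QC1.
  have : Q \in [set QA'; QB'; QC']%SET by rewrite -(tie_E t').
  rewrite !inE -orbA => /or3P[]/eqP->.
  + by exists a', b', c', x', y', z', QB', QC'.
  + by exists b', c', a', y', z', x', QC', QA'; exact: tie_rot.
  + by exists c', a', b', z', x', y', QA', QB'; exact/tie_rot/tie_rot.
have : Q \in [set QA; QB; QC]%SET by rewrite -(tie_E t).
rewrite !inE -orbA => /or3P[]/eqP QE; subst Q.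
- by have [] := tie_share_A TT' t t1; [exact: Or32|exact: Or33].
- by have [|/opposite_sym] := tie_share_A TT' (tie_swap12 t) t1;
    [exact: Or31|exact: Or33].
- by have [/opposite_sym|/opposite_sym] :=
    tie_share_A TT' (tie_rot (tie_rot t)) t1; [exact: Or31|exact: Or32].
Qed.

(** * Pairwise meeting cliques of [M] without a common member *)

Section family.
Variable F : {set {set M}}.
Hypothesis F0 : F != finset.set0.
Hypothesis F_clique : forall T, T \in F -> clique T.
Hypothesis F_meet : {in F &, forall T T', (T :&: T' != finset.set0)%SET}.
Hypothesis F_nc : forall Q, exists2 T, T \in F & Q \notin T.

Lemma F_meetP T T' : T \in F -> T' \in F -> exists2 Q, Q \in T & Q \in T'.
Proof.
move=> TF TF'; have /set0Pn[Q] := F_meet TF TF'.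
by rewrite inE => /andP[]; exists Q.
Qed.

Lemma F_star_cadj T T' u v : T \in F -> T' \in F -> star u T -> star v T' ->
  cadj u v.
Proof.
move=> TF TF' uT vT'; have [Q] := F_meetP TF TF'; rewrite uT vT'.
exact: s_cadj_mem.
Qed.

(** If [y] and [z] were not adjacent, [QB] and [QC] would be the only members through [a]. Both meet
    [QA], so maximality would put [QA] into the star at [a], although [a] is not in [s QA]. *)
Lemma F_star_a T a b c x y z QA QB QC T' : tie T a b c x y z QA QB QC ->
  T' \in F -> star a T' -> cadj y z.
Proof.
move=> t TF' aT'; apply/negPn/negP => yz; have N := sun_neqE (tie_sun t).
have : QA \in T'.
  apply: clique_mem (F_clique TF') _ => Q; rewrite aT' => aQ.
  have [->|->|[yz' _]] := tie_through_a t aQ; last by rewrite yz' in yz.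
  + by apply: (@s_mem_cadj c); rewrite ?(tie_A t) ?(tie_B t) !inE eqxx ?orbT.
  + by apply: (@s_mem_cadj b); rewrite ?(tie_A t) ?(tie_C t) !inE eqxx ?orbT.
by rewrite aT' (tie_A t) !inE !N.
Qed.

Lemma F_star_mem T a b c x y z QA QB QC T' v : tie T a b c x y z QA QB QC ->
  T \in F -> T' \in F -> star v T' ->
  [|| [|| v == a, v == b | v == c], v == x, v == y | v == z].
Proof.
move=> t TF TF' vT'; have [Q] := F_meetP TF TF'; rewrite vT' (tie_E t) !inE.
move=> /orP[/orP[]|]/eqP->; rewrite ?(tie_A t) ?(tie_B t) ?(tie_C t) !inE;
  by move=> /orP[/orP[]|]->; rewrite ?orbT.
Qed.

(** The second sun makes [x] and [z] adjacent and leaves [y] and [z] nonadjacent. Some member of the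
    family avoids [QA]; it could be a star at [a], [y] or [z], or a tie sharing a member with [T],
    and each case is refuted. *)
Lemma opposite_false T T' a b c x y z QA QB QC :
  tie T a b c x y z QA QB QC -> T \in F -> T' \in F ->
  opposite_b T' a b c x y z QA QC -> False.
Proof.
move=> t TF TF' [w [Q' [S' E' TE']]].
have S := tie_sun t; have N := sun_neqE S; have N' := sun_neqE S'.
have xz : cadj x z by rewrite cadj_sym (sun_ac S').
have yNw : y <> w.
  move=> yw; apply: (sun_xyz S); rewrite yw; split => //.
    by rewrite cadj_sym (sun_yc S').
  exact: (sun_ya S').
have yz : ~~ cadj y z.
  apply/negP; rewrite cadj_sym => /(sun_Na S'); rewrite !inE !N /= orbF.
  by move/eqP.
have [T0 TF0 QA0] := F_nc QA.
have [[v vT0]|[a0 [b0 [c0 [x0 [y0 [z0 [QA' [QB0 [QC0 t0]]]]]]]]]] :=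
    star_or_tie (F_clique TF0).
  have vA : v \notin s QA by rewrite -vT0.
  have := F_star_mem t TF TF0 vT0; move: (vA); rewrite (tie_A t) !inE !negb_or.
  move=> /andP[/andP[/negbTE-> /negbTE->] /negbTE->]; rewrite !orbF /=.
  move=> /or3P[]/eqP vE; subst v.
  + by rewrite (F_star_a t TF0 vT0) in yz.
  + have [Q] := F_meetP TF0 TF'; rewrite vT0 TE' !inE -orbA => yQ /or3P[]/eqP QE;
      move: yQ; rewrite QE ?(tie_A t) ?(tie_C t) ?E' !inE !N //=.
    by move/eqP.
  + case/negP: QA0; apply: clique_mem (F_clique TF0) _ => Q; rewrite vT0 => zQ.
    have [] := sun_cliques_through S' (s_clique Q) zQ => [E|E|E|[wa _]].
    * by apply: (@s_mem_cadj b); rewrite ?E ?(tie_A t) !inE eqxx ?orbT.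
    * by apply: (@s_mem_cadj b); rewrite ?E ?(tie_A t) !inE eqxx ?orbT.
    * by apply: (@s_mem_cadj x); rewrite ?E ?(tie_A t) !inE eqxx ?orbT.
    * move: wa; rewrite cadj_sym => /(sun_Na S); rewrite !inE !N' /= orbF.
      by move/eqP => wy; case: yNw.
have QAT : QA \in T by rewrite (tie_E t) !inE eqxx.
have TT0 : T <> T0 by move=> E; rewrite -E QAT in QA0.
have [Q QT QT0] := F_meetP TF TF0.
case: (tie_share TT0 QT QT0 t t0) => -[w0 [Q0 [S0 _ TE0]]].
- by move: yz; rewrite cadj_sym (sun_ac S0).
- by rewrite TE0 !inE eqxx in QA0.
- by rewrite TE0 !inE eqxx in QA0.
Qed.

Lemma F_tie_unique T T' a b c x y z QA QB QC :
  tie T a b c x y z QA QB QC -> T \in F -> T' \in F ->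
  T' = T \/ exists v, star v T'.
Proof.
move=> t TF TF'; have [vT'|[a0 [b0 [c0 [x0 [y0 [z0 [QA' [QB0 [QC0 t0]]]]]]]]]] :=
    star_or_tie (F_clique TF'); first by right.
left; apply: contrapT => TT'; have [Q QT QT'] := F_meetP TF TF'.
case: (tie_share (nesym TT') QT QT' t t0) => opp.
- exact: (opposite_false (tie_swap12 t)) opp.
- exact: (opposite_false t) opp.
- exact: (opposite_false (tie_swap23 t)) opp.
Qed.

(** If all members were stars, their centres would be pairwise adjacent and hence lie in one clique
    [P] of [H]. An element of the core dominating [P] meets everything in each star, so it would
    belong to all of them. *)
Lemma F_has_tie : exists2 T, T \in F &
  exists a b c x y z QA QB QC, tie T a b c x y z QA QB QC.
Proof.
apply: contrapT => nt.
have allstar T : T \in F -> exists v, star v T.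
  move=> TF; have [//|t] := star_or_tie (F_clique TF).
  by case: nt; exists T.
pose V := [set v | `[< exists2 T, T \in F & star v T >]]%SET.
have VP v : reflect (exists2 T, T \in F & star v T) (v \in V).
  by rewrite inE; exact: asboolP.
have cV : complete_sub V.
  apply/complete_subP; split.
    have /set0Pn[T TF] := F0; have [v vT] := allstar T TF.
    by apply/set0Pn; exists v; apply/VP; exists T.
  move=> u v /VP[T TF uT] /VP[T' TF' vT']; exact: F_star_cadj TF TF' uT vT'.
have [P VPs] := exists_clique_graph cV.
have [Q Qdom] := s_dom (csetP P).
have [T TF /negP[]] := F_nc Q; have [v vT] := allstar T TF.
apply: clique_mem (F_clique TF) _ => Q'; rewrite vT => vQ'; rewrite s_cadj.
apply: Qdom => //; apply/set0Pn; exists v; rewrite inE vQ' andbT.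
by apply: (fintype.subsetP VPs); apply/VP; exists T.
Qed.


(** This prepares a sun in [M] with centre [QA], [QB] and the clique [cxy]; [QZ] will be one of its
    outer vertices. It exists because otherwise maximality would put [QB] into [Tx]. As [x] has
    degree at most four, it has at most one neighbour [w] outside the sun's [b], [c], [y], and [QZ]
    is the only further member through [x]. *)
Lemma F_outer_triangle T a b c x y z QA QB QC Tx Ty : tie T a b c x y z QA QB QC ->
  Tx \in F -> Ty \in F -> star x Tx -> star y Ty ->
  exists w QZ, [/\ [/\ x \in s QZ, w \in s QZ &
      forall u, u \in s QZ -> u \in [:: x; b; w]],
    ~~ cadj QZ QB /\ ~~ cadj w y,
    forall Q, x \in s Q -> [\/ Q = QA, s Q = [set c; x; y]%SET | Q = QZ] &
    forall QW, s QW = [set c; x; y]%SET -> cadj QZ QC ->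
      (degree QZ <= 4)%N /\ (degree QC <= 4)%N].
Proof.
move=> t TxF TyF xTx yTy.
have S := tie_sun t; have N := sun_neqE S.
have xy := F_star_cadj TxF TyF xTx yTy.
have [dx dy] := sun_deg_xy S xy.
have xb := sun_xb S; have xc := sun_xc S.
have bx : cadj b x by rewrite cadj_sym.
have cx : cadj c x by rewrite cadj_sym.
have cb : cadj c b by rewrite cadj_sym (sun_bc S).
have bz : cadj b z by rewrite cadj_sym (sun_zb S).
have [w Nx] : exists w, forall u, cadj x u -> u \in [:: x; b; c; y; w].
  by apply: degree_le4_nbr; rewrite ?adj_cadj ?N //= !inE !N.
have [QZ QZTx QBZ] : exists2 Q, Q \in Tx & ~~ cadj QB Q.
  apply: contrapT => nQ; have : QB \in Tx.
    apply: clique_mem (F_clique TxF) _ => Q QTx; apply/negPn/negP => nc.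
    by apply: nQ; exists Q.
  by rewrite xTx (tie_B t) !inE !N.
have xZ : x \in s QZ by rewrite -xTx.
have BZ u : u \in s QB -> u \notin s QZ.
  by move=> uB; apply: contra QBZ => uZ; exact: s_mem_cadj uB uZ.
have aZ : a \notin s QZ by apply: BZ; rewrite (tie_B t) !inE eqxx.
have cZ : c \notin s QZ by apply: BZ; rewrite (tie_B t) !inE eqxx orbT.
have yZ : y \notin s QZ by apply: BZ; rewrite (tie_B t) !inE eqxx orbT.
have ZE u : u \in s QZ -> u \in [:: x; b; w].
  move=> uZ; have := Nx u (s_cadj_mem xZ uZ); rewrite !inE.
  move=> /orP[->//|/or4P[->|/eqP uE|/eqP uE|->]]; rewrite ?orbT //.
    by rewrite -uE uZ in cZ.
  by rewrite -uE uZ in yZ.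
have wbx : w \notin [:: x; b] /\ w \in s QZ.
  have nsub : ~ (forall u, u \in s QZ -> u \in [:: x; b]).
    move=> Zxb; case/negP: cZ; apply: clique_mem (s_clique QZ) _ => u /Zxb.
    by rewrite !inE => /orP[]/eqP->.
  split; apply/negP => wxb; apply: nsub => u uZ; have := ZE u uZ; rewrite !inE.
    by move=> /or3P[->|->|/eqP->] //; rewrite ?orbT //; move: wxb; rewrite !inE.
  move=> /or3P[->|->|/eqP uE] //; rewrite ?orbT //.
  by case: wxb; rewrite -uE.
have [wxb wZ] := wbx; move: wxb; rewrite !inE negb_or => /andP[/negbTE wx /negbTE wb].
have wneq u : u \notin s QZ -> (w == u) = false.
  by move=> uZ; apply/eqP => wu; rewrite -wu wZ in uZ.
have [wa wc wy] := And3 (wneq _ aZ) (wneq _ cZ) (wneq _ yZ).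
have bw : cadj b w -> w = z.
  by move=> /(sun_Nb S); rewrite !inE wa wb wc wx => /eqP.
have cw : ~~ cadj c w.
  by apply/negP => /(sun_Nc S); rewrite !inE wa wb wc wx wy.
have xw : cadj x w := s_cadj_mem xZ wZ.
have nwy : ~~ cadj w y.
  apply/negP => cwy; case: (boolP (b \in s QZ)) => bZ.
    have wz : w = z by apply: bw; exact: s_cadj_mem bZ wZ.
    by apply: (sun_xyz S); split => //; rewrite -wz // cadj_sym.
  case/negP: yZ; apply: clique_mem (s_clique QZ) _ => u uZ; have := ZE u uZ.
  rewrite !inE => /or3P[]/eqP uE; subst u; [| |by rewrite cadj_sym].
    by rewrite cadj_sym.
  by rewrite uZ in bZ.
have xQ Q : x \in s Q -> [\/ Q = QA, s Q = [set c; x; y]%SET | Q = QZ].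
  move=> xQ; have QE u : u \in s Q -> u \in [:: x; b; c; y; w].
    by move=> uQ; apply: Nx; exact: s_cadj_mem xQ uQ.
  case: (boolP (w \in s Q)) => wQ.
    apply: Or33; apply: s_inj; apply: clique_max (s_clique Q) _ _; last first.
      by have /maxsetP[] := s_clique QZ.
    apply/fintype.subsetP => u uQ; have := QE u uQ; rewrite !inE.
    move=> /orP[/eqP->//|/or4P[]/eqP uE]; subst u => //.
    + apply: clique_mem (s_clique QZ) _ => u /ZE; rewrite !inE.
      move=> /or3P[]/eqP->; rewrite ?cadjxx //; exact: s_cadj_mem uQ wQ.
    + by rewrite (s_cadj_mem uQ wQ) in cw.
    + by rewrite (s_cadj_mem wQ uQ) in nwy.
  case: (boolP (b \in s Q)) => bQ.
    apply: Or31; apply: s_inj; apply: clique_max (s_clique Q) _ _; last first.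
      by have /maxsetP[] := s_clique QA.
    apply/fintype.subsetP => u uQ; rewrite (tie_A t); have := QE u uQ; rewrite !inE.
    move=> /orP[->|/or4P[->|->|/eqP uE|/eqP uE]]; rewrite ?orbT //; subst u.
      by have := sun_yb S; rewrite (s_cadj_mem uQ bQ).
    by rewrite uQ in wQ.
  apply: Or32; apply: clique_max (s_clique Q) _ (complete3 cx xy _); last first.
    by rewrite cadj_sym (sun_yc S).
  apply/fintype.subsetP => u uQ; have := QE u uQ; rewrite !inE.
  move=> /orP[->|/or4P[/eqP uE|->|->|/eqP uE]]; rewrite ?orbT //; subst u.
    by rewrite uQ in bQ.
  by rewrite uQ in wQ.
exists w, QZ; split => //; first by rewrite cadj_sym.
move=> QW EW /s_cadjP[v vZ vC].
have wz : w = z.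
  move: vC; rewrite (tie_C t) !inE => /orP[/orP[]|]/eqP vE; subst v.
  + by rewrite vZ in aZ.
  + by apply: bw; exact: s_cadj_mem vZ wZ.
  + by have := ZE z vZ; rewrite !inE !N /= => /eqP.
subst w => {v vZ vC}.
have yz : ~~ cadj y z by apply/negP => yz; apply: (sun_xyz S).
have [_ dz] := sun_deg_xz S xw.
have bZ : b \in s QZ.
  apply: clique_mem (s_clique QZ) _ => u /ZE; rewrite !inE.
  by move=> /or3P[]/eqP->; rewrite ?cadjxx.
have EZ : s QZ = [set b; x; z]%SET.
  apply: clique_max (s_clique QZ) _ (complete3 bx xw bz).
  apply/fintype.subsetP => u /ZE; rewrite !inE.
  by move=> /or3P[]->; rewrite ?orbT.
(* The members through [z] besides [QC] and [QZ]. Apart from [a], [b], [x] only one neighbour [w2]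
   of [z] is left, so there is at most one such member, the possible fourth neighbour of both [QZ]
   and [QC]. *)
pose E Q := [/\ z \in s Q, Q != QC & Q != QZ].
have [w2 Nz] : exists w2, forall u, cadj z u -> u \in [:: z; a; b; x; w2].
  apply: degree_le4_nbr; rewrite ?adj_cadj ?N //= ?inE ?N ?(sun_za S) ?(sun_zb S) //.
  by rewrite cadj_sym.
have EE Q : E Q -> w2 \in s Q /\ (forall u, u \in s Q -> u \in [:: z; w2]).
  move=> [zQ QNC QNZ].
  have aQ : a \notin s Q.
    apply/negP => /(tie_through_a t)[QE|QE|[yz' _]].
    + by move: zQ; rewrite QE (tie_B t) !inE !N.
    + by rewrite QE eqxx in QNC.
    + by rewrite yz' in yz.
  have bQ : b \notin s Q.
    apply/negP => /(tie_through_b t)[QE|QE|[_ QE]].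
    + by move: zQ; rewrite QE (tie_A t) !inE !N.
    + by rewrite QE eqxx in QNC.
    + by case/eqP: QNZ; apply: s_inj; rewrite QE EZ.
  have xNQ : x \notin s Q.
    apply/negP => /xQ[QE|QE|QE].
    + by move: zQ; rewrite QE (tie_A t) !inE !N.
    + by move: zQ; rewrite QE !inE !N.
    + by rewrite QE eqxx in QNZ.
  have sub u : u \in s Q -> u \in [:: z; w2].
    move=> uQ; have := Nz u (s_cadj_mem zQ uQ); rewrite !inE.
    move=> /orP[->//|/or4P[/eqP uE|/eqP uE|/eqP uE|->]]; rewrite ?orbT //.
    + by rewrite -uE uQ in aQ.
    + by rewrite -uE uQ in bQ.
    + by rewrite -uE uQ in xNQ.
  split => //; apply/negPn/negP => w2Q; case/negP: aQ.
  apply: clique_mem (s_clique Q) _ => u uQ; have := sub u uQ; rewrite !inE.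
  move=> /orP[]/eqP uE; subst u; first by rewrite cadj_sym (sun_za S).
  by rewrite uQ in w2Q.
have E1 Q Q' : E Q -> E Q' -> Q = Q'.
  move=> EQ EQ'; have [_ sub] := EE Q EQ; have [w2Q' _] := EE Q' EQ'.
  apply: s_inj; apply: clique_max (s_clique Q) _ _; last first.
    by have /maxsetP[] := s_clique Q'.
  apply/fintype.subsetP => u /sub; rewrite !inE => /orP[]/eqP-> //.
  by case: EQ'.
have zQ Q : z \in s Q -> [\/ Q = QC, Q = QZ | E Q].
  move=> zQ; have [->|QNC] := eqVneq Q QC; first exact: Or31.
  by have [->|QNZ] := eqVneq Q QZ; [exact: Or32|exact: Or33].
have adjP Q P : adj Q P -> Q <> P /\ exists2 v, v \in s Q & v \in s P.
  by rewrite adj_cadj => /andP[/eqP QP /s_cadjP].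
split.
- apply: (@degree_le4 _ QZ QA QW QC E) => // Q /adjP[QQ [v]].
  rewrite EZ !inE => /orP[/orP[]|]/eqP-> vQ.
  + have [->|->|[_ E0]] := tie_through_b t vQ; rewrite ?eqxx ?orbT; try by left.
    by case: QQ; apply: s_inj; rewrite E0 EZ.
  + have [->|E0|E0] := xQ Q vQ; rewrite ?eqxx ?orbT; try by left.
      by left; rewrite (s_inj (etrans E0 (esym EW))) eqxx orbT.
    by case: QQ.
  + have [->|E0|E0] := zQ Q vQ; rewrite ?eqxx ?orbT; try by [left|right].
    by case: QQ.
- apply: (@degree_le4 _ QC QA QB QZ E) => // Q /adjP[QQ [v]].
  rewrite (tie_C t) !inE => /orP[/orP[]|]/eqP-> vQ.
  + have [->|E0|[yz' _]] := tie_through_a t vQ; rewrite ?eqxx ?orbT; try by left.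
      by case: QQ.
    by rewrite yz' in yz.
  + have [->|E0|[_ E0]] := tie_through_b t vQ; rewrite ?eqxx ?orbT; try by left.
      by case: QQ.
    by left; rewrite (s_inj (etrans E0 (esym EZ))) eqxx !orbT.
  + have [E0|->|E0] := zQ Q vQ; rewrite ?eqxx ?orbT; try by [left|right].
    by case: QQ.
Qed.


Lemma F_star_mem_xy T a b c x y z QA QB QC Tx Ty T' v :
  tie T a b c x y z QA QB QC -> T \in F -> Tx \in F -> Ty \in F -> T' \in F ->
  star x Tx -> star y Ty -> star v T' -> [|| v == c, v == x | v == y].
Proof.
move=> t TF TxF TyF TF' xTx yTy vT'; have S := tie_sun t.
have := F_star_mem t TF TF' vT'.
have xv := F_star_cadj TxF TF' xTx vT'; have yv := F_star_cadj TyF TF' yTy vT'.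
have xy := F_star_cadj TxF TyF xTx yTy.
move=> /or4P[/or3P[/eqP vE|/eqP vE|->]|->|->|/eqP vE]; rewrite ?orbT //; subst v.
- by have := sun_xa S; rewrite xv.
- by have := sun_yb S; rewrite yv.
- by case: (sun_xyz S).
Qed.

(** With [QW] the clique [cxy], the new centre is [QA], [QB], [QW], which is the star at [c]. The
    outer triangles are [T] itself with outer vertex [QC], the star at [x] with [QZ], and the star
    at [y] with [QZ']. *)
Lemma F_sun_xy T a b c x y z QA QB QC Tx Ty : tie T a b c x y z QA QB QC ->
  T \in F -> Tx \in F -> Ty \in F -> star x Tx -> star y Ty ->
  exists a b c x y z : M, [/\ good_sun a b c x y z,
    [/\ [set b; c; x]%SET \in F, [set a; c; y]%SET \in F &
        [set a; b; z]%SET \in F] &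
    forall T', T' \in F -> sun_set a b c x y z T'].
Proof.
move=> t TF TxF TyF xTx yTy.
have S := tie_sun t; have N := sun_neqE S.
have xy := F_star_cadj TxF TyF xTx yTy.
have [w [QZ [[xZ wZ ZE] [ZB wy] xQ dZ]]] := F_outer_triangle t TxF TyF xTx yTy.
have [w' [QZ' [[yZ' wZ' ZE'] [ZA' wx'] yQ dZ']]] :=
  F_outer_triangle (tie_swap12 t) TyF TxF yTy xTx.
have aB : a \in s QB by rewrite (tie_B t) !inE eqxx.
have cB : c \in s QB by rewrite (tie_B t) !inE eqxx orbT.
have yB : y \in s QB by rewrite (tie_B t) !inE eqxx orbT.
have bA : b \in s QA by rewrite (tie_A t) !inE eqxx.
have cA : c \in s QA by rewrite (tie_A t) !inE eqxx orbT.
have xA : x \in s QA by rewrite (tie_A t) !inE eqxx orbT.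
have aC : a \in s QC by rewrite (tie_C t) !inE eqxx.
have bC : b \in s QC by rewrite (tie_C t) !inE eqxx orbT.
have disj Q P u : ~~ cadj Q P -> u \in s P -> u \notin s Q.
  by move=> QP uP; apply: contra QP => uQ; exact: s_mem_cadj uQ uP.
have [QW EW] : exists QW, s QW = [set c; x; y]%SET.
  have [Q] := F_meetP TxF TyF; rewrite xTx yTy => xinQ yinQ; exists Q.
  have [QE|//|QE] := xQ Q xinQ.
    by move: yinQ; rewrite QE (tie_A t) !inE !N.
  by have := disj _ _ y ZB yB; rewrite -QE yinQ.
have EW' : s QW = [set c; y; x]%SET by rewrite EW set3CA.
have cW : c \in s QW by rewrite EW !inE eqxx.
have xW : x \in s QW by rewrite EW !inE eqxx orbT.
have yW : y \in s QW by rewrite EW !inE eqxx orbT.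
have xQ' Q : x \in s Q -> [\/ Q = QA, Q = QW | Q = QZ].
  by move=> /xQ[|QE|]; [exact: Or31|apply: Or32; apply: s_inj; rewrite QE|exact: Or33].
have yQ' Q : y \in s Q -> [\/ Q = QB, Q = QW | Q = QZ'].
  by move=> /yQ[|QE|]; [exact: Or31|apply: Or32; apply: s_inj; rewrite QE|exact: Or33].
have cQ Q : c \in s Q -> [\/ Q = QA, Q = QB | Q = QW].
  move=> /(tie_through_c t)[|| [_ QE]]; [exact: Or31|exact: Or32|apply: Or33].
  by apply: s_inj; rewrite QE.
have aQ Q : a \in s Q -> [\/ Q = QB, Q = QC | y \in s Q].
  move=> /(tie_through_a t)[|| [_ QE]]; [exact: Or31|exact: Or32|apply: Or33].
  by rewrite QE !inE eqxx orbT.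
have bQ Q : b \in s Q -> [\/ Q = QA, Q = QC | x \in s Q].
  move=> /(tie_through_b t)[|| [_ QE]]; [exact: Or31|exact: Or32|apply: Or33].
  by rewrite QE !inE eqxx orbT.
(* This nonadjacency gives [sun_xyz] for the new sun and makes one of its three degree conditions
   vacuous; the other two come from [F_outer_triangle]. *)
have ZZ' : ~~ cadj QZ' QZ.
  apply/negP => /s_cadjP[u uZ' uZ]; have := ZE u uZ; rewrite !inE.
  move=> /or3P[]/eqP uE; subst u.
  - by have := disj _ _ x ZA' xA; rewrite uZ'.
  - by have := disj _ _ b ZA' bA; rewrite uZ'.
  - by rewrite (s_cadj_mem uZ' yZ') in wy.
have GS : good_sun QA QB QW QZ' QZ QC.
  split.
  - exact: s_mem_cadj cA cB.
  - exact: s_mem_cadj cB cW.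
  - exact: s_mem_cadj cA cW.
  - exact: s_mem_cadj yZ' yB.
  - exact: s_mem_cadj yZ' yW.
  - exact: ZA'.
  - exact: s_mem_cadj xZ xA.
  - exact: s_mem_cadj xZ xW.
  - exact: ZB.
  - exact: s_mem_cadj bC bA.
  - exact: s_mem_cadj aC aB.
  - apply/negP => /s_cadjP[u]; rewrite (tie_C t) EW !inE.
    by move=> /orP[/orP[]|]/eqP->; rewrite !N.
  - move=> Q /s_cadjP[u]; rewrite (tie_A t) !inE => /orP[/orP[]|]/eqP-> uQ.
    + have [->|->|] := bQ Q uQ; rewrite ?eqxx ?orbT //.
      by move=> /xQ'[]->; rewrite ?eqxx ?orbT.
    + by have [] := cQ Q uQ => ->; rewrite ?eqxx ?orbT.
    + by have [] := xQ' Q uQ => ->; rewrite ?eqxx ?orbT.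
  - move=> Q /s_cadjP[u]; rewrite (tie_B t) !inE => /orP[/orP[]|]/eqP-> uQ.
    + have [->|->|] := aQ Q uQ; rewrite ?eqxx ?orbT //.
      by move=> /yQ'[]->; rewrite ?eqxx ?orbT.
    + by have [] := cQ Q uQ => ->; rewrite ?eqxx ?orbT.
    + by have [] := yQ' Q uQ => ->; rewrite ?eqxx ?orbT.
  - move=> Q /s_cadjP[u]; rewrite EW !inE => /orP[/orP[]|]/eqP-> uQ.
    + by have [] := cQ Q uQ => ->; rewrite ?eqxx ?orbT.
    + by have [] := xQ' Q uQ => ->; rewrite ?eqxx ?orbT.
    + by have [] := yQ' Q uQ => ->; rewrite ?eqxx ?orbT.
  - by move=> [Z'Z _ _]; rewrite Z'Z in ZZ'.
  - by move=> Z'Z; rewrite Z'Z in ZZ'.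
  - exact: dZ EW.
  - exact: dZ' EW'.
have TxE : Tx = [set QA; QW; QZ]%SET.
  apply/setP => Q; rewrite xTx !inE -orbA; apply/idP/or3P => [/xQ'[]->|[]/eqP-> //];
    by [exact: Or31|exact: Or32|exact: Or33].
have TyE : Ty = [set QB; QW; QZ']%SET.
  apply/setP => Q; rewrite yTy !inE -orbA; apply/idP/or3P => [/yQ'[]->|[]/eqP-> //];
    by [exact: Or31|exact: Or32|exact: Or33].
exists QA, QB, QW, QZ', QZ, QC; split => //.
  by rewrite -TyE -TxE -(tie_E t).
move=> T' TF'; have [->|[v vT']] := F_tie_unique t TF TF'.
  by apply: Or44; exact: tie_E t.
have := F_star_mem_xy t TF TxF TyF TF' xTx yTy vT'.
have same u T1 T2 : star u T1 -> star u T2 -> T1 = T2.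
  by move=> u1 u2; apply/setP => Q; rewrite u1 u2.
move=> /or3P[]/eqP vE; subst v.
- apply: Or41; apply/setP => Q; rewrite vT' !inE -orbA.
  apply/idP/or3P => [/cQ[]->|[]/eqP-> //];
    by [exact: Or31|exact: Or32|exact: Or33].
- by apply: Or43; rewrite -TxE; exact: same vT' xTx.
- by apply: Or42; rewrite -TyE; exact: same vT' yTy.
Qed.

(** Each of [QA], [QB], [QC] is avoided by some star of the family. Star centres are pairwise
    adjacent, which rules out [a] with [x], [b] with [y] and [c] with [z]; and [a], [b], [c]
    together would make [x], [y], [z] pairwise adjacent by [F_star_a]. So two of [x], [y], [z] are
    star centres. *)
Lemma F_sun : exists a b c x y z : M, [/\ good_sun a b c x y z,
    [/\ [set b; c; x]%SET \in F, [set a; c; y]%SET \in F &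
        [set a; b; z]%SET \in F] &
    forall T', T' \in F -> sun_set a b c x y z T'].
Proof.
have [T TF [a [b [c [x [y [z [QA [QB [QC t]]]]]]]]]] := F_has_tie.
have S := tie_sun t; have N := sun_neqE S.
pose inF v := exists2 T', T' \in F & star v T'.
have ncadj u v : ~~ cadj u v -> inF u -> inF v -> False.
  move=> /negP uv [T1 TF1 uT1] [T2 TF2 vT2]; exact: uv (F_star_cadj TF1 TF2 uT1 vT2).
have nax := ncadj _ _ (sun_xa S); have nby := ncadj _ _ (sun_yb S).
have ncz := ncadj _ _ (sun_zc S).
have nabc : inF a -> inF b -> inF c -> False.
  move=> [Ta TaF aTa] [Tb TbF bTb] [Tc TcF cTc]; apply: (sun_xyz S); split.
  - exact: F_star_a (tie_swap12 (tie_swap23 t)) TcF cTc.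
  - exact: F_star_a t TaF aTa.
  - exact: F_star_a (tie_swap12 t) TbF bTb.
have miss Q : Q \in T -> exists v, [/\ inF v, v \notin s Q &
    [|| [|| v == a, v == b | v == c], v == x, v == y | v == z]].
  move=> QT; have [T' TF' QT'] := F_nc Q.
  have [TE|[v vT']] := F_tie_unique t TF TF'; first by rewrite TE QT in QT'.
  exists v; split; [by exists T'|by rewrite -vT'|exact: F_star_mem t TF TF' vT'].
have missA : [\/ inF a, inF y | inF z].
  have [|v []] := miss QA; first by rewrite (tie_E t) !inE eqxx.
  rewrite (tie_A t) !inE => vF + vE; case/or4P: vE vF => [/or3P[]|||] /eqP-> vF;
    rewrite ?eqxx ?orbT // => _; by [exact: Or31|exact: Or32|exact: Or33].
have missB : [\/ inF b, inF x | inF z].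
  have [|v []] := miss QB; first by rewrite (tie_E t) !inE eqxx orbT.
  rewrite (tie_B t) !inE => vF + vE; case/or4P: vE vF => [/or3P[]|||] /eqP-> vF;
    rewrite ?eqxx ?orbT // => _; by [exact: Or31|exact: Or32|exact: Or33].
have missC : [\/ inF c, inF x | inF y].
  have [|v []] := miss QC; first by rewrite (tie_E t) !inE eqxx orbT.
  rewrite (tie_C t) !inE => vF + vE; case/or4P: vE vF => [/or3P[]|||] /eqP-> vF;
    rewrite ?eqxx ?orbT // => _; by [exact: Or31|exact: Or32|exact: Or33].
have : [\/ inF x /\ inF y, inF y /\ inF z | inF x /\ inF z].
  case: missA => h1; case: missB => h2; case: missC => h3;
    by [case: nabc|case: nax|case: nby|case: ncz|
        apply: Or31|apply: Or32|apply: Or33].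
case=> -[[T1 TF1 T1E] [T2 TF2 T2E]].
- exact: F_sun_xy t TF TF1 TF2 T1E T2E.
- exact: F_sun_xy (tie_rot t) TF TF1 TF2 T1E T2E.
- exact: F_sun_xy (tie_swap23 t) TF TF1 TF2 T1E T2E.
Qed.

End family.

Lemma sun_local_domination_core : sun_local M.
Proof. by move=> F F0 cF F2 nc; exact: F_sun. Qed.

End sun_clique_graph.

(** * Induced subgraphs and minimal dominating sets *)

Section induced.
Variables (G : sgraph) (A : {set G}).

Definition induced_adj : rel {v : G | v \in A} := [rel u v | adj (sval u) (sval v)].

Lemma induced_adj_sym : symmetric induced_adj.
Proof. by move=> u v; exact: adj_sym. Qed.

Lemma induced_adj_irrefl : irreflexive induced_adj.
Proof. by move=> u; exact: adj_irrefl. Qed.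

Definition induced_graph : sgraph := SGraph induced_adj_sym induced_adj_irrefl.

Lemma induced_cadj (u v : induced_graph) : cadj u v = cadj (sval u) (sval v).
Proof. by []. Qed.

End induced.

(** In a dominating set that is minimal for inclusion no member dominates another, since a dominated
    one could be dropped; this is the minimality that the core requires. *)
Lemma sun_local_retract (H : sgraph) : sun_local H ->
  exists2 M, sun_local M & dominated_retract (clique_graph H) M.
Proof.
move=> locH; pose K := clique_graph H.
pose dom (Q P : K) := [forall Q', cadj Q Q' ==> cadj P Q'].
have domP Q P : reflect (forall Q', cadj Q Q' -> cadj P Q') (dom Q P).
  by apply: (iffP forallP) => h Q'; [exact/implyP/h|apply/implyP; exact: h].
pose core (A : {set K}) := [forall Q, exists P in A, dom Q P].
have core_T : core finset.setT.
  by apply/forallP => Q; apply/exists_inP; exists Q; rewrite ?inE //; exact/domP.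
have [A /minsetP[/forallP coreA minA] _] := minset_exists core_T.
pose M := induced_graph A; exists M.
  pose s (Q : M) := cset (sval Q).
  apply: (@sun_local_domination_core H M s).
  - exact: locH.
  - by move=> Q P /cset_inj/val_inj.
  - by move=> Q; exact: csetP.
  - by move=> Q P; rewrite induced_cadj cadj_clique_graph.
  - move=> P0 /exists_cset[P <-]; have /exists_inP[Q QA /domP PQ] := coreA P.
    exists (exist _ Q QA) => _ /exists_cset[P' <-].
    by rewrite -!cadj_clique_graph; exact: PQ.
  - move=> Q Q' QQ'; apply/eqP/negPn/negP => QNQ'.
    have dQQ' : dom (sval Q) (sval Q').
      by apply/domP => P; rewrite !cadj_clique_graph; apply: QQ'; exact: csetP.
    have := minA (A :\ sval Q)%SET _ (finset.subsetDl _ _).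
    suff coreA' : core (A :\ sval Q)%SET.
      by move=> /(_ coreA')/setP/(_ (sval Q)); rewrite !inE eqxx (svalP Q).
    apply/forallP => P; apply/exists_inP.
    have /exists_inP[P' P'A dPP'] := coreA P.
    (* Whatever [Q] dominated is taken over by [Q']. *)
    have [P'Q|P'Q] := eqVneq P' (sval Q); last by exists P' => //; rewrite !inE P'Q.
    exists (sval Q'); first by rewrite !inE (svalP Q') andbT eq_sym.
    by apply/domP => P0 /(domP _ _ dPP'); rewrite P'Q; exact: (domP _ _ dQQ').
have /choice[r rP] (Q : K) : exists P : M, dom Q (sval P).
  by have /exists_inP[P PA dQP] := coreA Q; exists (exist _ P PA).
exists sval, r; split => // Q Q'; exact/domP.
Qed.

Theorem sun_local_iter (R : realType) (n : nat) (H : sgraph) :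
  sun_local H -> homotopic_graphs R (iter_clique_graph n H) H.
Proof.
elim: n H => [|n IH] H locH; first exact: homotopy_equivalent_refl.
rewrite /iter_clique_graph iterSr.
have [M locM KM] := sun_local_retract locH.
apply: homotopy_equivalent_trans (sun_local_clique_graph R locH).
apply: homotopy_equivalent_trans
  (homotopy_equivalent_sym (dominated_retract_homotopic R KM)).
apply: homotopy_equivalent_trans (IH _ locM).
exact: dominated_retract_homotopic (dominated_retract_iter n KM).
Qed.

(** * Low degree graphs *)

(** Opposite vertices are only required to be distinct: under the degree bound they are nonadjacent
    anyway, and the notion is then monotone in the edges, as edge deletion needs. *)
Definition octahedron (G : sgraph) (a b c x y z : G) : Prop :=
  [/\ [/\ a != x, b != y & c != z],
      [/\ adj a b, adj a c, adj a y & adj a z],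
      [/\ adj x b, adj x c, adj x y & adj x z] &
      [/\ adj b c, adj b z, adj y c & adj y z]].

Lemma degree4_nbr (G : sgraph) (v : G) (s : seq G) :
  (degree v <= size s)%N -> uniq s -> {in s, forall u, adj v u} ->
  forall u, adj v u -> u \in s.
Proof.
move=> dv us sv u vu; apply/negPn/negP => uNs.
suff : (size (u :: s) <= degree v)%N by rewrite leqNgt ltnS dv.
have /card_uniqP <- : uniq (u :: s) by rewrite /= uNs.
apply: subset_leq_card; apply/fintype.subsetP => w.
by rewrite !inE => /predU1P[->//|/sv].
Qed.

Lemma degree_max (G : sgraph) (v : G) : (degree v <= max_degree G)%N.
Proof. by apply: leq_bigmax. Qed.

(** Each of the six vertices already has four neighbours among them, so no edge leaves the
    octahedron, and by connectedness it is all of [G]. *)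
Lemma octahedron_iso (G : sgraph) (a b c x y z : G) :
  graph_connected G -> (forall v : G, (degree v <= 4)%N) ->
  octahedron a b c x y z -> graph_iso G (octahedral_graph 3).
Proof.
move=> [_ conG] deg4 [[ax by' cz] [ab ac ay az] [xb xc xy xz] [bc bz yc yz]].
pose g (p : octahedral_graph 3) : G :=
  let p : 'I_3 * bool := p in
  if p.2 then nth x [:: x; y; z] p.1 else nth a [:: a; b; c] p.1.
have adjN (u v : G) : adj u v -> (u == v) = false.
  by move=> uv; apply/eqP => E; rewrite E adj_irrefl in uv.
have adjC (u v : G) : adj u v -> adj v u by rewrite adj_sym.
have N (u v : G) : adj u v -> ((u == v) = false) * ((v == u) = false).
  by move=> uv; split; [|rewrite eq_sym]; exact: adjN.
have nbr (u v1 v2 v3 v4 : G) : adj u v1 -> adj u v2 -> adj u v3 -> adj u v4 ->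
    uniq [:: v1; v2; v3; v4] -> forall w, adj u w -> w \in [:: v1; v2; v3; v4].
  move=> u1 u2 u3 u4 U w; apply: (@degree4_nbr _ u); [exact: deg4|exact: U|].
  by move=> v; rewrite !inE => /or4P[]/eqP->.
have Na : forall w, adj a w -> w \in [:: b; c; y; z].
  by apply: nbr => //=; rewrite !inE !(N _ _ bc) (negbTE by') (N _ _ bz) !(N _ _ yc) (negbTE cz) (N _ _ yz).
have Nx : forall w, adj x w -> w \in [:: b; c; y; z].
  by apply: nbr => //=; rewrite !inE !(N _ _ bc) (negbTE by') (N _ _ bz) !(N _ _ yc) (negbTE cz) (N _ _ yz).
have Nb : forall w, adj b w -> w \in [:: a; x; c; z].
  by apply: nbr => //=; rewrite 1?adj_sym // !inE (negbTE ax) (N _ _ ac) (N _ _ az) (N _ _ xc) (N _ _ xz) (negbTE cz).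
have Ny : forall w, adj y w -> w \in [:: a; x; c; z].
  by apply: nbr => //=; rewrite 1?adj_sym // !inE (negbTE ax) (N _ _ ac) (N _ _ az) (N _ _ xc) (N _ _ xz) (negbTE cz).
have Nc : forall w, adj c w -> w \in [:: a; x; b; y].
  by apply: nbr => //=; rewrite 1?adj_sym // !inE (negbTE ax) (N _ _ ab) (N _ _ ay) (N _ _ xb) (N _ _ xy) (negbTE by').
have Nz : forall w, adj z w -> w \in [:: a; x; b; y].
  by apply: nbr => //=; rewrite 1?adj_sym // !inE (negbTE ax) (N _ _ ab) (N _ _ ay) (N _ _ xb) (N _ _ xy) (negbTE by').
have [nax nby ncz] : [/\ adj a x = false, adj b y = false & adj c z = false].
  split; apply/negbTE/negP; [move=> /Na|move=> /Nb|move=> /Nc]; rewrite !inE.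
  + by rewrite !(N _ _ xb) !(N _ _ xc) !(N _ _ xy) !(N _ _ xz).
  + by rewrite !(N _ _ ay) !(N _ _ xy) !(N _ _ yc) !(N _ _ yz).
  + by rewrite !(N _ _ az) !(N _ _ xz) !(N _ _ bz) !(N _ _ yz).
have gadj p q : adj (g p) (g q) = adj p q.
  case: p => [[[|[|[|//]]] pi] []]; case: q => [[[|[|[|//]]] qi] []];
  by rewrite /g /= ?adj_irrefl ?nax ?nby ?ncz ?[adj x a]adj_sym ?[adj y b]adj_sym
    ?[adj z c]adj_sym ?nax ?nby ?ncz ?ab ?ac ?ay ?az ?xb ?xc ?xy ?xz ?bc ?bz ?yc ?yz
    ?[adj b a]adj_sym ?[adj c a]adj_sym ?[adj y a]adj_sym ?[adj z a]adj_sym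
    ?[adj b x]adj_sym ?[adj c x]adj_sym ?[adj y x]adj_sym ?[adj z x]adj_sym
    ?[adj c b]adj_sym ?[adj z b]adj_sym ?[adj c y]adj_sym ?[adj z y]adj_sym
    ?ab ?ac ?ay ?az ?xb ?xc ?xy ?xz ?bc ?bz ?yc ?yz
    /compl_adj /edges_adj /= ?eqxx.
have ginj : injective g.
  move=> p q gpq; have := gadj p q; rewrite gpq adj_irrefl => /esym/negbT.
  rewrite /adj /= /compl_adj /= /edges_adj /= negb_and !negbK.
  move=> /orP[/eqP//|/andP[/eqP p1 p2]]; exfalso; move: p1 p2 gpq.
  case: p => [[[|[|[|//]]] pi] []]; case: q => [[[|[|[|//]]] qi] []] //= _ _;
  rewrite /g /= => /eqP; rewrite ?(negbTE ax) ?(negbTE by') ?(negbTE cz) //;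
  by rewrite eq_sym ?(negbTE ax) ?(negbTE by') ?(negbTE cz).
have gsurj v : exists p, g p = v.
  pose O := [:: a; b; c; x; y; z].
  have Ocl u w : adj u w -> u \in O -> w \in O.
    move=> uw uO; have {uO} : [|| u == a, u == b, u == c | [|| u == x, u == y | u == z]].
      by move: uO; rewrite !inE.
    have sub (s : seq G) : w \in s -> all (mem O) s -> w \in O.
      by move=> ws /allP; apply.
    have mO : [/\ a \in O, b \in O & c \in O] /\ [/\ x \in O, y \in O & z \in O].
      by rewrite !inE !eqxx !orbT.
    have [[aO bO cO] [xO yO zO]] := mO.
    move=> /or4P[| | |/or3P[]] /eqP uE; subst u.
    - by apply: sub (Na w uw) _; rewrite /= bO cO yO zO.
    - by apply: sub (Nb w uw) _; rewrite /= aO xO cO zO.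
    - by apply: sub (Nc w uw) _; rewrite /= aO xO bO yO.
    - by apply: sub (Nx w uw) _; rewrite /= bO cO yO zO.
    - by apply: sub (Ny w uw) _; rewrite /= aO xO cO zO.
    - by apply: sub (Nz w uw) _; rewrite /= aO xO bO yO.
  have vO : v \in O.
    have /connectP[p pp ->] := conG a v.
    have aO : a \in O by rewrite !inE eqxx.
    elim: p (a) pp aO => //= u p IH w /andP[wu up] wO.
    by apply: IH up _; exact: Ocl wu wO.
  move: vO; rewrite !inE => /orP[|/orP[|/or4P[]]] /eqP->.
  - by exists (Ordinal (isT : (0 < 3)%N), false).
  - by exists (Ordinal (isT : (1 < 3)%N), false).
  - by exists (Ordinal (isT : (2 < 3)%N), false).
  - by exists (Ordinal (isT : (0 < 3)%N), true).
  - by exists (Ordinal (isT : (1 < 3)%N), true).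
  - by exists (Ordinal (isT : (2 < 3)%N), true).
have /choice[f fP] := gsurj.
exists f; last by move=> u v; rewrite -gadj !fP.
by exists g => [v|p]; rewrite ?fP //; apply: ginj; rewrite fP.
Qed.

(** In a subfamily that is minimal without common vertex, each member [Q] has an apex lying in all
    other members but not in [Q]. The apices [a], [b], [c] of three members form the centre; as [a]
    is outside the clique [Q1], some [x] in [Q1] is not adjacent to [a], and similarly for [y] and
    [z]. Now [a], [b], [c] have four neighbours each, so nothing else is near them. *)
Lemma low_degree_sun_local (G : sgraph) : (forall v : G, (degree v <= 4)%N) ->
  (forall a b c x y z : G, ~ octahedron a b c x y z) -> sun_local G.
Proof.
move=> deg4 noct F F0 F_clique F_meet F_nc.
pose nh (A : {set {set G}}) := [forall v, exists Q in A, v \notin Q].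
have nhP (A : {set {set G}}) : reflect (forall v, exists2 Q : {set G}, Q \in A & v \notin Q) (nh A).
  by apply: (iffP forallP) => h v; [exact/exists_inP|apply/exists_inP; exact: h].
have nhF : nh F by apply/nhP.
have [A /minsetP[/nhP nhA minA] AF] := minset_exists nhF.
have Acl (Q : {set G}) : Q \in A -> clique Q by move=> /(fintype.subsetP AF)/F_clique.
have apex (Q : {set G}) : Q \in A -> exists2 v, v \notin Q & forall P, P \in A -> P != Q -> v \in P.
  move=> QA; have : ~~ nh (A :\ Q)%SET.
    apply/negP => /minA/(_ (finset.subsetDl _ _))/setP/(_ Q).
    by rewrite !inE eqxx QA.
  move=> /nhP nhAQ; have [v vP] : exists v, forall P, P \in (A :\ Q)%SET -> v \in P.
    apply: contrapT => nv; apply: nhAQ => v; apply: contrapT => nQ; apply: nv.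
    exists v => P PA; apply/negPn/negP => vP; apply: nQ; by exists P.
  have vP' P : P \in A -> P != Q -> v \in P.
    by move=> PA PQ; apply: vP; rewrite !inE PQ.
  exists v => //; apply/negP => vQ; have [P PA /negP[]] := nhA v.
  by have [->//|] := eqVneq P Q; exact: vP'.
have /set0Pn[Q0 Q0F] := F0.
have /cliqueP[/set0Pn[v0 _] _ _] := F_clique _ Q0F.
have [Q1 Q1A _] := nhA v0; have cQ1 := Acl _ Q1A.
have /cliqueP[/set0Pn[v1 v1Q1] _ _] := cQ1.
have [Q2 Q2A v1Q2] := nhA v1; have cQ2 := Acl _ Q2A.
have Q21 : Q2 != Q1 by apply: contraNneq v1Q2 => ->.
have Q12 : Q1 != Q2 by rewrite eq_sym.
have /set0Pn[v2] := F_meet _ _ (fintype.subsetP AF _ Q1A) (fintype.subsetP AF _ Q2A).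
rewrite inE => /andP[v2Q1 v2Q2].
have [Q3 Q3A v2Q3] := nhA v2; have cQ3 := Acl _ Q3A.
have Q31 : Q3 != Q1 by apply: contraNneq v2Q3 => ->.
have Q32 : Q3 != Q2 by apply: contraNneq v2Q3 => ->.
have Q13 : Q1 != Q3 by rewrite eq_sym.
have Q23 : Q2 != Q3 by rewrite eq_sym.
have [a aQ1 aA] := apex Q1 Q1A; have [b bQ2 bA] := apex Q2 Q2A.
have [c cNQ3 cA] := apex Q3 Q3A.
have out (Q : {set G}) v : clique Q -> v \notin Q -> exists2 u, u \in Q & ~~ cadj u v.
  move=> cQ vQ; apply: contrapT => nu; case/negP: vQ.
  apply: clique_mem cQ _ => u uQ; apply/negPn/negP; rewrite cadj_sym => uv.
  by apply: nu; exists u.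
have [x xQ1 xa] := out _ _ cQ1 aQ1; have [y yQ2 yb] := out _ _ cQ2 bQ2.
have [z zQ3 zc] := out _ _ cQ3 cNQ3.
have [aQ2 aQ3] := conj (aA _ Q2A Q21) (aA _ Q3A Q31).
have [bQ1 bQ3] := conj (bA _ Q1A Q12) (bA _ Q3A Q32).
have [cinQ1 cinQ2] := conj (cA _ Q1A Q13) (cA _ Q2A Q23).
have ab := clique_cadj cQ3 aQ3 bQ3; have bc := clique_cadj cQ1 bQ1 cinQ1.
have ac := clique_cadj cQ2 aQ2 cinQ2.
have xb := clique_cadj cQ1 xQ1 bQ1; have xc := clique_cadj cQ1 xQ1 cinQ1.
have ya := clique_cadj cQ2 yQ2 aQ2; have yc := clique_cadj cQ2 yQ2 cinQ2.
have za := clique_cadj cQ3 zQ3 aQ3; have zb := clique_cadj cQ3 zQ3 bQ3.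
have N := presun_neqE ab bc ac xb xc xa ya yc yb za zb zc.
have nbr (u v1' v2' v3 v4 : G) : cadj u v1' -> cadj u v2' -> cadj u v3 -> cadj u v4 ->
    uniq [:: u; v1'; v2'; v3; v4] ->
    forall w, cadj u w -> w \in [:: u; v1'; v2'; v3; v4].
  move=> u1 u2 u3 u4 /= /andP[uN U] w; rewrite inE /cadj /= eq_sym.
  case: eqP => //= _ uw.
  apply: (@degree4_nbr _ u [:: v1'; v2'; v3; v4]) uw => [||v vs];
    [exact: deg4|exact: U|].
  rewrite adj_cadj; apply/andP; split.
    by apply: contraNneq uN => ->.
  by move: vs; rewrite !inE => /or4P[]/eqP->.
have Na : forall u, cadj a u -> u \in [:: a; b; c; y; z].
  by apply: nbr => //; rewrite 1?cadj_sym //= !inE !N.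
have Nb : forall u, cadj b u -> u \in [:: a; b; c; x; z].
  have H : forall u, cadj b u -> u \in [:: b; a; c; x; z].
    by apply: nbr => //; rewrite 1?cadj_sym //= !inE !N.
  by move=> u /H; rewrite !inE orbCA.
have Nc : forall u, cadj c u -> u \in [:: a; b; c; x; y].
  have H : forall u, cadj c u -> u \in [:: c; a; b; x; y].
    by apply: nbr => //; rewrite 1?cadj_sym //= !inE !N.
  by move=> u /H; rewrite !inE; do 3?case: (u == _).
have S : good_sun a b c x y z.
  split => //; move=> [xy yz xz]; apply: (noct a b c x y z).
  split; split; rewrite ?adj_cadj ?N //=; try by rewrite cadj_sym.
have Q1E : Q1 = [set b; c; x]%SET.
  apply: (clique_max cQ1 _ (complete3 bc _ _)); rewrite 1?cadj_sym //.
  apply/fintype.subsetP => u uQ1; have := Nb u (clique_cadj cQ1 bQ1 uQ1).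
  rewrite !inE => /orP[/eqP uE|/or4P[->|->|->|/eqP uE]]; rewrite ?orbT //; subst u.
    by rewrite uQ1 in aQ1.
  by rewrite (clique_cadj cQ1 uQ1 cinQ1) in zc.
have Q2E : Q2 = [set a; c; y]%SET.
  apply: (clique_max cQ2 _ (complete3 ac _ _)); rewrite 1?cadj_sym //.
  apply/fintype.subsetP => u uQ2; have := Na u (clique_cadj cQ2 aQ2 uQ2).
  rewrite !inE => /orP[->//|/or4P[/eqP uE|->|->|/eqP uE]]; rewrite ?orbT //; subst u.
    by rewrite uQ2 in bQ2.
  by rewrite (clique_cadj cQ2 uQ2 cinQ2) in zc.
have Q3E : Q3 = [set a; b; z]%SET.
  apply: (clique_max cQ3 _ (complete3 ab _ _)); rewrite 1?cadj_sym //.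
  apply/fintype.subsetP => u uQ3; have := Na u (clique_cadj cQ3 aQ3 uQ3).
  rewrite !inE => /orP[->//|/or4P[->|/eqP uE|/eqP uE|->]]; rewrite ?orbT //; subst u.
    by rewrite uQ3 in cNQ3.
  by rewrite (clique_cadj cQ3 uQ3 bQ3) in yb.
exists a, b, c, x, y, z; split => //.
  by rewrite -Q1E -Q2E -Q3E !(fintype.subsetP AF).
move=> Q QF; have cQ := F_clique Q QF.
have meet (P : {set G}) : P \in A -> exists2 v, v \in Q & v \in P.
  move=> /(fintype.subsetP AF) PF; have /set0Pn[v] := F_meet _ _ QF PF.
  by rewrite inE => /andP[]; exists v.
have [u1 u1Q] := meet _ Q1A; have [u2 u2Q] := meet _ Q2A.
have [u3 u3Q] := meet _ Q3A; rewrite Q1E Q2E Q3E => u3E u2E u1E.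
(* A clique through a centre vertex is one of the four triangles, because the remaining type, such
   as [ayz], misses an outer triangle. A clique avoiding the centre would have to contain [x], [y]
   and [z]. *)
case: (boolP (a \in Q)) => aQ.
  have [] := sun_cliques_through S cQ aQ => [E|E|E|[_ E]].
  - exact: Or41.
  - exact: Or44.
  - exact: Or43.
  - by move: u1E u1Q; rewrite E !inE => /orP[/orP[]|]/eqP->; rewrite !N.
case: (boolP (b \in Q)) => bQ.
  have [] := sun_cliques_through (good_sun_swap12 S) cQ bQ => [E|E|E|[_ E]].
  - by apply: Or41; rewrite set3C.
  - by apply: Or44; rewrite set3C.
  - exact: Or42.
  - by move: u2E u2Q; rewrite E !inE => /orP[/orP[]|]/eqP->; rewrite !N.
case: (boolP (c \in Q)) => cinQ.
  have [] := sun_cliques_through (good_sun_rot (good_sun_rot S)) cQ cinQ => [E|E|E|[_ E]].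
  - by apply: Or41; rewrite E set3C set3CA.
  - by apply: Or43; rewrite E set3C.
  - by apply: Or42; rewrite E set3C.
  - by move: u3E u3Q; rewrite E !inE => /orP[/orP[]|]/eqP->; rewrite !N.
have xQ : x \in Q.
  move: u1E u1Q; rewrite !inE => /orP[/orP[]|]/eqP-> //; by rewrite ?(negbTE bQ) ?(negbTE cinQ).
have yQ : y \in Q.
  move: u2E u2Q; rewrite !inE => /orP[/orP[]|]/eqP-> //; by rewrite ?(negbTE aQ) ?(negbTE cinQ).
have zQ : z \in Q.
  move: u3E u3Q; rewrite !inE => /orP[/orP[]|]/eqP-> //; by rewrite ?(negbTE aQ) ?(negbTE bQ).
by case: (sun_xyz S); split; apply: clique_cadj cQ _ _.
Qed.

(** * Reduction to triangle-free graphs *)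

Section edge_deletion.
Variables (G : sgraph) (a b : G).

Definition edge_deletion_adj : rel G :=
  [rel u v | adj u v && ([set u; v]%SET != [set a; b]%SET)].

Lemma edge_deletion_sym : symmetric edge_deletion_adj.
Proof. by move=> u v; rewrite /edge_deletion_adj /= adj_sym finset.setUC. Qed.

Lemma edge_deletion_irrefl : irreflexive edge_deletion_adj.
Proof. by move=> u; rewrite /edge_deletion_adj /= adj_irrefl. Qed.

Definition edge_deletion : sgraph :=
  SGraph edge_deletion_sym edge_deletion_irrefl.

Lemma edge_deletion_sub (u v : G) : @adj edge_deletion u v -> adj u v.
Proof. by case/andP. Qed.

Lemma Cl_edge_deletion : adj a b ->
  Cl edge_deletion = star_deletion (Cl G) [set a; b]%SET.
Proof.
move=> ab; apply/setP => s; rewrite inE [RHS]inE inE; apply/idP/idP.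
  move=> /complete_subP[s0 cs]; apply/andP; split.
    apply/complete_subP; split => // u v us vs.
    have := cs u v us vs; rewrite /cadj /=.
    by move=> /predU1P[->|/edge_deletion_sub->]; rewrite ?eqxx ?orbT.
  apply/negP => /fintype.subsetP abs.
  have as' : a \in s by apply: abs; rewrite !inE eqxx.
  have bs : b \in s by apply: abs; rewrite !inE eqxx orbT.
  have := cs a b as' bs; rewrite /cadj /= /edge_deletion_adj /= eqxx andbF orbF.
  by move=> /eqP E; rewrite E adj_irrefl in ab.
move=> /andP[/complete_subP[s0 cs] nabs]; apply/complete_subP; split => // u v us vs.
have := cs u v us vs; rewrite /cadj /= /edge_deletion_adj /=.
move=> /predU1P[->|uv]; rewrite ?eqxx // uv /=; apply/orP; right.
apply: contra nabs => /eqP <-; apply/fintype.subsetP => w; rewrite !inE.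
by move=> /orP[]/eqP->.
Qed.

Lemma dominated_edge_homotopic (R : realType) (c : G) :
  adj a b -> adj a c -> adj b c ->
  (forall d, adj a d -> adj b d -> cadj c d) ->
  homotopic_graphs R G edge_deletion.
Proof.
move=> ab ac bc cdom; rewrite /homotopic_graphs /Cl_space Cl_edge_deletion //.
apply: (@star_removal R G _ _ c).
- exact: simplicial_Cl.
- by apply/set0Pn; exists a; rewrite !inE eqxx.
- rewrite !inE; apply/negP => /orP[]/eqP cE.
    by rewrite cE adj_irrefl in ac.
  by rewrite cE adj_irrefl in bc.
move=> s; rewrite !inE => /complete_subP[s0 cs] /fintype.subsetP abs.
have as' : a \in s by apply: abs; rewrite !inE eqxx.
have bs : b \in s by apply: abs; rewrite !inE eqxx orbT.
have cc u : u \in s -> cadj c u.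
  move=> us; have := cs a u as' us; have := cs b u bs us; rewrite {1 2}/cadj /=.
  move=> /predU1P[<-|bu]; first by rewrite cadj_sym /cadj /= bc orbT.
  move=> /predU1P[<-|au]; first by rewrite cadj_sym /cadj /= ac orbT.
  exact: cdom.
apply/complete_subP; split; first by apply/set0Pn; exists c; rewrite finset.setU11.
move=> u v; rewrite !finset.in_setU1 => /predU1P[->|us] /predU1P[->|vs].
- exact: cadjxx.
- exact: cc.
- by rewrite cadj_sym cc.
- exact: cs.
Qed.

(** The deleted edge is bypassed through [c]. *)
Lemma edge_deletion_connected (c : G) : adj a c -> adj b c -> a != b ->
  graph_connected G -> graph_connected edge_deletion.
Proof.
move=> ac bc aNb [G0 conG]; split=> // x y.
have ca : c != a by apply/eqP => E; rewrite E adj_irrefl in ac.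
have cb : c != b by apply/eqP => E; rewrite E adj_irrefl in bc.
have notab (u : G) : [set u; c]%SET != [set a; b]%SET.
  apply/negP => /eqP /setP /(_ c); rewrite !inE eqxx orbT.
  by rewrite (negbTE ca) (negbTE cb).
have ac' : @adj edge_deletion a c by rewrite /adj /= /edge_deletion_adj /= ac notab.
have bc' : @adj edge_deletion b c by rewrite /adj /= /edge_deletion_adj /= bc notab.
have cab : connect (@adj edge_deletion) a b.
  apply: connect_trans (connect1 ac') _; apply: connect1.
  by rewrite adj_sym.
have csym : connect_sym (@adj edge_deletion).
  by apply: sym_connect_sym => u v; exact: adj_sym.
have sub : subrel (@adj G) (connect (@adj edge_deletion)).
  move=> u v uv; case: (boolP ([set u; v]%SET == [set a; b]%SET)) => E; last first.
    by apply: connect1; rewrite /adj /= /edge_deletion_adj /= uv.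
  have : u \in [set a; b]%SET by rewrite -(eqP E) !inE eqxx.
  have : v \in [set a; b]%SET by rewrite -(eqP E) !inE eqxx orbT.
  rewrite !inE => /orP[]/eqP-> /orP[]/eqP-> //; by rewrite csym.
exact: (connect_sub sub) (conG x y).
Qed.

Lemma edge_deletion_degree (v : G) : (@degree edge_deletion v <= degree v)%N.
Proof.
apply: subset_leq_card; apply/fintype.subsetP => u; rewrite !inE.
exact: edge_deletion_sub.
Qed.

Lemma edge_deletion_octahedron (a' b' c' x' y' z' : G) :
  @octahedron edge_deletion a' b' c' x' y' z' -> octahedron a' b' c' x' y' z'.
Proof.
by case=> -[? ? ?] [? ? ? ?] [? ? ? ?] [? ? ? ?]; split; split => //;
  apply: edge_deletion_sub.
Qed.

End edge_deletion.

Definition triangle_free (G : sgraph) : Prop :=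
  forall a b c : G, adj a b -> adj b c -> adj a c -> False.

(* Without a dominated edge, each edge of a triangle [abc] lies in a second
   triangle; the four neighbours of [a], [b] and [c] are then known, and applying
   the same to the edges of these second triangles yields an octahedron. *)
Lemma exists_dominated_edge (G : sgraph) (a b c : G) :
  (forall v : G, (degree v <= 4)%N) ->
  (forall a b c x y z : G, ~ octahedron a b c x y z) ->
  adj a b -> adj b c -> adj a c ->
  exists u v w : G, [/\ adj u v, adj u w, adj v w &
    forall d, adj u d -> adj v d -> cadj w d].
Proof.
move=> deg4 noct ab bc ac; apply: contrapT => nodom.
have nd (u v w : G) : adj u v -> adj u w -> adj v w ->
    exists d, [/\ adj u d, adj v d, d != w & ~~ adj d w].
  move=> uv uw vw; apply: contrapT => nd; apply: nodom; exists u, v, w; split => //.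
  move=> d ud vd; rewrite /cadj /= eq_sym.
  have [//|dw] := eqVneq d w; apply/negPn/negP => nwd; apply: nd; exists d.
  by split => //; rewrite adj_sym.
have sy (u v : G) : adj u v -> adj v u by rewrite adj_sym.
have [z [az bz zc nzc]] := nd a b c ab ac bc.
have [y [ay cy yb nyb]] := nd a c b ac ab (sy _ _ bc).
have [x [bx cx xa nxa]] := nd b c a bc (sy _ _ ab) (sy _ _ ac).
have adjN (u v : G) : adj u v -> u != v.
  by move=> uv; apply/eqP => E; rewrite E adj_irrefl in uv.
have sepN (u v w : G) : adj w u -> ~~ adj v w -> u != v.
  by move=> wu vw; apply/eqP => E; rewrite -E adj_sym wu in vw.
have nbr (u v1 v2 v3 v4 : G) : adj u v1 -> adj u v2 -> adj u v3 -> adj u v4 ->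
    uniq [:: v1; v2; v3; v4] -> forall w, adj u w -> w \in [:: v1; v2; v3; v4].
  move=> u1 u2 u3 u4 U w; apply: (@degree4_nbr _ u); [exact: deg4|exact: U|].
  by move=> v; rewrite !inE => /or4P[]/eqP->.
have xy : x != y by apply: sepN bx nyb.
have xz : x != z by apply: sepN cx nzc.
have yz : y != z by apply: sepN cy nzc.
have Na : forall w, adj a w -> w \in [:: b; c; y; z].
  apply: nbr => //=; rewrite !inE !negb_or (adjN _ _ bc) (adjN _ _ bz) (adjN _ _ cy) yz.
  by rewrite [b == y]eq_sym yb [c == z]eq_sym zc.
have Nb : forall w, adj b w -> w \in [:: a; c; x; z].
  apply: nbr => //=; try exact: sy.
  rewrite !inE !negb_or (adjN _ _ ac) (adjN _ _ az) (adjN _ _ cx) xz.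
  by rewrite [a == x]eq_sym xa [c == z]eq_sym zc.
have yz' : adj y z.
  have [d [ad zd db ndb]] := nd a z b az ab (sy _ _ bz).
  have := Na d ad; rewrite !inE (negbTE db) /= => /or3P[]/eqP dE; subst d.
  - by rewrite adj_sym bc in ndb.
  - by rewrite adj_sym.
  - by rewrite adj_irrefl in zd.
have xz' : adj x z.
  have [d [bd zd da nda]] := nd b z a bz (sy _ _ ab) (sy _ _ az).
  have := Nb d bd; rewrite !inE (negbTE da) /= => /or3P[]/eqP dE; subst d.
  - by rewrite adj_sym ac in nda.
  - by rewrite adj_sym.
  - by rewrite adj_irrefl in zd.
have xy' : adj x y.
  have [d [bd xd dc ndc]] := nd c x b cx (sy _ _ bc) (sy _ _ bx).
  have Nc : forall w, adj c w -> w \in [:: a; b; x; y].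
    apply: nbr => //=; try exact: sy.
    rewrite !inE !negb_or (adjN _ _ ab) (adjN _ _ ay) (adjN _ _ bx) xy.
    by rewrite [a == x]eq_sym xa [b == y]eq_sym yb.
  have := Nc d bd; rewrite !inE (negbTE dc) /= => /or3P[]/eqP dE; subst d.
  - by rewrite ab in ndc.
  - by rewrite adj_irrefl in xd.
  - by [].
apply: (noct a b c x y z); split; split; rewrite ?[_ == x]eq_sym ?[_ == y]eq_sym ?[_ == z]eq_sym //.
- exact: sy bx.
- exact: sy cx.
- exact: sy cy.
Qed.

(** Deleting a dominated edge keeps connectedness, the degree bound and the absence of octahedra, so
    it can be repeated; the number of adjacent pairs decreases. *)
Lemma exists_triangle_free (R : realType) (G : sgraph) : graph_connected G ->
  (forall v : G, (degree v <= 4)%N) ->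
  (forall a b c x y z : G, ~ octahedron a b c x y z) ->
  exists2 T : sgraph, graph_connected T /\ triangle_free T & homotopic_graphs R G T.
Proof.
move: {2}(#|[pred p : G * G | adj p.1 p.2]|) (leqnn #|[pred p : G * G | adj p.1 p.2]|).
move=> n; elim: n G => [|n IH] G Gn conG deg4 noct.
  exists G; last exact: homotopy_equivalent_refl.
  split => // a b c ab _ _; move: Gn; rewrite leqn0 => /eqP/card0_eq/(_ (a, b)).
  by rewrite !inE /= ab.
have [tf|ntf] := pselect (triangle_free G).
  by exists G => //; exact: homotopy_equivalent_refl.
have [a [b [c [ab bc ac]]]] : exists a b c : G, [/\ adj a b, adj b c & adj a c].
  apply: contrapT => nt; apply: ntf => a b c ab bc ac; apply: nt.
  by exists a, b, c.
have [u [v [w [uv uw vw wdom]]]] := exists_dominated_edge deg4 noct ab bc ac.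
have uNv : u != v by apply/eqP => E; rewrite E adj_irrefl in uv.
have [T [conT tfT] GT] : exists2 T : sgraph, graph_connected T /\ triangle_free T &
    homotopic_graphs R (edge_deletion u v) T.
  apply: IH.
  - rewrite -ltnS; apply: leq_trans Gn; apply: proper_card; apply/properP; split.
      by apply/fintype.subsetP => p; rewrite !inE; exact: edge_deletion_sub.
    exists (u, v); rewrite !inE //= /adj /= /edge_deletion_adj /=.
    by rewrite eqxx andbF.
  - exact: edge_deletion_connected uw vw uNv conG.
  - move=> x; exact: leq_trans (edge_deletion_degree _ _ _) (deg4 x).
  - move=> a' b' c' x' y' z' /edge_deletion_octahedron; exact: noct.
exists T => //; apply: homotopy_equivalent_trans GT.
exact: dominated_edge_homotopic uv uw vw wdom.
Qed.

(** * One-dimensional complexes *)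

Section one_dimensional_moves.
Variables (R : realType) (W : finType).
Local Notation geom S := (set_type (realization R S)).
Implicit Types (B : {set {set W}}) (u v w i : W) (s t : {set W}).

Lemma simplicial_setU1 B s : simplicial B ->
  (forall t, t \subset s -> t != finset.set0 -> t != s -> t \in B) ->
  simplicial (s |: B)%SET.
Proof.
move=> simB sB t1 t2; rewrite !finset.in_setU1 => /predU1P[->|t1B] t21 t20.
  by have [//|t2s] := eqVneq t2 s; rewrite sB.
by rewrite (simB _ _ t1B t21 t20) orbT.
Qed.

Lemma simplicial_vertex B u : simplicial B -> simplicial ([set u]%SET |: B)%SET.
Proof.
move=> simB; apply: simplicial_setU1 => // t.
by rewrite finset.subset1 => /orP[]/eqP-> ; rewrite eqxx.
Qed.

Lemma sub_pair s u v : s \subset [set u; v]%SET -> s != finset.set0 ->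
  [\/ s = [set u]%SET, s = [set v]%SET | s = [set u; v]%SET].
Proof.
move=> suv /set0Pn[x xs].
have [us|us] := boolP (u \in s); have [vs|vs] := boolP (v \in s).
- apply: Or33; apply/eqP; rewrite finset.eqEsubset suv /=.
  by apply/fintype.subsetP => w; rewrite !inE => /orP[]/eqP->.
- apply: Or31; apply/eqP; rewrite finset.eqEsubset finset.sub1set us andbT.
  apply/fintype.subsetP => w ws; have := fintype.subsetP suv w ws; rewrite !inE.
  by move=> /orP[//|/eqP wv]; rewrite -wv ws in vs.
- apply: Or32; apply/eqP; rewrite finset.eqEsubset finset.sub1set vs andbT.
  apply/fintype.subsetP => w ws; have := fintype.subsetP suv w ws; rewrite !inE.
  by move=> /orP[/eqP wv|//]; rewrite -wv ws in us.
- have := fintype.subsetP suv x xs; rewrite !inE => /orP[]/eqP xE.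
    by rewrite -xE xs in us.
  by rewrite -xE xs in vs.
Qed.

Lemma simplicial_edge B u v : simplicial B -> [set u]%SET \in B ->
  [set v]%SET \in B -> simplicial ([set u; v]%SET |: B)%SET.
Proof.
move=> simB uB vB; apply: simplicial_setU1 => // t tuv t0.
by have [->|->|->] := sub_pair tuv t0; rewrite ?eqxx.
Qed.

Lemma sub_triple s u v w : s \subset [set u; v; w]%SET -> s != finset.set0 ->
  s = [set u; v; w]%SET \/
  [\/ s \subset [set u; v]%SET, s \subset [set u; w]%SET | s \subset [set v; w]%SET].
Proof.
move=> suvw s0.
have drop x (A : {set W}) : x \notin s ->
    (forall y, y \in [set u; v; w]%SET -> y != x -> y \in A) -> s \subset A.
  move=> xs sA; apply/fintype.subsetP => y ys; apply: sA.
    exact: (fintype.subsetP suvw).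
  by apply/eqP => yx; rewrite -yx ys in xs.
have [us|us] := boolP (u \in s); last first.
  right; apply: Or33; apply: (drop u) => // y; rewrite !inE.
  by move=> /orP[/orP[]|]->; rewrite ?orbT.
have [vs|vs] := boolP (v \in s); last first.
  right; apply: Or32; apply: (drop v) => // y; rewrite !inE.
  by move=> /orP[/orP[]|]->; rewrite ?orbT.
have [ws|ws] := boolP (w \in s); last first.
  right; apply: Or31; apply: (drop w) => // y; rewrite !inE.
  by move=> /orP[/orP[]|]->; rewrite ?orbT.
left; apply/eqP; rewrite finset.eqEsubset suvw /=.
by apply/fintype.subsetP => y; rewrite !inE => /orP[/orP[]|]/eqP->.
Qed.

(** The star of the pendant vertex [i] is a cone with apex [w]. *)
Lemma leaf_move B i w : simplicial B -> [set w]%SET \in B ->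
  (forall s, s \in B -> i \notin s) ->
  homotopy_equivalent R (geom ([set i]%SET |: ([set i; w]%SET |: B))%SET) (geom B).
Proof.
move=> simB wB iB.
have iw : i != w by have := iB _ wB; rewrite inE.
pose S := ([set i]%SET |: ([set i; w]%SET |: B))%SET.
have SE : S = ([set i; w]%SET |: ([set i]%SET |: B))%SET by rewrite /S finset.setUCA.
have simS : simplicial S.
  rewrite SE; apply: simplicial_edge; first exact: simplicial_vertex.
    by rewrite finset.setU11.
  by rewrite finset.in_setU1 wB orbT.
have BE : B = star_deletion S [set i]%SET.
  apply/setP => s; rewrite inE finset.sub1set !finset.in_setU1.
  have [->|_] := eqVneq s [set i]%SET.
    by rewrite inE eqxx; apply/negbTE/negP => /iB; rewrite inE eqxx.
  have [->|_] := eqVneq s [set i; w]%SET; rewrite /= ?andbT.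
    by rewrite !inE eqxx; apply/negbTE/negP => /iB; rewrite !inE eqxx.
  by case sB: (s \in B) => //; rewrite iB.
suff : homotopy_equivalent R (geom S) (geom (star_deletion S [set i]%SET)).
  by rewrite -BE.
apply: (@star_removal R W _ _ w) => //.
- by apply/set0Pn; exists i; rewrite inE.
- by rewrite inE eq_sym.
move=> s; rewrite finset.sub1set !finset.in_setU1.
move=> /or3P[/eqP->|/eqP->|/iB/negbTE->//] _; apply/or3P; apply: Or32.
  by rewrite finset.setUC.
apply/eqP/setP => y; rewrite !inE; by case: (y == w); rewrite ?orbT.
Qed.

(** Apart from itself, [uw] is a face of the triangle [uvw] only, so [v] is an apex for its star and
    the triangle collapses through that edge. *)
Lemma slide_half B u v w : simplicial B -> [set v; w]%SET \in B ->
  [set u]%SET \in B -> u != v -> u != w -> v != w ->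
  (forall s, s \in B -> u \in s -> v \notin s) ->
  (forall s, s \in B -> u \in s -> w \notin s) ->
  homotopy_equivalent R
    (geom ([set u; v; w]%SET |: ([set u; v]%SET |: ([set u; w]%SET |: B)))%SET)
    (geom ([set u; v]%SET |: B)%SET).
Proof.
move=> simB vwB uB uv uw vw uvB uwB.
set S := (_ |: (_ |: (_ |: B)))%SET.
have vB : [set v]%SET \in B.
  apply: simB vwB _ _; last by apply/set0Pn; exists v; rewrite inE.
  by rewrite finset.sub1set !inE eqxx.
have wB : [set w]%SET \in B.
  apply: simB vwB _ _; last by apply/set0Pn; exists w; rewrite inE.
  by rewrite finset.sub1set !inE eqxx orbT.
have simS : simplicial S.
  apply: simplicial_setU1.
    apply: simplicial_edge; first exact: simplicial_edge.
      by rewrite finset.in_setU1 uB orbT.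
    by rewrite finset.in_setU1 vB orbT.
  move=> t tS t0 tN; have [tE|[]] := sub_triple tS t0.
  - by rewrite tE eqxx in tN.
  - by move=> /sub_pair/(_ t0)[]->; rewrite !finset.in_setU1 ?uB ?vB ?eqxx ?orbT.
  - by move=> /sub_pair/(_ t0)[]->; rewrite !finset.in_setU1 ?uB ?wB ?eqxx ?orbT.
  - by move=> /sub_pair/(_ t0)[]->; rewrite !finset.in_setU1 ?vB ?wB ?vwB ?orbT.
have uwP s : ([set u; w]%SET \subset s) = (u \in s) && (w \in s).
  by rewrite finset.subUset !finset.sub1set.
have -> : ([set u; v]%SET |: B)%SET = star_deletion S [set u; w]%SET.
  apply/setP => s; rewrite [RHS]inE uwP !finset.in_setU1.
  have [->|_] := eqVneq s [set u; v]%SET.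
    by rewrite !inE ![w == _]eq_sym (negbTE uw) (negbTE vw) andbF !orbT.
  have [->|_] := eqVneq s [set u; v; w]%SET.
    rewrite !inE !eqxx !orbT /=; apply/negbTE/negP => sB.
    by have := uvB _ sB; rewrite !inE !eqxx !orbT => /(_ isT).
  have [->|_] := eqVneq s [set u; w]%SET.
    rewrite !inE !eqxx !orbT /=; apply/negbTE/negP => sB.
    by have := uwB _ sB; rewrite !inE !eqxx !orbT => /(_ isT).
  rewrite /=; case sB: (s \in B) => //=; case us: (u \in s) => //=.
  by rewrite (uwB _ sB us).
apply: (@star_removal R W _ _ v) => //.
- by apply/set0Pn; exists u; rewrite !inE eqxx.
- by rewrite !inE ![v == _]eq_sym negb_or uv eq_sym vw.
move=> s; rewrite uwP !finset.in_setU1 => sS /andP[us ws].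
apply/orP; left; apply/eqP; case/or4P: sS => [/eqP sE|/eqP sE|/eqP sE|sB].
- by apply/setP => y; rewrite sE !inE; case: (y == v); rewrite ?orbT.
- by move: ws; rewrite sE !inE ![w == _]eq_sym (negbTE uw) (negbTE vw).
- by apply/setP => y; rewrite sE !inE orbCA orbA.
- by have := uwB _ sB us; rewrite ws.
Qed.

(** Fill in the triangle [uvw] and collapse it through either of the edges [uw] and [uv]. *)
Lemma slide_move B u v w : simplicial B -> [set v; w]%SET \in B ->
  [set u]%SET \in B -> u != v -> u != w -> v != w ->
  (forall s, s \in B -> u \in s -> v \notin s) ->
  (forall s, s \in B -> u \in s -> w \notin s) ->
  homotopy_equivalent R (geom ([set u; v]%SET |: B)%SET)
    (geom ([set u; w]%SET |: B)%SET).
Proof.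
move=> simB vwB uB uv uw vw uvB uwB.
apply: homotopy_equivalent_trans (homotopy_equivalent_sym _) _.
  exact: (@slide_half B u v w).
have -> : ([set u; v; w] |: ([set u; v] |: ([set u; w] |: B)) =
    [set u; w; v] |: ([set u; w] |: ([set u; v] |: B)))%SET.
  apply/setP => s; rewrite !finset.in_setU1 [([set u; v; w])%SET]finset.setUAC.
  by do 3?case: (s == _).
apply: slide_half => //; first by rewrite finset.setUC.
by rewrite eq_sym.
Qed.

End one_dimensional_moves.

(** * Turning edges into ears at the root *)

Section ears.
Variables (R : realType) (V : finType) (r : V) (p : V -> V) (d : V -> nat).
Local Notation geom S := (set_type (realization R S)).

(* The two inner vertices of the ear that replaces the edge [i] are
   [inr (i, false)] and [inr (i, true)]. *)
Local Notation W := (V + (V * V) * bool)%type.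
Implicit Types (U : {set V}) (e : rel V) (J : {set V * V}) (s : {set W}).
Implicit Types (B : {set {set W}}).

Definition core U e : {set {set W}} :=
  [set s | [exists q : V * V, [&& q.1 \in U, q.2 \in U,
    (q.1 == q.2) || e q.1 q.2 & s == [set inl q.1; inl q.2]]]]%SET.

(** A path of three edges is the shortest that stays simplicial when both ends are attached to the
    same vertex; it then closes up to the boundary of a triangle. *)
Definition ear (i : V * V) (u v : W) : {set {set W}} :=
  [set s | s \in [:: [set inr (i, false)]; [set inr (i, true)];
    [set inr (i, false); inr (i, true)]; [set inr (i, false); u];
    [set inr (i, true); v]]]%SET.

Definition ears J : {set {set W}} :=
  [set s | [exists i in J, s \in ear i (inl r) (inl r)]]%SET.

Lemma coreP U e s : reflect (exists u v, [/\ u \in U, v \in U,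
   (u == v) || e u v & s = [set inl u; inl v]%SET]) (s \in core U e).
Proof.
rewrite inE; apply: (iffP existsP) => [[[u v] /= /and4P[uU vU uv /eqP sE]]|].
  by exists u, v.
by move=> [u [v [uU vU uv sE]]]; exists (u, v); rewrite /= uU vU uv sE eqxx.
Qed.

Lemma earsP J s : reflect (exists2 i, i \in J & s \in ear i (inl r) (inl r))
  (s \in ears J).
Proof. by rewrite inE; apply: exists_inP. Qed.

(** A spanning tree of [U] rooted at [r], given by the parent map [p] and a rank [d] that decreases
    strictly towards the root. *)
Definition graded U e : Prop := [/\ r \in U, symmetric e, irreflexive e &
  forall u, u \in U -> u != r -> [/\ p u \in U, e u (p u) & (d (p u) < d u)%N]].

Lemma core_vertex U e u : u \in U -> [set inl u]%SET \in core U e.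
Proof.
move=> uU; apply/coreP; exists u, u; rewrite eqxx; split => //.
by rewrite finset.setUid.
Qed.

Lemma core_edge U e u v : u \in U -> v \in U -> e u v ->
  [set inl u; inl v]%SET \in core U e.
Proof. by move=> uU vU uv; apply/coreP; exists u, v; rewrite uv orbT. Qed.

Lemma simplicial_core_ears U e J : r \in U -> simplicial (core U e :|: ears J)%SET.
Proof.
move=> rU s t; rewrite !finset.in_setU => /orP[/coreP[u [v [uU vU uv ->]]]|].
  move=> /sub_pair ts /ts [] ->; rewrite ?core_vertex //.
  by apply/orP; left; apply/coreP; exists u, v.
move=> /earsP[i iJ]; rewrite inE.
have ear_mem (x : {set W}) : x \in ear i (inl r) (inl r) -> x \in ears J.
  by move=> xE; apply/earsP; exists i.
have i0E : [set inr (i, false)]%SET \in ears J.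
  by apply: ear_mem; rewrite inE !in_cons eqxx.
have i1E : [set inr (i, true)]%SET \in ears J.
  by apply: ear_mem; rewrite inE !in_cons eqxx !orbT.
have pairs (x y : W) : [set x; y]%SET \in ears J ->
    [set x]%SET \in (core U e :|: ears J)%SET ->
    [set y]%SET \in (core U e :|: ears J)%SET ->
    t \subset [set x; y]%SET -> t != finset.set0 ->
    (t \in core U e) || (t \in ears J).
  rewrite !finset.in_setU => xyE xE yE txy t0.
  by have [->|->|->] := sub_pair txy t0 => //; rewrite xyE orbT.
have rC : [set inl r]%SET \in (core U e :|: ears J)%SET.
  by rewrite finset.in_setU core_vertex.
have [i0C i1C] : [set inr (i, false)]%SET \in (core U e :|: ears J)%SET /\
    [set inr (i, true)]%SET \in (core U e :|: ears J)%SET.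
  by rewrite !finset.in_setU i0E i1E !orbT.
rewrite !in_cons in_nil orbF.
move=> /orP[/eqP->|/or4P[]/eqP->] ts t0.
- by move: ts; rewrite finset.subset1 (negbTE t0) orbF => /eqP->; rewrite i0E orbT.
- by move: ts; rewrite finset.subset1 (negbTE t0) orbF => /eqP->; rewrite i1E orbT.
- by apply: pairs ts t0 => //; apply: ear_mem; rewrite inE !in_cons eqxx !orbT.
- by apply: pairs ts t0 => //; apply: ear_mem; rewrite inE !in_cons eqxx !orbT.
- by apply: pairs ts t0 => //; apply: ear_mem; rewrite inE !in_cons eqxx !orbT.
Qed.

Lemma ears_fresh U e J i j : i \notin J ->
  forall s, s \in (core U e :|: ears J)%SET -> inr (i, j) \notin s.
Proof.
move=> iJ s; rewrite finset.in_setU => /orP[/coreP[u [v [_ _ _ ->]]]|].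
  by rewrite !inE.
move=> /earsP[k kJ]; have ik : (i == k) = false.
  by apply/negbTE/eqP => E; rewrite E kJ in iJ.
have neq b : (inr (i, j) == inr (k, b) :> W) = false.
  by apply/negbTE/eqP => -[E]; rewrite E eqxx in ik.
rewrite inE !in_cons in_nil orbF => /orP[/eqP->|/or4P[]/eqP->]; by rewrite !inE !neq.
Qed.

(** The end of the edge slides from each vertex to its parent, by induction on the rank. No simplex
    of [B] joins [i] to a vertex of [V], so every slide is allowed. *)
Lemma slide_to_root U e B (i : W) : graded U e -> simplicial B ->
  core U e \subset B -> [set i]%SET \in B ->
  (forall u, i != inl u) ->
  (forall s u, s \in B -> i \in s -> inl u \notin s) ->
  forall u, u \in U ->
  homotopy_equivalent R (geom ([set i; inl u]%SET |: B)%SET)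
    (geom ([set i; inl r]%SET |: B)%SET).
Proof.
move=> [rU esym eirr gr] simB /fintype.subsetP CB iB iV iBV u.
have [n] := ubnP (d u); elim: n u => // n IH u; rewrite ltnS => dn uU.
have [->|ur] := eqVneq u r; first exact: homotopy_equivalent_refl.
have [puU eup dpu] := gr u uU ur.
apply: homotopy_equivalent_trans (IH (p u) (leq_trans dpu dn) puU).
apply: slide_move => //; first by apply: CB; exact: core_edge.
- by apply/eqP => -[E]; rewrite -E eirr in eup.
- by move=> s sB is'; exact: iBV.
- by move=> s sB is'; exact: iBV.
Qed.

Definition delete_pair e (v w : V) : rel V :=
  [rel x y | e x y && ~~ ((x == v) && (y == w) || (x == w) && (y == v))].

Lemma core_delete_pair U e v w : v \in U -> w \in U -> symmetric e -> e v w ->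
  core U e = ([set inl v; inl w]%SET |: core U (delete_pair e v w))%SET.
Proof.
move=> vU wU esym evw; apply/setP => s; rewrite finset.in_setU1.
apply/idP/idP => [/coreP[x [y [xU yU xy ->]]]|/predU1P[->|]].
- case: (boolP ((x == v) && (y == w) || (x == w) && (y == v))).
    by move=> /orP[]/andP[/eqP-> /eqP->]; rewrite ?eqxx // finset.setUC eqxx.
  move=> nvw; apply/orP; right; apply/coreP; exists x, y; split => //.
  by case/orP: xy => [->//|xy]; rewrite /delete_pair /= xy nvw orbT.
- exact: core_edge.
- move=> /coreP[x [y [xU yU xy ->]]]; apply/coreP; exists x, y; split => //.
  by case/orP: xy => [->//|/andP[-> _]]; rewrite orbT.
Qed.

(** A whisker is grown at [w], the [w]-end of the edge [vw] slides out to its tip, and the resulting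
    path from [v] to [w] has both ends slid to the root along the tree. *)
Lemma edge_to_ear U e J v w : graded U (delete_pair e v w) -> symmetric e ->
  v \in U -> w \in U -> e v w -> v != w -> v != r -> (v, w) \notin J ->
  homotopy_equivalent R (geom (core U e :|: ears J)%SET)
    (geom (core U (delete_pair e v w) :|: ears ((v, w) |: J))%SET).
Proof.
set e' := delete_pair e v w => gr esym vU wU evw vw vr iJ.
have [rU esym' eirr' _] := gr.
set i := (v, w); pose i0 : W := inr (i, false); pose i1 : W := inr (i, true).
pose B := (core U e' :|: ears J)%SET.
have simB : simplicial B by exact: simplicial_core_ears.
have freshB j s : s \in B -> inr (i, j) \notin s by exact: ears_fresh.
have CB : core U e' \subset B by exact: finset.subsetUl.
have vB : [set inl v]%SET \in B by rewrite finset.in_setU core_vertex.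
have wB : [set inl w]%SET \in B by rewrite finset.in_setU core_vertex.
have vwB s : s \in B -> inl v \in s -> inl w \notin s.
  rewrite finset.in_setU => /orP[/coreP[x [y [_ _ xy ->]]]|].
    rewrite !inE => vxy; apply/negP => wxy; move: vxy wxy xy.
    have inlE (a b : V) : (inl a == inl b :> W) = (a == b) by [].
    rewrite !inlE /e' /delete_pair /= => /orP[]/eqP<- /orP[]/eqP wE.
    + by rewrite wE eqxx in vw.
    + by rewrite -wE !eqxx (negbTE vw) /= andbF.
    + by rewrite -wE !eqxx ![w == v]eq_sym (negbTE vw) /= ?orbT ?andbF.
    + by rewrite wE eqxx in vw.
  move=> /earsP[k kJ]; have vrE : (inl v == inl r :> W) = false.
    by apply/negbTE/eqP => -[E]; rewrite E eqxx in vr.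
  rewrite inE !in_cons in_nil orbF => /orP[/eqP->|/or4P[]/eqP->]; by rewrite !inE ?vrE.
have -> : (core U e :|: ears J = [set inl v; inl w]%SET |: B)%SET.
  by rewrite (core_delete_pair vU wU esym evw) finset.setUA.
(* The whisker consists of [i1] attached to [w], and then [i0] attached to [i1]. *)
pose L1 := ([set i1]%SET |: ([set i1; inl w]%SET |: B))%SET.
pose L2 := ([set i0]%SET |: ([set i0; i1]%SET |: L1))%SET.
have simL1 : simplicial L1.
  rewrite /L1 finset.setUCA; apply: simplicial_edge; first exact: simplicial_vertex.
    by rewrite finset.setU11.
  by rewrite finset.in_setU1 wB orbT.
have i1L1 : [set i1]%SET \in L1 by rewrite finset.setU11.
have simL2 : simplicial L2.
  rewrite /L2 finset.setUCA; apply: simplicial_edge; first exact: simplicial_vertex.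
    by rewrite finset.setU11.
  by rewrite finset.in_setU1 i1L1 orbT.
have L2P s : s \in L2 -> [\/ s \in B, s = [set i0]%SET, s = [set i0; i1]%SET |
    s = [set i1]%SET \/ s = [set i1; inl w]%SET].
  rewrite !finset.in_setU1 => /or3P[/eqP|/eqP|/or3P[/eqP|/eqP|]] sE.
  - exact: Or42.
  - exact: Or43.
  - by apply: Or44; left.
  - by apply: Or44; right.
  - exact: Or41.
have vL2 : [set inl v]%SET \in L2 by rewrite !finset.in_setU1 vB !orbT.
have vwE : (inl v == inl w :> W) = false.
  by apply/negbTE/eqP => -[E]; rewrite E eqxx in vw.
have i01 : i0 == i1 = false by apply/negbTE/eqP => -[].
have i10 : i1 == i0 = false by rewrite eq_sym.
apply: (@homotopy_equivalent_trans _ (geom ([set inl v; inl w]%SET |: L2)%SET)).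
  apply: homotopy_equivalent_sym.
  apply: (@homotopy_equivalent_trans _ (geom ([set inl v; inl w]%SET |: L1)%SET)).
    have -> : ([set inl v; inl w]%SET |: L2)%SET =
        ([set i0]%SET |: ([set i0; i1]%SET |: ([set inl v; inl w]%SET |: L1)))%SET.
      by apply/setP => s; rewrite !finset.in_setU1; do 3?case: (s == _).
    apply: leaf_move.
    - by apply: simplicial_edge => //; rewrite !finset.in_setU1 ?vB ?wB !orbT.
    - by rewrite finset.in_setU1 i1L1 orbT.
    - move=> s; rewrite !finset.in_setU1.
      by move=> /or4P[/eqP->|/eqP->|/eqP->|/freshB->//]; rewrite !inE ?i01.
  have -> : ([set inl v; inl w]%SET |: L1)%SET =
      ([set i1]%SET |: ([set i1; inl w]%SET |: ([set inl v; inl w]%SET |: B)))%SET.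
    by apply/setP => s; rewrite !finset.in_setU1; do 3?case: (s == _).
  apply: leaf_move.
  - exact: simplicial_edge.
  - by rewrite finset.in_setU1 wB orbT.
  - move=> s; rewrite !finset.in_setU1.
    by move=> /orP[/eqP->|/freshB->//]; rewrite !inE.
(* With [v] fixed, the other end moves from [w] to [i1] and next to [i0], along the edges of the
   whisker. *)
apply: (@homotopy_equivalent_trans _ (geom ([set inl v; i1]%SET |: L2)%SET)).
  apply: slide_move => //.
  - by rewrite !finset.in_setU1 [[set inl w; i1]%SET]finset.setUC eqxx !orbT.
  - move=> s /L2P[sB|->|->|[]->] vs; [exact: vwB| | | |]; move: vs;
      by rewrite !inE ?vwE.
  - move=> s /L2P[sB|->|->|[]->] vs; [exact: freshB| | | |]; move: vs;
      by rewrite !inE ?vwE.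
apply: (@homotopy_equivalent_trans _ (geom ([set inl v; i0]%SET |: L2)%SET)).
  apply: slide_move => //.
  - by rewrite !finset.in_setU1 [[set i1; i0]%SET]finset.setUC eqxx !orbT.
  - by rewrite i10.
  - move=> s /L2P[sB|->|->|[]->] vs; [exact: freshB| | | |]; move: vs;
      by rewrite !inE ?vwE.
  - move=> s /L2P[sB|->|->|[]->] vs; [exact: freshB| | | |]; move: vs;
      by rewrite !inE ?vwE.
(* Now [i0] is fixed and the end at [v] moves to the root; the end of [i1] at [w] follows below. *)
apply: (@homotopy_equivalent_trans _ (geom ([set i0; inl r]%SET |: L2)%SET)).
  rewrite [[set inl v; i0]%SET]finset.setUC.
  apply: (slide_to_root gr simL2) => //.
  - apply: fintype.subset_trans CB _; apply/fintype.subsetP => s sB.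
    by rewrite !finset.in_setU1 sB !orbT.
  - by rewrite finset.setU11.
  - move=> s u /L2P[sB|->|->|[]->]; rewrite ?inE ?i01 ?i10 //.
    by rewrite (negbTE (freshB _ _ sB)).
pose L3 := ([set i0]%SET |: ([set i1]%SET |: ([set i0; i1]%SET |: ([set i0; inl r]%SET |: B))))%SET.
have rB : [set inl r]%SET \in B by rewrite finset.in_setU core_vertex.
have -> : ([set i0; inl r]%SET |: L2)%SET = ([set i1; inl w]%SET |: L3)%SET.
  by apply/setP => s; rewrite !finset.in_setU1; do 6?case: (s == _).
have -> : (core U e' :|: ears (i |: J) = [set i1; inl r]%SET |: L3)%SET.
  apply/setP => s; rewrite finset.in_setU !finset.in_setU1 finset.in_setU.
  case: (s \in core U e') => /=; first by rewrite !orbT.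
  apply/idP/idP => [/earsP[k]|].
    rewrite finset.in_setU1 => /predU1P[->|kJ] kE; last first.
      have -> : s \in ears J by apply/earsP; exists k.
      by rewrite !orbT.
    move: kE; rewrite inE !in_cons in_nil orbF.
    by case/or4P=> [->|->|->|/orP[]->]; rewrite ?orbT.
  rewrite !orbA => /orP[sE|/earsP[k kJ kE]]; apply/earsP; last first.
    by exists k => //; rewrite finset.in_setU1 kJ orbT.
  exists i; first by rewrite finset.setU11.
  rewrite inE !in_cons in_nil; move: sE; rewrite -!orbA.
  by move=> /or4P[->|->|->|/orP[]->]; rewrite ?orbT.
apply: (slide_to_root gr) => //.
- have -> : L3 = ([set i0; inl r]%SET |: ([set i0; i1]%SET |: ([set i0]%SET |: ([set i1]%SET |: B))))%SET.
    by apply/setP => s; rewrite !finset.in_setU1; do 6?case: (s == _).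
  apply: simplicial_edge.
  + by apply: simplicial_edge; [do 2! apply: simplicial_vertex| |];
      rewrite // !finset.in_setU1 eqxx ?orbT.
  + by rewrite !finset.in_setU1 eqxx ?orbT.
  + by rewrite !finset.in_setU1 rB ?orbT.
- apply: fintype.subset_trans CB _; apply/fintype.subsetP => s sB.
  by rewrite !finset.in_setU1 sB !orbT.
- by rewrite !finset.in_setU1 eqxx orbT.
- move=> s u; rewrite !finset.in_setU1.
  move=> /orP[/eqP->|/or4P[/eqP->|/eqP->|/eqP->|sB]]; rewrite ?inE ?i01 ?i10 //.
  by rewrite (negbTE (freshB _ _ sB)).
Qed.

End ears.

(** * From a graph with a spanning tree to a rose of triangles *)

Section roses.
Variables (R : realType) (V : finType) (r : V) (p : V -> V) (d : V -> nat).
Local Notation geom S := (set_type (realization R S)).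
Local Notation W := (V + (V * V) * bool)%type.
Implicit Types (U : {set V}) (e : rel V) (J : {set V * V}) (s : {set W}).

Definition rose (V' : finType) (r' : V') (J : {set V' * V'}) :
    {set {set V' + (V' * V') * bool}} :=
  ([set inl r'] |: ears r' J)%SET.

Lemma core_leaf U e v : v \in U -> p v \in U -> e v (p v) -> p v != v ->
  symmetric e -> irreflexive e -> (forall w, w \in U -> e v w -> w = p v) ->
  core U e = ([set inl v]%SET |: ([set inl v; inl (p v)]%SET |: core (U :\ v)%SET e))%SET.
Proof.
move=> vU pU ep pv esym eirr only; apply/setP => s; rewrite !finset.in_setU1.
apply/idP/idP => [/coreP[x [y [xU yU xy ->]]]|/or3P[/eqP->|/eqP->|]].
- have [xv|xv] := eqVneq x v.
    subst x; case/orP: xy => [/eqP<-|xy]; first by rewrite finset.setUid eqxx.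
    by rewrite (only y yU xy) eqxx orbT.
  have [yv|yv] := eqVneq y v.
    subst y; case/orP: xy => [/eqP xE|xy]; first by rewrite xE eqxx in xv.
    by rewrite (only x xU) 1?esym // [[set inl (p v); _]%SET]finset.setUC eqxx orbT.
  apply/or3P; apply: Or33; apply/coreP; exists x, y; split => //;
    by rewrite finset.in_setD1 ?xv ?yv.
- exact: core_vertex.
- exact: core_edge.
- move=> /coreP[x [y []]]; rewrite !finset.in_setD1 => /andP[_ xU] /andP[_ yU] xy sE.
  by apply/coreP; exists x, y.
Qed.

(** A vertex [v] of maximal rank is nobody's parent. An edge from [v] to a vertex other than its
    parent is thus not in the tree and may become an ear; when there is none, [v] is pendant and is
    removed. Ears are labelled by pairs that are no longer adjacent, which keeps labels fresh. *)
Lemma graded_rose U e J : graded r p d U e -> (forall q, q \in J -> ~~ e q.1 q.2) ->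
  exists J', homotopy_equivalent R (geom (core U e :|: ears r J)%SET)
    (geom (rose r J')).
Proof.
have [n] := ubnP (#|U| + #|[pred q : V * V | e q.1 q.2]|)%N.
elim: n U e J => // n IH U e J; rewrite ltnS => Un gr eJ.
have [rU esym eirr grp] := gr.
have [Ur|] := set_0Vmem (U :\ r)%SET.
  exists J; have -> : core U e = [set [set inl r]]%SET.
    have UE u : u \in U -> u = r.
      move=> uU; apply/eqP; have := finset.in_set0 u; rewrite -Ur inE uU andbT inE.
      by move/negbFE.
    apply/setP => s; apply/coreP/idP => [[x [y [/UE-> /UE-> _ ->]]]|].
      by rewrite inE finset.setUid.
    by rewrite inE => /eqP->; exists r, r; rewrite eqxx finset.setUid.
  exact: homotopy_equivalent_refl.
case=> u0 u0U; have [v vUr vmax] := @arg_maxnP _ u0 (mem (U :\ r)%SET) d u0U.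
have /andP[vr vU] : (v != r) && (v \in U) by rewrite -finset.in_setD1.
have vtop u : u \in U -> u != r -> (d u <= d v)%N.
  by move=> uU ur; apply: vmax; have := finset.in_setD1 u U r; rewrite ur uU.
have [pU ep dp] := grp v vU vr.
have pv : p v != v by apply/eqP => E; rewrite E ltnn in dp.
have notparent u : u \in U -> u != r -> p u != v.
  move=> uU ur; have [_ _ dpu] := grp u uU ur; apply/eqP => E.
  by have := vtop u uU ur; rewrite leqNgt -E dpu.
have [[w [wU vw wp]]|only] := pselect (exists w, [/\ w \in U, e v w & w != p v]).
  pose e' := delete_pair e v w.
  have gr' : graded r p d U e'.
    split => //.
    - move=> x y; rewrite /e' /delete_pair /= esym; congr (_ && ~~ _).
      by rewrite orbC [(y == v) && _]andbC [(y == w) && _]andbC.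
    - by move=> x; rewrite /e' /delete_pair /= eirr.
    - move=> u uU ur; have [puU eup dpu] := grp u uU ur; split => //.
      rewrite /e' /delete_pair /= eup /= negb_or; apply/andP; split.
        by apply/negP => /andP[/eqP uv /eqP pw]; rewrite -pw uv eqxx in wp.
      by apply/negP => /andP[_ /eqP pw]; have := notparent u uU ur; rewrite pw eqxx.
  have vNw : v != w by apply/eqP => E; rewrite E eirr in vw.
  have iJ : (v, w) \notin J by apply/negP => /eJ; rewrite vw.
  have [|||J' J'E] := IH U e' ((v, w) |: J)%SET.
  - apply: leq_trans Un; rewrite ltn_add2l; apply: proper_card.
    apply/properP; split.
      by apply/fintype.subsetP => q; rewrite !inE => /andP[].
    exists (v, w); first by rewrite inE.
    by rewrite inE /e' /delete_pair /= !eqxx andbF.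
  - exact: gr'.
  - move=> q; rewrite finset.in_setU1 => /predU1P[->|/eJ].
      by rewrite /e' /delete_pair /= !eqxx andbF.
    by apply: contra => /andP[].
  exists J'; apply: homotopy_equivalent_trans J'E.
  exact: (edge_to_ear R gr' esym vU wU vw vNw vr iJ).
have {}only w : w \in U -> e v w -> w = p v.
  move=> wU vw; apply/eqP/negPn/negP => wp; apply: only; by exists w.
have gr' : graded r p d (U :\ v)%SET e.
  split => //; first by rewrite finset.in_setD1 rU andbT eq_sym.
  move=> u; rewrite finset.in_setD1 => /andP[_ uU] ur.
  by have [puU eup dpu] := grp u uU ur; split => //; rewrite finset.in_setD1 puU notparent.
have [|J' J'E] := IH (U :\ v)%SET e J _ gr' eJ.
  by apply: leq_trans Un; rewrite ltn_add2r [X in (_ < X)%N](cardsD1 v) vU.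
exists J'; apply: homotopy_equivalent_trans J'E.
rewrite (core_leaf vU pU ep pv esym eirr only) -!finset.setUA.
have rU' : r \in (U :\ v)%SET by case: gr'.
apply: leaf_move.
- exact: simplicial_core_ears.
- by rewrite finset.in_setU core_vertex // finset.in_setD1 pv.
- move=> s; rewrite finset.in_setU => /orP[/coreP[x [y []]]|/earsP[k kJ]].
    rewrite !finset.in_setD1 => /andP[xv _] /andP[yv _] _ ->; rewrite !inE.
    have inlE (a b : V) : (inl a == inl b :> W) = (a == b) by [].
    by rewrite !inlE ![v == _]eq_sym negb_or xv.
  have vrE : (inl v == inl r :> W) = false.
    by apply/negbTE/eqP => -[E]; rewrite E eqxx in vr.
  rewrite inE !in_cons in_nil orbF => /orP[/eqP->|/or4P[]/eqP->]; by rewrite !inE ?vrE.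
Qed.

End roses.

(** The breadth-first tree: [d] is the distance from [r], and [p u] precedes [u] on a shortest
    path. *)
Lemma exists_graded (G : sgraph) (r : G) : graph_connected G ->
  exists (p : G -> G) (d : G -> nat), graded r p d finset.setT (@adj G).
Proof.
move=> [_ conG].
pose reach (u : G) n := exists q : seq G, [/\ path (@adj G) r q, last r q = u & size q = n].
have /choice[d dP] (u : G) : exists n, reach u n /\ forall m, reach u m -> (n <= m)%N.
  have ex : exists n, `[< reach u n >].
    have /connectP[q qp qE] := conG r u.
    by exists (size q); apply/asboolP; exists q.
  have [n /asboolP un nmin] := ex_minnP ex.
  by exists n; split => // m um; apply: nmin; exact/asboolP.
have /choice[p pP] (u : G) : exists w, u != r -> adj u w /\ (d w < d u)%N.
  have [ur|ur] := eqVneq u r; first by exists r.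
  have [[q [qp qE qs]] _] := dP u.
  case/lastP: q qp qE qs => [|q w] qp qE qs.
    by move: ur; rewrite -qE eqxx.
  move: qp qE qs; rewrite rcons_path last_rcons size_rcons => /andP[qp wadj] wu qs.
  exists (last r q) => _; rewrite adj_sym -wu; split => //.
  have [_ /(_ (size q))] := dP (last r q).
  rewrite wu -qs ltnS; apply; by exists q.
exists p, d; split => //.
- exact: adj_sym.
- exact: adj_irrefl.
- by move=> u _ ur; have [] := pP u ur; rewrite inE.
Qed.

Lemma triangle_free_rose (R : realType) (G : sgraph) :
  graph_connected G -> triangle_free G ->
  exists (r : G) (J : {set G * G}), homotopy_equivalent R (Cl_space R G)
    (set_type (realization R (rose r J))).
Proof.
move=> conG tf; have [/card_gt0P[r _] _] := conG.
have [p [d gr]] := exists_graded r conG.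
have [|J JE] := graded_rose R (J := finset.set0) gr.
  by move=> q; rewrite inE.
exists r, J; apply: homotopy_equivalent_trans JE.
have -> : (core finset.setT (@adj G) :|: ears r finset.set0 = core finset.setT (@adj G))%SET.
  apply/setP => s; rewrite finset.in_setU.
  suff -> : s \in ears r finset.set0 = false by rewrite orbF.
  by apply/negbTE/negP => /earsP[i]; rewrite inE.
have ClP (s : {set G}) : s \in Cl G ->
    exists u v, ((u == v) || adj u v) /\ s = [set u; v]%SET.
  rewrite inE => /complete_subP[/set0Pn[u us] cs].
  have [su|[v]] := set_0Vmem (s :\ u)%SET.
    exists u, u; rewrite eqxx finset.setUid; split => //.
    by rewrite -(finset.setD1K us) su finset.setU0.
  rewrite finset.in_setD1 => /andP[vu vs]; exists u, v; split; first exact: cs.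
  have adjs (x y : G) : x \in s -> y \in s -> x != y -> adj x y.
    by move=> xs ys xy; rewrite adj_cadj xy cs.
  apply/setP => w; rewrite !inE; apply/idP/orP => [ws|[]/eqP-> //].
  have [//|wu] := eqVneq w u; first by left.
  have [//|wv] := eqVneq w v; first by right.
  case: (tf u v w); apply: adjs => //; by rewrite eq_sym.
have CoreCl u v : (u == v) || adj u v -> [set u; v]%SET \in Cl G.
  move=> uv; rewrite inE; apply/complete_subP; split.
    by apply/set0Pn; exists u; rewrite !inE eqxx.
  move=> x y; rewrite !inE => /orP[]/eqP-> /orP[]/eqP->; rewrite ?cadjxx //.
  by rewrite cadj_sym.
pose W := (G + (G * G) * bool)%type.
pose back (w : W) : G := if w is inl v then v else r.
have simC : simplicial (core finset.setT (@adj G)).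
  have := @simplicial_core_ears G r finset.setT (@adj G) finset.set0.
  rewrite (_ : (core _ _ :|: _)%SET = core finset.setT (@adj G)); first by apply; rewrite inE.
  apply/setP => s; rewrite finset.in_setU.
  suff -> : s \in ears r finset.set0 = false by rewrite orbF.
  by apply/negbTE/negP => /earsP[i]; rewrite inE.
have imp (A B : finType) (f : A -> B) (u v : A) : (f @: [set u; v] = [set f u; f v])%SET.
  by rewrite finset.imsetU !finset.imset_set1.
apply: (@simplicial_equivalent R _ _ _ _ (inl : G -> W) back) => //.
- exact: simplicial_Cl.
- move=> s /ClP[u [v [uv ->]]]; rewrite imp; apply/coreP; exists u, v.
  by rewrite !inE.
- by move=> t /coreP[u [v [_ _ uv ->]]]; rewrite imp; exact: CoreCl.
- move=> s sC; have [u [v [uv sE]]] := ClP s sC.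
  by rewrite sE !imp /= finset.setUid -sE.
- move=> t tC; have [u [v [_ _ uv tE]]] := coreP _ _ _ tC.
  by rewrite tE !imp /= finset.setUid -tE.
Qed.

Lemma set_val_inj (T : choiceType) (A : set T) : injective (@set_val T A).
Proof. by move=> x y; exact: val_inj. Qed.

(** * Wedges of circles *)

Section triangle_circle.
Variable R : realType.
Implicit Types c s y l : R.

(* The boundary of the triangle with vertices (1,0), (-1,1), (-1,-1) is projected
   radially onto the circle; [y1] and [y2] are the barycentric coordinates with
   respect to the last two vertices. *)
Definition loop_c y1 y2 : R := 1 - 2 * (y1 + y2).
Definition loop_s y1 y2 : R := y1 - y2.
Definition loop_norm y1 y2 : R :=
  Num.sqrt (loop_c y1 y2 ^+ 2 + loop_s y1 y2 ^+ 2).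

Definition tri_boundary y1 y2 : Prop :=
  [/\ 0 <= y1, 0 <= y2, y1 + y2 <= 1 & [\/ y1 = 0, y2 = 0 | y1 + y2 = 1]].

Lemma loop_norm_gt0 y1 y2 : tri_boundary y1 y2 -> 0 < loop_norm y1 y2.
Proof.
move=> [y10 y20 y12 bd]; rewrite sqrtr_gt0 /loop_c /loop_s.
rewrite !expr2; case: bd => E.
(* On the two sides at (1,0) the squared norm is 5y^2 - 4y + 1, which is minimal at y = 2/5 with
   value 1/5. *)
- by rewrite E; have := sqr_ge0 (y2 - 2 / 5); rewrite expr2; lra.
- by rewrite E; have := sqr_ge0 (y1 - 2 / 5); rewrite expr2; lra.
- by rewrite E; have := sqr_ge0 (y1 - y2); rewrite expr2; lra.
Qed.

(** Inverts the radial projection. The unnormalised barycentric coordinates of a point in direction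
    [(c, s)] are [c + s - 2t], [s - t] and [-t]; [tri_min c s] is the largest [t] for which all are
    nonnegative, so that one of them vanishes and the point is on the boundary. Their sum is
    [c + 2s - 4t]. *)
Definition tri_min c s : R := Num.min 0 (Num.min s ((c + s) / 2)).

Lemma tri_minP c s : let t := tri_min c s in
  [/\ t <= 0, t <= s, 2 * t <= c + s & [\/ t = 0, t = s | 2 * t = c + s]].
Proof.
rewrite /tri_min /=; case: (leP s ((c + s) / 2)) => h1.
  case: (leP 0 s) => h2; split; try lra; by [apply: Or31; lra|apply: Or32; lra].
case: (leP 0 ((c + s) / 2)) => h2; split; try lra;
  by [apply: Or31; lra|apply: Or33; lra].
Qed.

Lemma tri_min_unique c s t : t <= 0 -> t <= s -> 2 * t <= c + s ->
  [\/ t = 0, t = s | 2 * t = c + s] -> t = tri_min c s.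
Proof.
move=> t0 ts tcs tE; have [u0 us ucs uE] := tri_minP c s.
by case: tE => E; case: uE => E'; lra.
Qed.

Lemma tri_min_loop y1 y2 l : tri_boundary y1 y2 -> 0 < l ->
  tri_min (loop_c y1 y2 * l) (loop_s y1 y2 * l) = - y2 * l.
Proof.
move=> [y10 y20 y12 bd] l0; symmetry; rewrite /loop_c /loop_s.
apply: tri_min_unique; [nra|nra|nra|].
case: bd => E.
- by apply: Or32; rewrite E; lra.
- by apply: Or31; rewrite E; lra.
- apply: Or33; have -> : y1 = 1 - y2 by lra.
  lra.
Qed.

(** A zero total would make all three nonnegative coordinates vanish, and with them [c] and [s]. *)
Lemma tri_total_gt0 c s : c ^+ 2 + s ^+ 2 = 1 -> 0 < c + 2 * s - 4 * tri_min c s.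
Proof.
move=> cs1; have [t0 ts tcs _] := tri_minP c s.
rewrite lt_neqAle; apply/andP; split; last by lra.
apply/eqP => E; have t0' : tri_min c s = 0 by lra.
have s0 : s = 0 by lra.
have c0 : c = 0 by lra.
by move: cs1; rewrite s0 c0; lra.
Qed.

End triangle_circle.

Section rose_wedge.
Variables (R : realType) (V : finType) (r : V) (J : {set V * V}).
Local Notation geom S := (set_type (realization R S)).
Local Notation W := (V + (V * V) * bool)%type.
Local Notation X := (geom (rose r J)).
Local Notation C := (set_type (@circle R)).

Let i0 (i : V * V) : W := inr (i, false).
Let i1 (i : V * V) : W := inr (i, true).

Lemma ear0_eq i j : (i0 i == i0 j) = (i == j).
Proof. by apply/eqP/eqP => [[]|->]. Qed.

Lemma ear1_eq i j : (i1 i == i1 j) = (i == j).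
Proof. by apply/eqP/eqP => [[]|->]. Qed.

Lemma ear01_neq i j : (i0 i == i1 j) = false.
Proof. by apply/negbTE/eqP => -[]. Qed.

Lemma ear10_neq i j : (i1 i == i0 j) = false.
Proof. by rewrite eq_sym ear01_neq. Qed.

Lemma rose_support (x : X) : J != finset.set0 -> exists2 i, i \in J &
  (forall w, w != inl r -> w != i0 i -> w != i1 i -> set_val x w = 0) /\
  [\/ set_val x (i0 i) = 0, set_val x (i1 i) = 0 | set_val x (inl r) = 0].
Proof.
move=> /set0Pn[j jJ].
have zero w : w \notin supp (set_val x) -> set_val x w = 0.
  exact: realization_notin.
have := realization_supp x; rewrite finset.in_setU1 => /predU1P[sE|/earsP[i iJ]].
  (* The root lies on every ear, so any [j] is a witness. *)
  exists j => //; split; last by apply: Or31; apply: zero; rewrite sE inE.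
  by move=> w wr _ _; apply: zero; rewrite sE inE.
rewrite inE !in_cons in_nil orbF => sE; exists i => //; split.
  move=> w wr w0 w1; apply: zero.
  by case/orP: sE => [|/or4P[]] => /eqP ->; rewrite !inE ?(negbTE wr) ?(negbTE w0) ?(negbTE w1).
case/orP: sE => [|/or4P[]] => /eqP sE.
- by apply: Or32; apply: zero; rewrite sE !inE ear10_neq.
- by apply: Or31; apply: zero; rewrite sE !inE ear01_neq.
- by apply: Or33; apply: zero; rewrite sE !inE.
- by apply: Or32; apply: zero; rewrite sE !inE ear10_neq.
- by apply: Or31; apply: zero; rewrite sE !inE ear01_neq.
Qed.

Lemma rose_sum (x : X) i :
  (forall w, w != inl r -> w != i0 i -> w != i1 i -> set_val x w = 0) ->
  set_val x (inl r) + (set_val x (i0 i) + set_val x (i1 i)) = 1.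
Proof.
move=> xz; rewrite -(realization_sum x) (bigD1 (inl r)) //=.
rewrite (bigD1 (i0 i)) //= (bigD1 (i1 i)) //=; last first.
  by rewrite ear10_neq.
by rewrite big1 ?addr0 // => w /andP[/andP[wr w0] w1]; exact: xz.
Qed.

Lemma rose_boundary (x : X) i : J != finset.set0 ->
  tri_boundary (set_val x (i0 i)) (set_val x (i1 i)).
Proof.
move=> J0; have [j jJ [xz xj]] := rose_support x J0; have xs := rose_sum xz.
have x0 w := realization_ge0 x w.
have [-> |ij] := eqVneq i j.
  split => //; first by have := x0 (inl r); lra.
  case: xj => E; [exact: Or31|exact: Or32|apply: Or33]; lra.
have -> : set_val x (i0 i) = 0 by apply: xz; rewrite ?ear0_eq ?ear01_neq.
have -> : set_val x (i1 i) = 0 by apply: xz; rewrite ?ear1_eq ?ear10_neq.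
by split; [lra|lra|lra|exact: Or31].
Qed.

Lemma exists_to_circle i : J != finset.set0 ->
  exists2 f : X -> C, continuous f & forall x,
    set_val (f x) =
      (loop_c (set_val x (i0 i)) (set_val x (i1 i)) /
         loop_norm (set_val x (i0 i)) (set_val x (i1 i)),
       loop_s (set_val x (i0 i)) (set_val x (i1 i)) /
         loop_norm (set_val x (i0 i)) (set_val x (i1 i))).
Proof.
move=> J0.
pose y0 (x : X) := set_val x (i0 i); pose y1 (x : X) := set_val x (i1 i).
have l0 x : 0 < loop_norm (y0 x) (y1 x) by apply/loop_norm_gt0/rose_boundary.
pose F x := (loop_c (y0 x) (y1 x) / loop_norm (y0 x) (y1 x),
  loop_s (y0 x) (y1 x) / loop_norm (y0 x) (y1 x)).
have FP x : F x \in @circle R.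
  apply/mem_set; rewrite /circle /= !expr_div_n -mulrDl sqr_sqrtr.
    by rewrite divff // gt_eqF // -sqrtr_gt0; exact: l0.
  by rewrite addr_ge0 // sqr_ge0.
exists (fun x => SigSub (FP x)) => //; apply: continuous_to_set_type.
have c0 : continuous y0 by exact: continuous_coord.
have c1 : continuous y1 by exact: continuous_coord.
have cc : continuous (fun x => loop_c (y0 x) (y1 x)).
  apply: continuousBT; first exact: continuous_cstT.
  apply: continuousMT; [exact: continuous_cstT|exact: continuousDT].
have cs : continuous (fun x => loop_s (y0 x) (y1 x)) by exact: continuousBT.
have cl : continuous (fun x => (loop_norm (y0 x) (y1 x))^-1).
  apply: continuousVT; first by move=> x; rewrite gt_eqF.
  apply: (@continuous_compT _ _ _ (fun x => loop_c (y0 x) (y1 x) ^+ 2 +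
    loop_s (y0 x) (y1 x) ^+ 2) (@Num.sqrt R)); last exact: sqrt_continuous.
  by apply: continuousDT; apply: continuousMT.
by apply: continuous_pair; exact: continuousMT.
Qed.

Lemma exists_from_circle i : i \in J ->
  exists2 g : C -> X, continuous g & forall p w,
    let c := (set_val p).1 in let s := (set_val p).2 in let t := tri_min c s in
    set_val (g p) w = ((c + s - 2 * t) *+ (w == inl r) + (s - t) *+ (w == i0 i) +
      (- t) *+ (w == i1 i)) / (c + 2 * s - 4 * t).
Proof.
move=> iJ.
pose c (p : C) := (set_val p).1; pose s (p : C) := (set_val p).2.
pose t p := tri_min (c p) (s p).
pose F p w := (c p + s p - 2 * t p) *+ (w == inl r) + (s p - t p) *+ (w == i0 i) +
  (- t p) *+ (w == i1 i).
have tP p := tri_minP (c p) (s p).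
have cs1 (p : C) : c p ^+ 2 + s p ^+ 2 = 1 by have := set_valP p.
have F0 p w : 0 <= F p w.
  have [t0 ts tcs _] := tP p; rewrite -/(t p) in t0 ts tcs.
  by rewrite /F !addr_ge0 // mulrn_wge0 //; lra.
have Fr p : F p (inl r) = c p + s p - 2 * t p.
  by rewrite /F eqxx /= !mulr0n !addr0 mulr1n.
have F0E p : F p (i0 i) = s p - t p.
  by rewrite /F eqxx ear01_neq /= !mulr0n addr0 add0r mulr1n.
have F1E p : F p (i1 i) = - t p.
  by rewrite /F eqxx ear10_neq /= !mulr0n !add0r mulr1n.
have Foth p w : w != inl r -> w != i0 i -> w != i1 i -> F p w = 0.
  by rewrite /F => /negbTE-> /negbTE-> /negbTE->; rewrite !mulr0n !addr0.
have Fsum p : \sum_w F p w = c p + 2 * s p - 4 * t p.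
  rewrite (bigD1 (inl r)) //= (bigD1 (i0 i)) //= (bigD1 (i1 i)) //=; last first.
    by rewrite ear10_neq.
  rewrite big1 => [|w /andP[/andP[wr w0] w1]]; last exact: Foth.
  rewrite Fr F0E F1E; lra.
have tot p : 0 < \sum_w F p w by rewrite Fsum; exact: tri_total_gt0.
have [g cg gE] : exists2 g : C -> X, continuous g &
    forall p w, set_val (g p) w = F p w / \sum_w' F p w'.
  apply: exists_normalized_map => //.
  - move=> p; apply: contrapT => nF; have := tot p; rewrite big1 ?ltxx // => w _.
    apply/eqP; rewrite eq_le F0 andbT leNgt; apply/negP => Fw; apply: nF; by exists w.
  - move=> p; have sub : supp (F p) \subset [set inl r; i0 i; i1 i]%SET.
      apply/fintype.subsetP => w; rewrite inE; apply: contraNT.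
      rewrite !inE !negb_or => /andP[/andP[wr w0] w1]; apply/eqP; exact: Foth.
    have s0 : supp (F p) != finset.set0.
      apply/negP => /eqP sE; have := tot p; rewrite big1 ?ltxx // => w _.
      by apply/eqP; have := finset.in_set0 w; rewrite -sE inE => /negbFE.
    (* [tri_min] attains one of its three bounds, and the corresponding coordinate is zero; the
       support is therefore a proper face of the triangle. *)
    have : [|| (inl r : W) \notin supp (F p), i0 i \notin supp (F p) | i1 i \notin supp (F p)].
      rewrite !inE !negbK Fr F0E F1E; have [_ _ _ tE] := tP p; rewrite -/(t p) in tE.
      case: tE => E; apply/or3P; [apply: Or33|apply: Or32|apply: Or31]; apply/eqP; lra.
    have earJ (a : {set W}) : a \in ear i (inl r) (inl r) -> a \in rose r J.
      by move=> ai; rewrite finset.in_setU1; apply/orP; right; apply/earsP; exists i.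
    have rR : [set inl r : W]%SET \in rose r J by rewrite finset.setU11.
    have i0R : [set i0 i]%SET \in rose r J.
      by apply: earJ; rewrite inE !in_cons eqxx.
    have i1R : [set i1 i]%SET \in rose r J.
      by apply: earJ; rewrite inE !in_cons eqxx !orbT.
    have i01R : [set i0 i; i1 i]%SET \in rose r J.
      by apply: earJ; rewrite inE !in_cons eqxx !orbT.
    have i0rR : [set inl r; i0 i]%SET \in rose r J.
      by rewrite finset.setUC; apply: earJ; rewrite inE !in_cons eqxx !orbT.
    have i1rR : [set inl r; i1 i]%SET \in rose r J.
      by rewrite finset.setUC; apply: earJ; rewrite inE !in_cons eqxx !orbT.
    have [-> |[]] := sub_triple sub s0; first by rewrite !inE !eqxx !orbT.
    + by move=> /sub_pair/(_ s0)[]->.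
    + by move=> /sub_pair/(_ s0)[]->.
    + by move=> /sub_pair/(_ s0)[]->.
  - have cc : continuous c.
      apply: (@continuous_compT _ _ _ (@set_val _ (@circle R)) fst).
        exact: set_val_continuous.
      exact: continuous_fst.
    have cs : continuous s.
      apply: (@continuous_compT _ _ _ (@set_val _ (@circle R)) snd).
        exact: set_val_continuous.
      exact: continuous_snd.
    have ct : continuous t.
      apply: continuous_minT; first exact: continuous_cstT.
      apply: continuous_minT => //; apply: continuousMT; last exact: continuous_cstT.
      exact: continuousDT.
    have cMn (h : C -> R) (b : bool) : continuous h -> continuous (fun p => h p *+ b).
      by move=> ch; case: b => //=; exact: continuous_cstT.
    move=> w; apply: continuousDT; first apply: continuousDT; apply: cMn.
    + apply: continuousBT; first exact: continuousDT.
      by apply: continuousMT => //; exact: continuous_cstT.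
    + exact: continuousBT.
    + exact: continuousNT.
by exists g => // p w; rewrite /= gE Fsum.
Qed.

Lemma rose_point : J = finset.set0 ->
  homotopy_equivalent R X (set_type [set (0 : R)]).
Proof.
move=> JE; pose P := set_type [set (0 : R)].
have suppE (x : X) : supp (set_val x) = [set inl r]%SET.
  have := realization_supp x; rewrite finset.in_setU1 => /predU1P[//|/earsP[i iJ]].
  by have := finset.in_set0 i; rewrite -JE iJ.
have xE (x : X) w : set_val x w = (w == inl r)%:R.
  have xz w' : w' != inl r -> set_val x w' = 0.
    by move=> wr; apply: realization_notin; rewrite suppE inE.
  have [->|wr] := eqVneq w (inl r); last exact: xz.
  by rewrite -(realization_sum x) (bigD1 (inl r)) //= big1 ?addr0.
have [g cg gE] : exists2 g : P -> X, continuous g &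
    forall p w, set_val (g p) w = (w == inl r)%:R.
  apply: (@exists_realization_map _ _ _ _ (fun _ w => (w == inl r)%:R)).
  - by move=> p w; rewrite ler0n.
  - move=> p; rewrite (bigD1 (inl r)) //= eqxx big1 ?addr0 // => w /negbTE->.
    by [].
  - move=> p; rewrite (_ : supp _ = [set inl r]%SET) ?finset.setU11 //.
    by apply/setP => w; rewrite !inE pnatr_eq0 eqb0 negbK.
  - by move=> w; exact: continuous_cstT.
have zP : (0 : R) \in [set (0 : R)] by apply/mem_set.
exists (fun=> SigSub zP), g; split => //.
- exact: cst_continuous.
- rewrite (_ : _ \o _ = idfun); last first.
    by apply/funext => x; apply: realization_eq => w; rewrite /= gE xE.
  by apply: homotopic_maps_refl => x; exact: cvg_id.
- rewrite (_ : _ \o _ = idfun); last first.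
    apply/funext => p; apply: val_inj; rewrite /=.
    by have /set_mem := valP p => ->.
  by apply: homotopic_maps_refl => x; exact: cvg_id.
Qed.

(** The two maps are mutually inverse: each ear is carried to its circle by radial projection, with
    the root going to the base point. *)
Lemma rose_circles m : #|J| = m.+1 ->
  homotopy_equivalent R X (wedge_of_circles R m.+1).
Proof.
move=> nE.
have J0 : J != finset.set0 by rewrite -finset.card_gt0 nE.
have [en [enJ en_inj en_surj]] : exists en : 'I_m.+1 -> V * V, [/\ forall k, en k \in J,
    injective en & forall i, i \in J -> exists k, en k = i].
  exists (fun k => enum_val (cast_ord (esym nE) k)); split.
  - by move=> k; exact: enum_valP.
  - by move=> k j /enum_val_inj/cast_ord_inj.
  - move=> i iJ; exists (cast_ord nE (enum_rank_in iJ i)).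
    by rewrite cast_ordK enum_rankK_in.
clear nE.
have /choice[c cP] (k : 'I_m.+1) : exists f : X -> C, continuous f /\ forall x,
    set_val (f x) =
      (loop_c (set_val x (i0 (en k))) (set_val x (i1 (en k))) /
         loop_norm (set_val x (i0 (en k))) (set_val x (i1 (en k))),
       loop_s (set_val x (i0 (en k))) (set_val x (i1 (en k))) /
         loop_norm (set_val x (i0 (en k))) (set_val x (i1 (en k)))).
  by have [f cf fE] := exists_to_circle (en k) J0; exists f.
have /choice[g gP] (k : 'I_m.+1) : exists g : C -> X, continuous g /\ forall p w,
    let c := (set_val p).1 in let s := (set_val p).2 in let t := tri_min c s in
    set_val (g p) w = ((c + s - 2 * t) *+ (w == inl r) +
      (s - t) *+ (w == i0 (en k)) + (- t) *+ (w == i1 (en k))) /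
      (c + 2 * s - 4 * t).
  by have [h ch hE] := exists_from_circle (enJ k); exists h.
pose P0 (k : 'I_m.+1) : C := circle_base R.
have c_base k (x : X) : set_val x (i0 (en k)) = 0 ->
    set_val x (i1 (en k)) = 0 -> c k x = circle_base R.
  move=> x0 x1; apply: set_val_inj; have [_ ->] := cP k.
  rewrite x0 x1 /loop_norm /loop_c /loop_s addr0 mulr0 !subr0.
  by rewrite expr1n expr0n addr0 sqrtr1 mul0r divr1.
have g_base k j : g k (P0 k) = g j (P0 j).
  have t0 : tri_min 1 0 = 0 :> R.
    by symmetry; apply: tri_min_unique; try lra; exact: Or31.
  have gkE k' w : set_val (g k' (P0 k')) w = (w == inl r)%:R.
    have [_ ->] := gP k'; rewrite /= t0 !mulr0 subr0 !addr0 subr0 oppr0.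
    by rewrite !mul0rn !addr0 divr1.
  by apply: realization_eq => w; rewrite !gkE.
pose G : wedge P0 -> X := wedge_fun g.
have cG : continuous G.
  by apply: wedge_fun_continuous => // k; have [] := gP k.
have /choice[kk kkP] (x : X) : exists k, forall w, w != inl r ->
    w != i0 (en k) -> w != i1 (en k) -> set_val x w = 0.
  have [i iJ [xz _]] := rose_support x J0; have [k kE] := en_surj i iJ.
  by exists k; rewrite kE.
pose lift k : C -> wedge P0 := @wedge_lift _ (fun _ : 'I_m.+1 => C : topologicalType) P0 k.
(* The point lies on the [k]-th ear; the root satisfies this for every [k]. *)
pose on k (x : X) := forall j, j != k ->
  set_val x (i0 (en j)) = 0 /\ set_val x (i1 (en j)) = 0.
have on_kk x : on (kk x) x.
  move=> j jk; have ej : en j != en (kk x) by rewrite (inj_eq en_inj).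
  by split; apply: kkP; rewrite ?ear0_eq ?ear1_eq ?ear01_neq ?ear10_neq.
pose F (x : X) : wedge P0 := lift (kk x) (c (kk x) x).
have FE x k : on k x -> F x = lift k (c k x).
  move=> kx; rewrite /F; have [->//|ne] := eqVneq (kk x) k.
  have [x0 x1] := kx _ ne; rewrite c_base //.
  have [] := on_kk x k; first by rewrite eq_sym.
  move=> y0 y1; rewrite c_base //.
  exact: (@wedge_liftE _ (fun _ : 'I_m.+1 => C : topologicalType) P0 k (P0 k) (kk x) (P0 k)).
have cF : continuous F.
  move=> x U UFx.
  have nbhsS (A B : set X) : (forall y, A y -> B y) -> nbhs x A -> nbhs x B.
    by move=> AB; exact: filterS.
  (* The index [kk] is chosen pointwise and need not be locally constant. If [x] is not on the
     [k]-th ear, neither is any nearby point; if it is, [FE] identifies [F x] with the value of a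
     continuous map. Finitely many indices allow a common neighbourhood. *)
  have : \forall y \near x, forall k, on k y -> U (lift k (c k y)).
    apply: (@filter_forall X 'I_m.+1
      (fun k y => on k y -> U (lift k (c k y))) (nbhs x) _) => k.
    have [kx|nkx] := pselect (on k x).
      have [ck _] := cP k.
      have cl : continuous (fun y : X => lift k (c k y)).
        apply: (@continuous_compT _ _ _ (c k) (lift k)) => //.
        exact: (@wedge_lift_continuous _ (fun _ : 'I_m.+1 => C : topologicalType) P0 k).
      have Uk : nbhs x (fun y => U (lift k (c k y))).
        by apply: (cl x U); rewrite -FE.
      by apply: nbhsS Uk => y Uy _.
    have [w [xw nw]] : exists w, set_val x w != 0 /\
        forall y, on k y -> set_val y w = 0.
      apply: contrapT => nw; apply: nkx => j jk; split; apply/eqP/negPn/negP => xj;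
        apply: nw.
      - by exists (i0 (en j)); split => // y /(_ j jk)[].
      - by exists (i1 (en j)); split => // y /(_ j jk)[].
    have : \forall y \near x, set_val y w != 0.
      have cw := @continuous_coord R _ (rose r J) w.
      have : nbhs (set_val x w : R) [set u : R | u != 0].
        by apply: open_nbhs_nbhs; split => //; exact: open_neq.
      exact: (cw x).
    by apply: nbhsS => y yw ky; rewrite nw // eqxx in yw.
  by apply: nbhsS => y Uy; exact: Uy (kk y) (on_kk y).
have GF x : G (F x) = x.
  rewrite /G /F wedge_lift_funE //; set k := kk x.
  have bd := rose_boundary x (en k) J0.
  have l0 : 0 < (loop_norm (set_val x (i0 (en k))) (set_val x (i1 (en k))))^-1.
    by rewrite invr_gt0 loop_norm_gt0.
  have xsum := rose_sum (kkP x).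
  apply: realization_eq => w; have [_ ->] := gP k; have [_ ->] := cP k.
  (* Radial projection multiplies all three coordinates by the inverse norm [l], which cancels in
     the normalisation. *)
  rewrite /= tri_min_loop // -/k.
  move: l0 xsum; rewrite -/k.
  set l := (loop_norm _ _)^-1; set y0 := set_val x (i0 _); set y1 := set_val x (i1 _).
  set yr := set_val x (inl r) => l0 xsum; rewrite /loop_c /loop_s.
  have yrE : yr = 1 - (y0 + y1) by lra.
  have -> : (1 - 2 * (y0 + y1)) * l + 2 * ((y0 - y1) * l) - 4 * (- y1 * l) = l by lra.
  have -> : (1 - 2 * (y0 + y1)) * l + (y0 - y1) * l - 2 * (- y1 * l) = yr * l.
    by rewrite yrE; lra.
  have -> : (y0 - y1) * l - - y1 * l = y0 * l by lra.
  have -> : - (- y1 * l) = y1 * l by lra.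
  have lN : l != 0 by rewrite gt_eqF.
  have [->|wr] := eqVneq w (inl r).
    by rewrite /= !mulr0n !addr0 mulr1n mulfK.
  have [->|w0] := eqVneq w (i0 (en k)).
    by rewrite ear01_neq !mulr0n addr0 add0r mulr1n mulfK.
  have [->|w1] := eqVneq w (i1 (en k)).
    by rewrite !mulr0n !add0r mulr1n mulfK.
  by rewrite !mulr0n !addr0 mul0r kkP.
have FG z : F (G z) = z.
  have : [set: wedge P0] z by [].
  rewrite -wedgeTE => -[k _ [p _ <-]]; rewrite /G wedge_lift_funE //.
  have gz w : w != inl r -> w != i0 (en k) -> w != i1 (en k) ->
      set_val (g k p) w = 0.
    have [_ ->] := gP k; move=> /negbTE-> /negbTE-> /negbTE->.
    by rewrite !mulr0n !addr0 mul0r.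
  rewrite (FE _ k); last first.
    move=> j jk; have ej : en j != en k by rewrite (inj_eq en_inj).
    by split; apply: gz; rewrite ?ear0_eq ?ear1_eq ?ear01_neq ?ear10_neq.
  congr (lift k _); apply: set_val_inj; have [_ ->] := cP k; have [_ gE] := gP k.
  have := set_valP p; rewrite /circle /= => p1.
  have T0 := tri_total_gt0 p1; rewrite !gE /= !eqxx ear01_neq ear10_neq /=.
  rewrite [RHS]surjective_pairing; move: p1 T0.
  set a := (set_val p).1; set b := (set_val p).2; set t := tri_min a b => p1 T0.
  rewrite !mulr0n !mulr1n !add0r !addr0.
  set T := a + 2 * b - 4 * t in T0 *.
  have TN : T != 0 by rewrite gt_eqF.
  have cE : loop_c ((b - t) / T) (- t / T) = a / T.
    rewrite /loop_c -mulrDl; apply: (mulIf TN).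
    by rewrite mulrBl mul1r mulrA !divfK // /T; lra.
  have sE : loop_s ((b - t) / T) (- t / T) = b / T.
    by rewrite /loop_s -mulrBl; congr (_ / _); lra.
  have lE : loop_norm ((b - t) / T) (- t / T) = T^-1.
    rewrite /loop_norm cE sE !expr_div_n -mulrDl p1 mul1r -exprVn sqrtr_sqr.
    by rewrite ger0_norm // invr_ge0 ltW.
  by rewrite lE cE sE !invrK !divfK.
exists F, G; split => //.
- rewrite (_ : _ \o _ = idfun); last exact/funext.
  by apply: homotopic_maps_refl => x; exact: cvg_id.
- rewrite (_ : _ \o _ = idfun); last exact/funext.
  by apply: homotopic_maps_refl => x; exact: cvg_id.
Qed.

Lemma rose_wedge : homotopy_equivalent R X (wedge_of_circles R #|J|).
Proof.
case nE: #|J| => [|m]; last exact: rose_circles.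
by apply: rose_point; apply/eqP; rewrite -finset.cards_eq0 nE.
Qed.

End rose_wedge.

Theorem mainTheorem1 (R : realType) (G : sgraph)
    (G_connected : graph_connected G)
    (G_degree : (max_degree G <= 4)%N)
    (G_not_O3 : ~ graph_iso G (octahedral_graph 3)) :
  (exists n : nat, homotopy_equivalent R (Cl_space R G) (wedge_of_circles R n))
  /\ homotopy_K_permanent R G.
Proof.
have deg4 (v : G) : (degree v <= 4)%N by exact: leq_trans (degree_max v) G_degree.
have noct (a b c x y z : G) : ~ octahedron a b c x y z.
  by move=> oct; exact: G_not_O3 (octahedron_iso G_connected deg4 oct).
split.
  have [T [conT tfT] GT] := exists_triangle_free R G_connected deg4 noct.
  have [r [J TJ]] := triangle_free_rose R conT tfT.
  exists #|J|; apply: homotopy_equivalent_trans GT _.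
  by apply: homotopy_equivalent_trans TJ _; exact: rose_wedge.
by move=> n _; apply: sun_local_iter; exact: low_degree_sun_local.
Qed.
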